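(* Consider a single-output ($n_y=1$) system satisfying the system, noise and input assumptions (S), (N), (I) of the context, and let the order $n=n(N)$ of the high-order ARX model satisfy the order assumption (O). Let $\hat{\boldsymbol a}_{\mathrm{wls}}$ and $\hat{\boldsymbol\eta}_{\mathrm{wls}}$ be the estimates produced by Steps 3 and 5 of the multi-step least-squares procedure described in the context. Then $$\hat{\boldsymbol a}_{\mathrm{wls}}\to \boldsymbol a,\qquad \hat{\boldsymbol\eta}_{\mathrm{wls}}\to\boldsymbol\eta,\qquad \text{as } N\to\infty \text{ with probability one.}$$
   Context: **System.** $x_{k+1}=Ax_k+Bu_k+Ke_k$, $y_k=Cx_k+e_k$, with $x_k\in\mathbb R^{n_x}$, $u_k\in\mathbb R^{n_u}$, $y_k,e_k\in\mathbb R^{n_y}$; here $n_y=1$. Put $A_K=A-KC$, $B_K=[B\ K]$, $z_k=[u_k^\top\ y_k^\top]^\top\in\mathbb R^{n_z}$, $n_z=n_u+1$. Predictor form: $x_{k+1}=A_Kx_k+B_Kz_k$, $y_k=Cx_k+e_k$. Predictor Markov parameters: $g_i=CA_K^{i-1}B_K\in\mathbb R^{1\times n_z}$, $i\ge 1$. (S) $\rho(A)\le 1$, $\rho(A_K)<1$ ($\rho$ = spectral radius), $(A,[B\ K])$ controllable, $(A,C)$ observable, $n_x$ known. (N) With $\mathcal F_{k-1}$ the $\sigma$-algebra generated by $\{e_j,u_j: j\le k-1\}$: $\mathbb E(e_k|\mathcal F_{k-1})=0$, $\mathbb E(e_ke_k^\top|\mathcal F_{k-1})=\sigma_e^2I$,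 $\mathbb E|e_k|^{10}\le c$ for a constant $c$. (I) $u_k=-F_y(q)y_k+r_k$ ($F_y=0$ is open loop; $q^{-1}$ is the backward shift), where: (1) $\{r_k\}$ is independent of $\{e_k\}$, uniformly bounded, and $f_N$-quasi-stationary with $f_N=\sqrt{\log N/N}$; (2) the spectrum of $\{r_k\}$ factorizes as $\Psi_r(z)=\psi_r(z)\psi_r(z^{-1})$ with $\psi_r$ causal and BIBO stable; (3) the closed-loop system (from $(r,e)$ to $(u,y)$) is $f_N$-stable with $f_N=1/\sqrt N$; (4) $F_y(z)$ is bounded on the unit circle; (5) the spectral density of $[r_k^\top\ e_k^\top]^\top$ is bounded from below by $\delta I$ for some $\delta>0$. Here a sequence $v_t$ is $f_N$-quasi-stationary ($f_N\downarrow0$) if, with $R^N_{v}(\tau)$ the sample covariance $\frac1N\sum_t v_tv_{t-\tau}^\top$ over $t,t-\tau\in\{1,\dots,N\}$ (zero for $|\tau|\ge N$), there is $R_v(\tau)$ with $\sup_{|\tau|\le N}\|R^N_v(\tau)-R_v(\tau)\|\le C_1f_N$ and $\frac1N\sum_{t=-N}^N\|v_t\|^2\le C_2$ for all large $N$; a filter $\sum_k h_kq^{-k}$ is $f_N$-stable if $\sum_{k\ge1}\|h_k\|/f_k<\infty$. (O) $n(N)\to\infty$; $n^{4+\delta}(N)/N\to0$ for some $\delta>0$; $\sqrt N\,d(N)\to0$ with $d(N)=\sum_{k>n(N)}\|CA_K^{k-1}B_K\|$. **Canonical form.** State coordinates are chosen so that $C=[1\ 0\cdots0]$, and $A_K$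 has first column $(-a_1,\dots,-a_{n_x})^\top$, ones on the superdiagonal and zeros elsewhere; $B,K$ are unstructured. Parameters: $\boldsymbol a=[a_{n_x}\ a_{n_x-1}\cdots a_1]$ and $\boldsymbol\eta=\mathrm{Vec}(B_K)$. $\mathrm{Vec}$ is vectorization by rows, giving a row vector. **Procedure.** A single trajectory is used, indexed so that $y_k$ and $\boldsymbol z_n(k)=[z_{k-1}^\top\cdots z_{k-n}^\top]^\top$ are available for $k=1,\dots,N$. Hats on Hankel matrices mean that $g_i$ is replaced by $\hat g_i$. Step 1: $\hat{\boldsymbol g}_n=[\hat g_1\cdots\hat g_n]=r_nR_n^{-1}$, $r_n=\frac1N\sum_{k=1}^Ny_k\boldsymbol z_n^\top(k)$, $R_n=\frac1N\sum_{k=1}^N\boldsymbol z_n(k)\boldsymbol z_n^\top(k)$. Step 2: Let $p=n-n_x$; $\mathcal H_{n_xn}$ is the block Hankel matrix with $(i,j)$ block $g_{i+j-1}$, $1\le i\le n_x+1$, $1\le j\le p$; $\mathcal H^+_{n_xn}$ is its first $n_x$ rows and $\mathcal H^-_{n_xn}$ its last row (so $\boldsymbol a\mathcal H^+_{n_xn}+\mathcal H^-_{n_xn}=0$). Set $\hat{\boldsymbol a}_{\mathrm{ols}}=-\hat{\mathcal H}^-_{n_xn}(\hat{\mathcal H}^+_{n_xn})^\top\big(\hat{\mathcal H}^+_{n_xn}(\hat{\mathcal H}^+_{n_xn})^\top\big)^{-1}$. Step 3: $\mathcal K_n(\boldsymbol a)=\mathcal T_{n,p}(\boldsymbol a)\otimes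 I_{n_z}$, where $\mathcal T_{n,p}(\boldsymbol a)$ is the $n\times p$ Toeplitz matrix with first column $[\boldsymbol a\ 1\ 0\cdots0]^\top$ and first row $[a_{n_x}\ 0\cdots0]$; $\hat\Lambda_n(\hat{\boldsymbol a}_{\mathrm{ols}})=\mathcal K_n^\top(\hat{\boldsymbol a}_{\mathrm{ols}})R_n^{-1}\mathcal K_n(\hat{\boldsymbol a}_{\mathrm{ols}})$; $\hat{\boldsymbol a}_{\mathrm{wls}}=-\hat{\mathcal H}^-_{n_xn}\hat\Lambda_n^{-1}(\hat{\boldsymbol a}_{\mathrm{ols}})(\hat{\mathcal H}^+_{n_xn})^\top\hat M^{-1}$ with $\hat M=\hat{\mathcal H}^+_{n_xn}\hat\Lambda_n^{-1}(\hat{\boldsymbol a}_{\mathrm{ols}})(\hat{\mathcal H}^+_{n_xn})^\top$. Let $\hat A_K$ be the canonical $A_K$ with $\hat{\boldsymbol a}_{\mathrm{wls}}$ inserted. Step 4: $\mathcal O_{n-1}=[C^\top\ (CA_K)^\top\cdots(CA_K^{n-1})^\top]^\top$, $\Phi_n=\mathcal O_{n-1}^\top\otimes I_{n_z}$ (so $\boldsymbol\eta\Phi_n=\boldsymbol g_n=[g_1\cdots g_n]$); $\hat\Phi_n$ is $\Phi_n$ with $A_K$ replaced by $\hat A_K$; $\hat{\boldsymbol\eta}_{\mathrm{ols}}=\hat{\boldsymbol g}_n\hat\Phi_n^\top(\hat\Phi_n\hat\Phi_n^\top)^{-1}$. Step 5: Let $\bar P\in\mathbb R^{n_x\times n_x}$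 be the exchange (anti-identity) matrix, $\bar I=I_{n_x}\otimes[1\ 0\cdots0]\in\mathbb R^{n_x\times n_x^2}$, $S_k(\boldsymbol a)=-\bar P\bar I\sum_{i=0}^{k-1}(CA_K^i)^\top\otimes A_K^{k-i-1}$, $\mathcal S_n(\boldsymbol a)=[0\ S_1(\boldsymbol a)\cdots S_{n-1}(\boldsymbol a)]$, and $$\mathcal K_n(\boldsymbol a,\boldsymbol\eta)=I+\mathcal K_n(\boldsymbol a)\hat\Lambda_n^{-1}(\hat{\boldsymbol a}_{\mathrm{ols}})(\hat{\mathcal H}^+_{n_xn})^\top\hat M^{-1}\mathcal S_n(\boldsymbol a)(I_n\otimes B_K).$$ Put $\hat\Lambda_n(\hat{\boldsymbol a}_{\mathrm{wls}},\hat{\boldsymbol\eta}_{\mathrm{ols}})=\mathcal K_n^\top(\hat{\boldsymbol a}_{\mathrm{wls}},\hat{\boldsymbol\eta}_{\mathrm{ols}})R_n^{-1}\mathcal K_n(\hat{\boldsymbol a}_{\mathrm{wls}},\hat{\boldsymbol\eta}_{\mathrm{ols}})$ and $$\hat{\boldsymbol\eta}_{\mathrm{wls}}=\hat{\boldsymbol g}_n\hat\Lambda_n^{-1}(\hat{\boldsymbol a}_{\mathrm{wls}},\hat{\boldsymbol\eta}_{\mathrm{ols}})\hat\Phi_n^\top\big(\hat\Phi_n\hat\Lambda_n^{-1}(\hat{\boldsymbol a}_{\mathrm{wls}},\hat{\boldsymbol\eta}_{\mathrm{ols}})\hat\Phi_n^\top\big)^{-1}.$$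
   Formalization: The limit of η̂_wls is taken over those N for which Λ̂_n(â_wls, η̂_ols) is invertible, i.e. for which the Step 5 estimate exists; the assumptions do not guarantee this, as K_n(a,η) is singular at the true parameters. The claim for â_wls is unrestricted. *)

(* Defs.v *)
From mathcomp Require Import all_boot all_order all_algebra.
From mathcomp Require Import all_classical all_reals all_analysis.
From mathcomp.real_closed Require Import complex mxtens.
Set Implicit Arguments.
Unset Strict Implicit.
Unset Printing Implicit Defensive.
Import Order.TTheory GRing.Theory Num.Theory.
Import numFieldNormedType.Exports.
Local Open Scope classical_set_scope.
Local Open Scope ring_scope.

(* Signals are indexed by all of Z; a random signal is a map
   int -> T -> 'cV_m.  The output is scalar (n_y = 1), but e_k and y_k are kept
   as 1 x 1 matrices so that every formula is a plain matrix product. *)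

(* Frobenius norm: for row and column vectors, the Euclidean norm. *)
Definition normF (R : realType) (p m : nat) (M : 'M[R]_(p, m)) : R :=
  Num.sqrt (\sum_i \sum_j M i j ^+ 2).

Definition spectral_radius (R : realType) (n : nat) (A : 'M[R]_n) : R :=
  sup [set x : R | exists2 z : R[i],
         eigenvalue (map_mx (real_complex R) A) z & x = complex.Re `|z|].

Definition controllable (R : realType) (n m : nat) (A : 'M[R]_n)
    (B : 'M[R]_(n, m)) : Prop :=
  \rank (\mxrow_(i < n) (A ^+ i *m B)) = n.

Definition observable (R : realType) (n m : nat) (A : 'M[R]_n)
    (C : 'M[R]_(m, n)) : Prop :=
  \rank (\mxcol_(i < n) (C *m A ^+ i)) = n.

(* The row [1 0 ... 0]. *)
Definition e1row (R : realType) (n : nat) : 'rV[R]_n :=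
  \row_(j < n) (j == 0 :> nat)%:R.

(* The vector a is [a_n ... a_1], so the entry -a_(i+1) in row i (counted
   from 0) of the first column is - a 0 (rev_ord i). *)
Definition canonical_AK (R : realType) (n : nat) (a : 'rV[R]_n) : 'M[R]_n :=
  \matrix_(i < n, j < n)
    (if j == 0 :> nat then - a 0 (rev_ord i) else (j == i.+1 :> nat)%:R).

(* Vectorization by rows, as a row vector; mxtens_index (i, j) has value
   i * m + j. *)
Definition rvec (R : realType) (n m : nat) (M : 'M[R]_(n, m)) : 'rV[R]_(n * m) :=
  \row_(l < n * m) M (mxtens_unindex l).1 (mxtens_unindex l).2.

Definition unrvec (R : realType) (n m : nat) (v : 'rV[R]_(n * m)) : 'M[R]_(n, m) :=
  \matrix_(i < n, j < m) v 0 (mxtens_index (i, j)).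

(* A causal filter sum_k h_k q^-k is given by its impulse response h. *)

(* w = h(q) v, the defining series converging at every time. *)
Definition filtered (R : realType) (p m : nat) (h : nat -> 'M[R]_(p, m))
    (v : int -> 'cV[R]_m) (w : int -> 'cV[R]_p) : Prop :=
  forall t : int,
    (fun k : nat => \sum_(0 <= i < k) h i *m v (t - i%:Z)) @ \oo --> w t.

Definition bibo_stable (R : realType) (p m : nat) (h : nat -> 'M[R]_(p, m)) : Prop :=
  cvgn (series (fun k => normF (h k))).

Definition f_stable (R : realType) (p m : nat) (f : nat -> R)
    (h : nat -> 'M[R]_(p, m)) : Prop :=
  cvgn (series (fun k => normF (h k.+1) / f k.+1)).

(* Sum of a complex series. *)
Definition csum (R : realType) (c : nat -> R[i]) : R[i] :=
  Complex (limn (series (fun k => complex.Re (c k))))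
          (limn (series (fun k => complex.Im (c k)))).

(* sum_k s_k z^-k *)
Definition ztransform (R : realType) (s : nat -> R) (z : R[i]) : R[i] :=
  csum (fun k => real_complex R (s k) * z ^- k).

Definition transfer (R : realType) (p m : nat) (h : nat -> 'M[R]_(p, m))
    (z : R[i]) : 'M[R[i]]_(p, m) :=
  \matrix_(i, j) ztransform (fun k => h k i j) z.

Definition cov_summable (R : realType) (m : nat) (S : int -> 'M[R]_m) : Prop :=
  cvgn (series (fun k : nat => normF (S k%:Z) + normF (S (- k%:Z)))).

(* sum over tau in Z of S(tau) z^-tau *)
Definition spectrum (R : realType) (m : nat) (S : int -> 'M[R]_m) (z : R[i]) :
    'M[R[i]]_m :=
  \matrix_(i, j) csum (fun k : nat =>
    if k == 0%N then real_complex R (S 0 i j)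
    else real_complex R (S k%:Z i j) * z ^- k
         + real_complex R (S (- k%:Z) i j) * z ^+ k).

(* N^-1 sum_t v_t v_(t-tau)^T over 1 <= t <= N with 1 <= t - tau <= N. *)
Definition sample_cov (R : realType) (m : nat) (v : int -> 'cV[R]_m) (N : nat)
    (tau : int) : 'M[R]_m :=
  N%:R^-1 *: \sum_(1 <= t < N.+1 | (1 <= t%:Z - tau) && (t%:Z - tau <= N%:Z))
               v t%:Z *m (v (t%:Z - tau))^T.

Definition quasi_stationary (R : realType) (m : nat) (f : nat -> R)
    (v : int -> 'cV[R]_m) (S : int -> 'M[R]_m) : Prop :=
  exists C1 C2 : R, \forall N \near \oo,
    (forall tau : int, `|tau| <= N%:Z ->
       normF (sample_cov v N tau - S tau) <= C1 * f N) /\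
    N%:R^-1 * \sum_(0 <= i < N.*2.+1) normF (v (i%:Z - N%:Z)) ^+ 2 <= C2.

Definition random_signal (R : realType) d (T : measurableType d) (m : nat)
    (v : int -> T -> 'cV[R]_m) : Prop :=
  forall k i, measurable_fun setT (fun w => v k w i 0).

(* The sigma-algebra generated by a set D of real functions. *)
Definition sigma_gen (R : realType) (T : Type) (D : set (T -> R)) : set (set T) :=
  <<s [set E | exists2 X, D X & exists2 U : set R, measurable U & E = X @^-1` U] >>.

Definition sigma_signal (R : realType) (T : Type) (m : nat)
    (v : int -> T -> 'cV[R]_m) : set (set T) :=
  sigma_gen [set X | exists k i, X = fun w => v k w i 0].

(* The sigma-algebra generated by e_j, u_j for j <= k - 1. *)
Definition sigma_past (R : realType) (T : Type) (me mu : nat)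
    (e : int -> T -> 'cV[R]_me) (u : int -> T -> 'cV[R]_mu) (k : int) :
    set (set T) :=
  sigma_gen [set X | exists2 j : int, j <= k - 1 &
     (exists i, X = fun w => e j w i 0) \/ (exists i, X = fun w => u j w i 0)].

Definition independent_sigma (R : realType) d (T : measurableType d)
    (P : probability T R) (F G : set (set T)) : Prop :=
  forall E E', F E -> G E' -> P (E `&` E') = (P E * P E')%E.

(* Y is a version of E(X | F). *)
Definition is_cond_exp (R : realType) d (T : measurableType d)
    (P : probability T R) (F : set (set T)) (X Y : T -> R) : Prop :=
  [/\ P.-integrable setT (EFin \o X), P.-integrable setT (EFin \o Y),
      forall U : set R, measurable U -> F (Y @^-1` U) &
      forall E, F E ->
        (\int[P]_(w in E) (X w)%:E = \int[P]_(w in E) (Y w)%:E)%E].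

Definition is_system (R : realType) d (T : measurableType d)
    (P : probability T R) (nx nu : nat) (A : 'M[R]_nx) (B : 'M[R]_(nx, nu))
    (C : 'rV[R]_nx) (K : 'cV[R]_nx) (x : int -> T -> 'cV[R]_nx)
    (u : int -> T -> 'cV[R]_nu) (y e : int -> T -> 'cV[R]_1) : Prop :=
  [/\ random_signal x, random_signal u, random_signal y, random_signal e &
      {ae P, forall w, forall k : int,
         x (k + 1) w = A *m x k w + B *m u k w + K *m e k w /\
         y k w = C *m x k w + e k w}].

Definition system_assumption (R : realType) (nx nu : nat) (A : 'M[R]_nx)
    (B : 'M[R]_(nx, nu)) (C : 'rV[R]_nx) (K : 'cV[R]_nx) : Prop :=
  [/\ spectral_radius A <= 1, spectral_radius (A - K *m C) < 1,
      controllable A (row_mx B K) & observable A C].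

Definition noise_assumption (R : realType) d (T : measurableType d)
    (P : probability T R) (nu : nat) (u : int -> T -> 'cV[R]_nu)
    (e : int -> T -> 'cV[R]_1) (sigma_e : R) : Prop :=
  [/\ forall k, is_cond_exp P (sigma_past e u k) (fun w => e k w 0 0) (cst 0),
      forall k, is_cond_exp P (sigma_past e u k)
                  (fun w => (e k w *m (e k w)^T) 0 0) (cst (sigma_e ^+ 2)) &
      exists c : R, forall k,
        ('E_P[(fun w => normF (e k w) ^+ 10)%R] <= c%:E)%E].

(* F = den^-1 num with den and num BIBO stable and den scalar.  This gives a
   meaning to F_y(q) y_k and to the values F_y(z) = num(z) / den(z) on the unit
   circle also when the controller F_y is itself unstable; den = 1 recovers
   the convergent convolution when F_y is BIBO stable. *)
Definition stable_fraction (R : realType) (p m : nat) (F : nat -> 'M[R]_(p, m))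
    (den : nat -> R) (num : nat -> 'M[R]_(p, m)) : Prop :=
  [/\ cvgn (series (fun k => `|den k|)), bibo_stable num, den 0%N != 0 &
      forall k, \sum_(i < k.+1) den i *: F (k - i)%N = num k].

(* hu and hy are the responses of u and y, from rest, to unit impulses applied
   at time 0 in each of the inputs (r, e) of the closed loop made of the system
   and of u = -F(q) y + r. *)
Definition closed_loop_impulse (R : realType) (nx nu : nat) (A : 'M[R]_nx)
    (B : 'M[R]_(nx, nu)) (C : 'rV[R]_nx) (K : 'cV[R]_nx)
    (F : nat -> 'cV[R]_nu) (hu : nat -> 'M[R]_(nu, nu + 1))
    (hy : nat -> 'M[R]_(1, nu + 1)) : Prop :=
  let ir k : 'M[R]_(nu, nu + 1) := (k == 0%N)%:R *: row_mx 1%:M 0 in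
  let ie k : 'M[R]_(1, nu + 1) := (k == 0%N)%:R *: row_mx 0 1%:M in
  exists hx : nat -> 'M[R]_(nx, nu + 1),
  [/\ hx 0%N = 0,
      forall k, hx k.+1 = A *m hx k + B *m hu k + K *m ie k,
      forall k, hy k = C *m hx k + ie k &
      forall k, hu k = - (\sum_(i < k.+1) F i *m hy (k - i)%N) + ir k].

Record input_assumption (R : realType) d (T : measurableType d)
    (P : probability T R) (nx nu : nat) (A : 'M[R]_nx) (B : 'M[R]_(nx, nu))
    (C : 'rV[R]_nx) (K : 'cV[R]_nx) (Fy : nat -> 'cV[R]_nu)
    (u r : int -> T -> 'cV[R]_nu) (y e : int -> T -> 'cV[R]_1) : Prop := {
  input_random : random_signal r;
  (* F_y is bounded on the unit circle, and F_y(q) y_k = r_k - u_k. *)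
  input_feedback : exists (den : nat -> R) (num : nat -> 'cV[R]_nu),
    [/\ stable_fraction Fy den num,
        exists M : R, forall z : R[i], `|z| = 1 -> forall i,
          `|transfer num z i 0| <= real_complex R M * `|ztransform den z| &
        {ae P, forall w, exists s : int -> 'cV[R]_nu,
           filtered (fun k => (den k)%:M) (fun t => r t w - u t w) s /\
           filtered num (fun t => y t w) s}];
  input_independent : independent_sigma P (sigma_signal r) (sigma_signal e);
  input_bounded : exists M : R, {ae P, forall w, forall k, normF (r k w) <= M};
  (* For vector r the factorization reads psi(z) psi(z^-1)^T. *)
  input_spectrum : exists (Rr : int -> 'M[R]_nu) (psi : nat -> 'M[R]_nu),
    [/\ {ae P, forall w, quasi_stationary
           (fun N => Num.sqrt (ln (N%:R : R) / N%:R)) (fun t => r t w) Rr},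
        cov_summable Rr, bibo_stable psi &
        forall z : R[i], `|z| = 1 ->
          spectrum Rr z = transfer psi z *m (transfer psi z^-1)^T];
  input_closed_loop : exists (hu : nat -> 'M[R]_(nu, nu + 1))
                             (hy : nat -> 'M[R]_(1, nu + 1)),
    let h k := col_mx (hu k) (hy k) in
    [/\ closed_loop_impulse A B C K Fy hu hy,
        f_stable (fun N => (Num.sqrt N%:R)^-1) h &
        {ae P, forall w, filtered h (fun t => col_mx (r t w) (e t w))
                                    (fun t => col_mx (u t w) (y t w))}];
  input_excitation : exists (Rre : int -> 'M[R]_(nu + 1)) (delta : R),
    [/\ {ae P, forall w, forall tau : int,
           (fun N : nat => sample_cov (fun t => col_mx (r t w) (e t w)) N tau)
             @ \oo --> Rre tau},
        cov_summable Rre, 0 < delta &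
        forall z : R[i], `|z| = 1 -> forall v : 'cV[R[i]]_(nu + 1),
          real_complex R delta * ((map_mx (@conjc R) v)^T *m v) 0 0
            <= ((map_mx (@conjc R) v)^T *m spectrum Rre z *m v) 0 0] }.

(* BK stands for [B K]. *)
Definition order_assumption (R : realType) (nx nz : nat) (C : 'rV[R]_nx)
    (AK : 'M[R]_nx) (BK : 'M[R]_(nx, nz)) (n : nat -> nat) : Prop :=
  let dN (N : nat) : R :=
    limn (fun m => \sum_((n N).+1 <= k < m) normF (C *m AK ^+ k.-1 *m BK)) in
  [/\ n @ \oo --> \oo,
      exists2 delta : R, 0 < delta &
        (fun N : nat => ((n N)%:R : R) `^ (4 + delta) / N%:R) @ \oo --> (0 : R) &
      (fun N : nat => Num.sqrt (N%:R : R) * dN N) @ \oo --> (0 : R)].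

(* The estimates are functions of Rn = R_n and of g, the estimate of
   [g_1 ... g_n].  Inverses are invmx, and invmx M = M for singular M. *)

(* z_n(k) = [z_(k-1)^T ... z_(k-n)^T]^T *)
Definition regressor (R : realType) (nz : nat) (z : int -> 'cV[R]_nz) (n : nat)
    (k : int) : 'cV[R]_(n * nz) :=
  \col_(l < n * nz)
    z (k - ((mxtens_unindex l).1).+1%:Z) (mxtens_unindex l).2 0.

Definition Rhat (R : realType) (nz : nat) (z : int -> 'cV[R]_nz) (n N : nat) :
    'M[R]_(n * nz) :=
  N%:R^-1 *: \sum_(1 <= k < N.+1) regressor z n k%:Z *m (regressor z n k%:Z)^T.

Definition rhat (R : realType) (nz : nat) (y : int -> 'cV[R]_1)
    (z : int -> 'cV[R]_nz) (n N : nat) : 'rV[R]_(n * nz) :=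
  N%:R^-1 *: \sum_(1 <= k < N.+1) y k%:Z *m (regressor z n k%:Z)^T.

Definition ghat (R : realType) (nz : nat) (y : int -> 'cV[R]_1)
    (z : int -> 'cV[R]_nz) (n N : nat) : 'rV[R]_(n * nz) :=
  rhat y z n N *m invmx (Rhat z n N).

(* Entry l of the block g_(i+1) of g = [g_1 ... g_n], 0 if i >= n. *)
Definition gblock (R : realType) (n nz : nat) (g : 'rV[R]_(n * nz)) (i : nat)
    (l : 'I_nz) : R :=
  if insub i is Some i' then g 0 (mxtens_index (i' : 'I_n, l)) else 0.

Definition hankel (R : realType) (nx n nz : nat) (g : 'rV[R]_(n * nz)) :
    'M[R]_(nx + 1, (n - nx) * nz) :=
  \matrix_(i, l) gblock g (i + (mxtens_unindex l).1)%N (mxtens_unindex l).2.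

Definition Hplus (R : realType) (nx n nz : nat) (g : 'rV[R]_(n * nz)) :
    'M[R]_(nx, (n - nx) * nz) := usubmx (hankel nx g).

Definition Hminus (R : realType) (nx n nz : nat) (g : 'rV[R]_(n * nz)) :
    'rV[R]_((n - nx) * nz) := dsubmx (hankel nx g).

Definition a_ols (R : realType) (nx n nz : nat) (g : 'rV[R]_(n * nz)) : 'rV[R]_nx :=
  - Hminus nx g *m (Hplus nx g)^T *m invmx (Hplus nx g *m (Hplus nx g)^T).

(* n x (n - nx) Toeplitz matrix with first column [a 1 0 ... 0]^T and zeros
   above the diagonal. *)
Definition toeplitz (R : realType) (nx : nat) (a : 'rV[R]_nx) (n : nat) :
    'M[R]_(n, n - nx) :=
  let c (k : nat) : R :=
    if insub k is Some k' then a 0 (k' : 'I_nx) else (k == nx)%:R in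
  \matrix_(i, j) (if (j <= i)%N then c (i - j)%N else 0).

Definition Kn (R : realType) (nx n nz : nat) (a : 'rV[R]_nx) :
    'M[R]_(n * nz, (n - nx) * nz) := toeplitz a n *t 1%:M.

Definition Lambda_ols (R : realType) (nx n nz : nat) (Rn : 'M[R]_(n * nz))
    (g : 'rV[R]_(n * nz)) : 'M[R]_((n - nx) * nz) :=
  (Kn n nz (a_ols nx g))^T *m invmx Rn *m Kn n nz (a_ols nx g).

Definition Mhat (R : realType) (nx n nz : nat) (Rn : 'M[R]_(n * nz))
    (g : 'rV[R]_(n * nz)) : 'M[R]_nx :=
  Hplus nx g *m invmx (Lambda_ols nx Rn g) *m (Hplus nx g)^T.

Definition a_wls (R : realType) (nx n nz : nat) (Rn : 'M[R]_(n * nz))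
    (g : 'rV[R]_(n * nz)) : 'rV[R]_nx :=
  - Hminus nx g *m invmx (Lambda_ols nx Rn g) *m (Hplus nx g)^T
    *m invmx (Mhat nx Rn g).

(* Rows C, C A_K, ..., C A_K^(n-1). *)
Definition obsv (R : realType) (nx : nat) (AK : 'M[R]_nx) (n : nat) :
    'M[R]_(n, nx) :=
  \matrix_(i < n) (e1row R nx *m AK ^+ i).

Definition Phi (R : realType) (nx : nat) (AK : 'M[R]_nx) (n nz : nat) :
    'M[R]_(nx * nz, n * nz) := (obsv AK n)^T *t 1%:M.

Definition Phihat (R : realType) (nx n nz : nat) (Rn : 'M[R]_(n * nz))
    (g : 'rV[R]_(n * nz)) : 'M[R]_(nx * nz, n * nz) :=
  Phi (canonical_AK (a_wls nx Rn g)) n nz.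

Definition eta_ols (R : realType) (nx n nz : nat) (Rn : 'M[R]_(n * nz))
    (g : 'rV[R]_(n * nz)) : 'rV[R]_(nx * nz) :=
  g *m (Phihat nx Rn g)^T *m invmx (Phihat nx Rn g *m (Phihat nx Rn g)^T).

Definition exchange_mx (R : realType) (n : nat) : 'M[R]_n :=
  \matrix_(i, j) (j == rev_ord i)%:R.

(* I (x) [1 0 ... 0]; the cast identifies n * 1 with n. *)
Definition Ibar (R : realType) (n : nat) : 'M[R]_(n, n * n) :=
  castmx (muln1 n, erefl (n * n)%N) (1%:M *t e1row R n).

(* The cast identifies 1 * nx with nx. *)
Definition Sk (R : realType) (nx : nat) (a : 'rV[R]_nx) (k : nat) : 'M[R]_nx :=
  let AK := canonical_AK a in
  - (exchange_mx R nx *m Ibar R nx *m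
     \sum_(i < k) castmx (erefl (nx * nx)%N, mul1n nx)
                    ((e1row R nx *m AK ^+ i)^T *t AK ^+ (k - i - 1))).

(* [0 S_1 ... S_(n-1)]; Sk a 0 is an empty sum. *)
Definition Sn (R : realType) (nx : nat) (a : 'rV[R]_nx) (n : nat) :
    'M[R]_(nx, n * nx) :=
  \matrix_(i, l) Sk a (mxtens_unindex l).1 i (mxtens_unindex l).2.

Definition Kn_eta (R : realType) (nx n nz : nat) (Rn : 'M[R]_(n * nz))
    (g : 'rV[R]_(n * nz)) (a : 'rV[R]_nx) (eta : 'rV[R]_(nx * nz)) :
    'M[R]_(n * nz) :=
  1%:M + Kn n nz a *m invmx (Lambda_ols nx Rn g) *m (Hplus nx g)^T
           *m invmx (Mhat nx Rn g) *m Sn a n *m (1%:M *t unrvec eta).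

(* At the true parameters Kn_eta is a projection of corank nx: the error of
   a_wls cancels nx directions of the residual.  Lambda_wls is thus
   nonsingular only generically, and eta_wls is the estimate of the procedure
   only when Lambda_wls is invertible. *)
Definition Lambda_wls (R : realType) (nx n nz : nat) (Rn : 'M[R]_(n * nz))
    (g : 'rV[R]_(n * nz)) : 'M[R]_(n * nz) :=
  let Ke := Kn_eta Rn g (a_wls nx Rn g) (eta_ols nx Rn g) in
  Ke^T *m invmx Rn *m Ke.

Definition eta_wls (R : realType) (nx n nz : nat) (Rn : 'M[R]_(n * nz))
    (g : 'rV[R]_(n * nz)) : 'rV[R]_(nx * nz) :=
  let L := invmx (Lambda_wls nx Rn g) in
  g *m L *m (Phihat nx Rn g)^T
    *m invmx (Phihat nx Rn g *m L *m (Phihat nx Rn g)^T).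

(* Main.v *)
(** On the event that Lambda_wls is invertible, the normal equation of Step 3
gives ghat X = 0 and Cayley-Hamilton gives Phihat X = 0 for the matrix X in
Kn_eta = 1 + X Y, so that Kn_eta fixes both ghat and Phihat and eta_wls is the
weighted least squares estimate with weight R_n.  Hence S_n and eta_ols play no
part in consistency, and a_wls and eta_wls are continuous functions of ghat,
uniformly in n, as soon as c1 <= R_n <= c2 for constants 0 < c1, c2 and
ghat - g_n -> 0 in l2; here the bounds on K_n(a) come from those of the
polynomial a on the unit circle, by Parseval.

Both facts hold on each path along which N^(1/4) times the error of the sample
covariances of s = (r, e), for lags up to 4 N^(1/4), tends to 0 and the energy of
s over windows is at most linear.  The quadratic form of R_n is then the
Toeplitz form of the spectrum of s at the row polynomial v h, with h the impulse
response of the closed loop, and v h is bounded below on the circle because the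
closed loop is inverted by the controller and the predictor.

Almost all paths are of this kind: the products e_t e_(t-k) - sigma^2 and
e_t r_(t-k) are orthogonal sequences, so the Rademacher-Menshov maximal
inequality on dyadic blocks gives the rate, and the part of r is
quasi-stationarity. *)

Require Import Defs.
From mathcomp Require Import all_boot all_order all_algebra.
From mathcomp Require Import all_classical all_reals all_analysis.
From mathcomp.real_closed Require Import complex mxtens.
From mathcomp Require Import perm separable cyclotomic cyclic ring lra zify measurable_realfun.
Set Implicit Arguments.
Unset Strict Implicit.
Unset Printing Implicit Defensive.
Import Order.TTheory GRing.Theory Num.Theory.
Import numFieldNormedType.Exports.
Local Open Scope classical_set_scope.
Local Open Scope ring_scope.

(** * Quadratic forms on row vectors *)

(** The dimensions grow with N, so no constant may depend on n. Bounds are therefore inequalities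
    between squared norms of [v] and [v X], with no eigenvalue or compactness argument in growing
    dimension. The exponents balance as follows. A Toeplitz form in n blocks tolerates entrywise
    errors o(1/n), and n^4 <= N puts this at N^(-1/4). With J = N^(1/4), second moments summed over
    about J lags cost J^2 * J * N / N^2 = N^(-1/4) up to logarithms, which is summable over
    geometric blocks of N. Cutting the filter at lag n leaves an energy of order 1/n, thanks to the
    weight sqrt l given by the stability of the loop; this pays for the n blocks of the regressor.
    Two obstacles shape the rest. The excitation bound concerns covariance limits that come without
    a rate, while rates are proved for a block diagonal candidate; uniqueness of limits identifies
    the two. And [den] may vanish on the circle, so the inverse of the loop is controlled only off
    its zeros: forms are averaged over a finite grid, rotated so as to avoid them. *)

Lemma disc_le (R : realFieldType) (a b c : R) :
  (forall t : R, 0 <= a * t ^+ 2 + 2 * b * t + c) -> b ^+ 2 <= a * c.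
Proof.
move=> h; have c0 : 0 <= c by have := h 0; rewrite expr0n /= !mulr0 !add0r.
have [a0|a0|a0] := ltgtP a 0.
(* The linear terms cancel in the sum of the values at [t] and [- t], and this sum is negative
   because [t >= 1]. *)
- pose t := 1 + c / - a.
  have na : 0 < - a by rewrite oppr_gt0.
  have t1 : 0 <= c / - a by rewrite divr_ge0 // ltW.
  have e1 : - a * t = c - a by rewrite /t; field; rewrite lt_eqF.
  have h1 := h t; have h2 := h (- t).
  have e2 : a * t ^+ 2 + 2 * b * t + c + (a * (- t) ^+ 2 + 2 * b * - t + c) = - 2 * (- a * t) * t + 2 * c by ring.
  have := addr_ge0 h1 h2; rewrite e2 e1 /t => h3; exfalso; nra.
- have := h (- b / a) => h1.
  have : a * (a * (- b / a) ^+ 2 + 2 * b * (- b / a) + c) = a * c - b ^+ 2 by field; rewrite gt_eqF.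
  by move=> e; rewrite -subr_ge0 -e pmulr_rge0.
- rewrite a0 mul0r; have h1 := h (- (c + 1) / (2 * b)).
  case: (eqVneq b 0) => [->|b0]; first by rewrite expr0n.
  move: h1; rewrite a0 mul0r add0r.
  have -> : 2 * b * (- (c + 1) / (2 * b)) = - (c + 1) by field.
  by move=> h1; exfalso; lra.
Qed.

Lemma sum_CS (R : realFieldType) (I : Type) (s : seq I) (P : pred I) (x y : I -> R) :
  (\sum_(i <- s | P i) x i * y i) ^+ 2
  <= (\sum_(i <- s | P i) x i ^+ 2) * (\sum_(i <- s | P i) y i ^+ 2).
Proof.
apply: disc_le => t.
have -> : (\sum_(i <- s | P i) x i ^+ 2) * t ^+ 2 +
    2 * (\sum_(i <- s | P i) x i * y i) * t + \sum_(i <- s | P i) y i ^+ 2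
  = \sum_(i <- s | P i) (x i * t + y i) ^+ 2.
  rewrite mulr_suml mulr_sumr mulr_suml -!big_split /=; apply: eq_bigr => i _; ring.
by apply: sumr_ge0 => i _; rewrite sqr_ge0.
Qed.

Lemma sqr_sum_le (R : realFieldType) (I : finType) (x : I -> R) :
  (\sum_i x i) ^+ 2 <= #|I|%:R * \sum_i x i ^+ 2.
Proof.
have := sum_CS (index_enum I) xpredT (fun=> 1) x.
rewrite (eq_bigr (fun i => x i)); last by move=> i _; rewrite mul1r.
by under [X in _ <= X * _]eq_bigr do rewrite expr1n; rewrite sumr_const.
Qed.

(** Squares avoid roots in products of bounds. The Frobenius norm dominates the operator norm, which
    is all that perturbations require. *)
Definition sqn (R : realType) (p q : nat) (M : 'M[R]_(p, q)) : R :=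
  \sum_i \sum_j M i j ^+ 2.

Lemma normF_sqn (R : realType) (p q : nat) (M : 'M[R]_(p, q)) : normF M = Num.sqrt (sqn M).
Proof. by []. Qed.

Lemma sqn_ge0 (R : realType) (p q : nat) (M : 'M[R]_(p, q)) : 0 <= sqn M.
Proof. by apply: sumr_ge0 => i _; apply: sumr_ge0 => j _; rewrite sqr_ge0. Qed.

Lemma normF_sqr (R : realType) (p q : nat) (M : 'M[R]_(p, q)) : normF M ^+ 2 = sqn M.
Proof. by rewrite normF_sqn sqr_sqrtr ?sqn_ge0. Qed.

Lemma normF_ge0 (R : realType) (p q : nat) (M : 'M[R]_(p, q)) : 0 <= normF M.
Proof. exact: sqrtr_ge0. Qed.

Lemma sqnE (R : realType) (q : nat) (v : 'rV[R]_q) : sqn v = \sum_j v 0 j ^+ 2.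
Proof. by rewrite /sqn big_ord1. Qed.

Lemma sqn_colE (R : realType) (q : nat) (v : 'cV[R]_q) : sqn v = \sum_j v j 0 ^+ 2.
Proof. by apply: eq_bigr => i _; rewrite big_ord1. Qed.

Lemma sqn_dot (R : realType) (q : nat) (v : 'rV[R]_q) : sqn v = (v *m v^T) 0 0.
Proof. by rewrite sqnE mxE; apply: eq_bigr => j _; rewrite mxE. Qed.

Lemma sqn_tr (R : realType) (p q : nat) (M : 'M[R]_(p, q)) : sqn M^T = sqn M.
Proof.
rewrite /sqn exchange_big; apply: eq_bigr => i _; apply: eq_bigr => j _; by rewrite mxE.
Qed.

Lemma sqnN (R : realType) (p q : nat) (M : 'M[R]_(p, q)) : sqn (- M) = sqn M.
Proof. by apply: eq_bigr => i _; apply: eq_bigr => j _; rewrite mxE sqrrN. Qed.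

Lemma sqn0 (R : realType) (p q : nat) : sqn (0 : 'M[R]_(p, q)) = 0.
Proof. by rewrite /sqn big1 // => i _; rewrite big1 // => j _; rewrite mxE expr0n. Qed.

Lemma sqnD (R : realType) (p q : nat) (M N : 'M[R]_(p, q)) :
  sqn (M + N) <= 2 * sqn M + 2 * sqn N.
Proof.
rewrite /sqn 2!mulr_sumr -big_split; apply: ler_sum => i _ /=.
rewrite 2!mulr_sumr -big_split; apply: ler_sum => j _ /=; rewrite mxE.
have := sqr_ge0 (M i j - N i j); nra.
Qed.

Lemma sqn_entry (R : realType) (p q : nat) (M : 'M[R]_(p, q)) i j : M i j ^+ 2 <= sqn M.
Proof.
rewrite /sqn (bigD1 i) //= (bigD1 j) //= -addrA lerDl addr_ge0 //.
  by apply: sumr_ge0 => k _; rewrite sqr_ge0.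
by apply: sumr_ge0 => k _; apply: sumr_ge0 => l _; rewrite sqr_ge0.
Qed.

Lemma entry_normF (R : realType) (p q : nat) (M : 'M[R]_(p, q)) i j : `|M i j| <= normF M.
Proof. by rewrite -sqrtr_sqr ler_wsqrtr // sqn_entry. Qed.

Lemma sqn_eq0 (R : realType) (p q : nat) (M : 'M[R]_(p, q)) : sqn M <= 0 -> M = 0.
Proof.
move=> h; apply/matrixP => i j; rewrite mxE; apply/eqP; rewrite -sqrf_eq0 -[_ == 0]andTb.
rewrite eq_le sqr_ge0 andbT (le_trans (sqn_entry M i j)) //.
Qed.

Lemma dot_CS (R : realType) (q : nat) (u v : 'rV[R]_q) :
  ((u *m v^T) 0 0) ^+ 2 <= sqn u * sqn v.
Proof.
rewrite !sqnE mxE; under eq_bigr do rewrite mxE; exact: sum_CS.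
Qed.

Lemma sqn_mul (R : realType) (p q r : nat) (M : 'M[R]_(p, q)) (N : 'M[R]_(q, r)) :
  sqn (M *m N) <= sqn M * sqn N.
Proof.
rewrite -(sqn_tr N) /sqn mulr_suml; apply: ler_sum => i _; rewrite mulr_sumr.
apply: ler_sum => j _; rewrite mxE; apply: le_trans (sum_CS _ _ _ _) _.
by rewrite le_eqVlt; apply/orP; left; apply/eqP; congr (_ * _); apply: eq_bigr => k _; rewrite mxE.
Qed.

(** Bounds on the squared singular values of [X] acting on row vectors. Stated on vectors, they
    compose and perturb with constants free of the dimensions. *)
Definition opub (R : realType) (p q : nat) (c : R) (X : 'M[R]_(p, q)) :=
  forall v : 'rV[R]_p, sqn (v *m X) <= c * sqn v.
Definition oplb (R : realType) (p q : nat) (c : R) (X : 'M[R]_(p, q)) :=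
  forall v : 'rV[R]_p, c * sqn v <= sqn (v *m X).

Lemma opub_sqn (R : realType) (p q : nat) (X : 'M[R]_(p, q)) : opub (sqn X) X.
Proof. by move=> v; rewrite mulrC sqn_mul. Qed.

(** For [u = w X^T] one has [|u|^2 = <u X, w>], so Cauchy-Schwarz and the bound on [X] give
    [|u|^4 <= c |u|^2 |w|^2]. *)
Lemma opub_tr (R : realType) (p q : nat) (c : R) (X : 'M[R]_(p, q)) :
  0 <= c -> opub c X -> opub c X^T.
Proof.
move=> c0 h w; set u := w *m X^T.
have e : sqn u = ((u *m X) *m w^T) 0 0.
  by rewrite sqn_dot {2}/u trmx_mul trmxK -mulmxA.
have := dot_CS (u *m X) w; rewrite -e => h1.
have := h u => h2; have h3 := sqn_ge0 w; have h4 := sqn_ge0 u.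
have h5 : sqn u ^+ 2 <= c * sqn u * sqn w.
  by apply: le_trans h1 _; rewrite ler_wpM2r.
have [h6|h6] := ltP 0 (sqn u); last by apply: le_trans h6 _; rewrite mulr_ge0.
by rewrite -(ler_pM2l h6) -expr2 (le_trans h5) //; rewrite mulrCA mulrA.
Qed.

Lemma opub_mul (R : realType) (p q r : nat) (c d : R) (X : 'M[R]_(p, q)) (Y : 'M[R]_(q, r)) :
  0 <= d -> opub c X -> opub d Y -> opub (c * d) (X *m Y).
Proof.
move=> d0 hX hY v; rewrite mulmxA; apply: le_trans (hY _) _.
by rewrite [c * d]mulrC -mulrA ler_wpM2l.
Qed.

(** Half of [c] is lost because squared norms only satisfy [|x + y|^2 <= 2 |x|^2 + 2 |y|^2]. *)
Lemma oplb_pert (R : realType) (p q : nat) (c e : R) (X Y : 'M[R]_(p, q)) :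
  oplb c X -> opub e (Y - X) -> oplb (c / 2 - e) Y.
Proof.
move=> hX hY v.
have e1 : v *m X = v *m Y + v *m (X - Y) by rewrite mulmxBr addrC subrK.
have := hX v; rewrite e1 => h; have := sqnD (v *m Y) (v *m (X - Y)) => h1.
have := hY v; rewrite -sqnN -mulmxN opprB => h2.
have := le_trans h h1; rewrite mulrBl; lra.
Qed.

Lemma opub_pert (R : realType) (p q : nat) (c e : R) (X Y : 'M[R]_(p, q)) :
  opub c X -> opub e (Y - X) -> opub (2 * c + 2 * e) Y.
Proof.
move=> hX hY v.
have e1 : v *m Y = v *m X + v *m (Y - X) by rewrite mulmxBr addrC subrK.
rewrite e1 (le_trans (sqnD _ _)) //; have := hX v; have := hY v; lra.
Qed.

Lemma oplb_le (R : realType) (p q : nat) (c e : R) (X : 'M[R]_(p, q)) :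
  c <= e -> oplb e X -> oplb c X.
Proof. by move=> ce h v; apply: le_trans (h v); rewrite ler_wpM2r ?sqn_ge0. Qed.

Lemma opub_le (R : realType) (p q : nat) (c e : R) (X : 'M[R]_(p, q)) :
  c <= e -> opub c X -> opub e X.
Proof. by move=> ce h v; apply: le_trans (h v) _; rewrite ler_wpM2r ?sqn_ge0. Qed.

(** * Symmetric matrices between two multiples of the identity *)

Definition qf (R : realType) (q : nat) (M : 'M[R]_q) (v : 'rV[R]_q) : R :=
  (v *m M *m v^T) 0 0.

Definition qbd (R : realType) (q : nat) (c1 c2 : R) (M : 'M[R]_q) :=
  M^T = M /\ forall v, c1 * sqn v <= qf M v <= c2 * sqn v.

Lemma qf_CS (R : realType) (q : nat) (c1 c2 : R) (M : 'M[R]_q) (u v : 'rV[R]_q) :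
  0 <= c1 -> qbd c1 c2 M -> ((u *m M *m v^T) 0 0) ^+ 2 <= qf M u * qf M v.
Proof.
move=> c0 [sM h]; apply: disc_le => t.
have h1 : 0 <= qf M (t *: u + v).
  by have /andP[h1 _] := h (t *: u + v); apply: le_trans h1; rewrite mulr_ge0 ?sqn_ge0.
have sy : (v *m M *m u^T) 0 0 = (u *m M *m v^T) 0 0.
  rewrite -[in LHS](trmxK (v *m M *m u^T)) [LHS]mxE !trmx_mul trmxK sM mulmxA //.
suff <- : qf M (t *: u + v) = qf M u * t ^+ 2 + 2 * (u *m M *m v^T) 0 0 * t + qf M v by [].
rewrite /qf linearD linearZ /= !mulmxDl !mulmxDr -!scalemxAl -!scalemxAr.
move: sy; move: (u *m M *m u^T) (u *m M *m v^T) (v *m M *m u^T) (v *m M *m v^T) => m1 m2 m3 m4 sy.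
by rewrite !mxE sy; ring.
Qed.

Lemma qbd_unit (R : realType) (q : nat) (c1 c2 : R) (M : 'M[R]_q) :
  0 < c1 -> qbd c1 c2 M -> M \in unitmx.
Proof.
move=> c0 [sM h]; rewrite -row_free_unit -kermx_eq0; apply/eqP/row_matrixP => i.
rewrite row0; have : row i (kermx M) *m M = 0 by rewrite -row_mul mulmx_ker row0.
set v := row i _ => hv; have /andP[h1 _] := h v.
apply: sqn_eq0; move: h1; rewrite /qf hv mul0mx mxE => h1.
by rewrite -(ler_pM2l c0) mulr0.
Qed.

(** Cauchy-Schwarz in the form of [M], for [w] and [u = w M]: there [w M u^T = |u|^2]. No
    diagonalization is involved. *)
Lemma qbd_opub (R : realType) (q : nat) (c1 c2 : R) (M : 'M[R]_q) :
  0 <= c1 -> 0 <= c2 -> qbd c1 c2 M -> opub (c2 ^+ 2) M.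
Proof.
move=> c0 c20 hM w; have [sM h] := hM; set u := w *m M.
have := qf_CS w u c0 hM; rewrite -/u -sqn_dot.
have /andP[_ h1] := h w; have /andP[_ h2] := h u; have /andP[h3 _] := h w.
have h4 := sqn_ge0 u; have h5 := sqn_ge0 w.
move=> h6; have [h7|h7] := ltP 0 (sqn u); last by apply: le_trans h7 _; rewrite mulr_ge0 ?sqr_ge0.
have h8 : qf M w * qf M u <= (c2 * sqn w) * (c2 * sqn u).
  have /andP[h10 _] := h u.
  by rewrite ler_pM // (le_trans _ h3, le_trans _ h10) // mulr_ge0.
have := le_trans h6 h8 => h9.
by rewrite -(ler_pM2r h7) -expr2 (le_trans h9) // le_eqVlt; apply/orP; left; apply/eqP; ring.
Qed.

(** With [w = v M^-1], the form of the inverse at [v] is the form of [M] at [w]. It equals [<v, w>],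
    which gives the upper bound; the lower one is Cauchy-Schwarz in the form of [M] for [w] and
    [v]. *)
Lemma qbd_inv (R : realType) (q : nat) (c1 c2 : R) (M : 'M[R]_q) :
  0 < c1 -> 0 < c2 -> qbd c1 c2 M -> qbd (c2^-1) (c1^-1) (invmx M).
Proof.
move=> c10 c20 hM; have U := qbd_unit c10 hM; have [sM h] := hM.
split; first by rewrite trmx_inv sM.
move=> v; set w := v *m invmx M.
have ew : w *m M = v by rewrite /w mulmxKV.
have e : qf (invmx M) v = qf M w.
  by rewrite /qf -/w -{1}ew trmx_mul sM mulmxA.
rewrite e; apply/andP; split.
  rewrite mulrC ler_pdivrMr //.
  have := qf_CS w v (ltW c10) hM; rewrite ew -sqn_dot.
  have /andP[h1 h2] := h v; have /andP[h3 _] := h w.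
  have h4 := sqn_ge0 v; have h5 := sqn_ge0 w => h6.
  have h7 : 0 <= qf M w by apply: le_trans h3; rewrite mulr_ge0 // ltW.
  have [h8|h8] := ltP 0 (sqn v); last by apply: le_trans h8 _; rewrite mulr_ge0 // ltW.
  rewrite -(ler_pM2r h8) -expr2 (le_trans h6) // -mulrA ler_wpM2l //.
have /andP[h3 _] := h w.
rewrite mulrC ler_pdivlMr //.
have e2 : qf M w = (v *m w^T) 0 0 by rewrite /qf ew.
have := dot_CS v w; rewrite -e2 => h6.
have h5 := sqn_ge0 w; have h4 := sqn_ge0 v.
have h7 : 0 <= qf M w by apply: le_trans h3; rewrite mulr_ge0 // ltW.
have [h8|h8] := ltP 0 (qf M w); last by rewrite (le_trans _ h4) // mulr_le0_ge0 // ltW.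
rewrite -(ler_pM2r h8); apply: (@le_trans _ _ (c1 * (sqn v * sqn w))).
  by rewrite mulrAC -expr2 mulrC ler_wpM2l // ltW.
by rewrite mulrCA ler_wpM2l.
Qed.

Lemma qbd_cong (R : realType) (p q : nat) (c1 c2 l u : R) (M : 'M[R]_q) (X : 'M[R]_(p, q)) :
  0 <= c1 -> 0 <= c2 -> qbd c1 c2 M -> oplb l X -> opub u X ->
  qbd (c1 * l) (c2 * u) (X *m M *m X^T).
Proof.
move=> c10 c20 [sM h] hl hu; split; first by rewrite !trmx_mul trmxK sM mulmxA.
move=> v; have -> : qf (X *m M *m X^T) v = qf M (v *m X).
  by rewrite /qf trmx_mul !mulmxA.
have /andP[h1 h2] := h (v *m X); apply/andP; split.
  by apply: le_trans h1; rewrite -mulrA ler_wpM2l.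
by apply: le_trans h2 _; rewrite -mulrA ler_wpM2l.
Qed.

Lemma qbd_scalar (R : realType) (q : nat) : qbd (1 : R) 1 (1%:M : 'M[R]_q).
Proof.
split; first by rewrite trmx1.
by move=> v; rewrite /qf mulmx1 -sqn_dot mul1r lexx.
Qed.

(** The pseudo-inverse recovers [v] from [v X]; the added 1 keeps the constant meaningful when the
    pseudo-inverse is 0. *)
Lemma row_free_oplb (R : realType) (p q : nat) (X : 'M[R]_(p, q)) :
  row_free X -> exists2 c : R, 0 < c & oplb c X.
Proof.
move=> hX; exists (1 + sqn (pinvmx X))^-1.
  by rewrite invr_gt0 ltr_pwDl // sqn_ge0.
move=> v; have p0 : 0 < 1 + sqn (pinvmx X) by rewrite ltr_pwDl // sqn_ge0.
rewrite mulrC ler_pdivrMr //.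
have -> : sqn v = sqn (v *m X *m pinvmx X) by rewrite -mulmxA mulmxVp // mulmx1.
rewrite (le_trans (sqn_mul _ _)) // ler_wpM2l ?sqn_ge0 // lerDr //.
Qed.

Lemma trivial_ker_oplb (R : realType) (p q : nat) (X : 'M[R]_(p, q)) :
  (forall v : 'rV[R]_p, v *m X = 0 -> v = 0) -> exists2 c : R, 0 < c & oplb c X.
Proof.
move=> h; apply: row_free_oplb; rewrite -kermx_eq0; apply/eqP/row_matrixP => i.
by rewrite row0; apply: h; rewrite -row_mul mulmx_ker row0.
Qed.

(** * Powers of stable matrices *)

(** The modulus as an element of [R], where the order is total; the norm of [R[i]] takes its values
    in [R[i]]. *)
Definition cm (R : realType) (z : R[i]) : R := complex.Re `|z|.

Lemma cmE (R : realType) (z : R[i]) : `|z| = (cm z)%:C%C.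
Proof. by rewrite /cm normc_def. Qed.

Lemma cm_ge0 (R : realType) (z : R[i]) : 0 <= cm z.
Proof. by rewrite -ler0c -cmE. Qed.

Lemma cmM (R : realType) (z w : R[i]) : cm (z * w) = cm z * cm w.
Proof. by apply: complexI; rewrite rmorphM /= -!cmE normrM. Qed.

Lemma cmD (R : realType) (z w : R[i]) : cm (z + w) <= cm z + cm w.
Proof. by rewrite -lecR rmorphD /= -!cmE ler_normD. Qed.

Lemma cmR (R : realType) (x : R) : cm x%:C%C = `|x|.
Proof. by rewrite /cm normc_def /= expr0n addr0 sqrtr_sqr. Qed.

Lemma cm0 (R : realType) : cm (0 : R[i]) = 0.
Proof. by rewrite (cmR 0) normr0. Qed.

Lemma cm1 (R : realType) : cm (1 : R[i]) = 1.
Proof. by rewrite (cmR 1) normr1. Qed.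

Lemma cmN (R : realType) (z : R[i]) : cm (- z) = cm z.
Proof. by rewrite /cm normrN. Qed.

Lemma cm_eq0 (R : realType) (z : R[i]) : cm z = 0 -> z = 0.
Proof. by move=> h; apply/eqP; rewrite -normr_eq0 cmE h. Qed.

Lemma cmX (R : realType) (z : R[i]) k : cm (z ^+ k) = cm z ^+ k.
Proof. by elim: k => [|k IH]; rewrite ?expr0 ?cm1 // !exprS cmM IH. Qed.

Lemma cmJ (R : realType) (z : R[i]) : cm (z^*)%C = cm z.
Proof. by rewrite /cm normcJ. Qed.

Lemma cmJM (R : realType) (z : R[i]) : z * (z^*)%C = ((cm z) ^+ 2)%:C%C.
Proof. by rewrite -sqr_normc cmE rmorphXn. Qed.

Lemma cmB (R : realType) (z w : R[i]) : cm z - cm w <= cm (z + w).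
Proof.
have := cmD (z + w) (- w); rewrite addrK cmN; lra.
Qed.

Lemma cm_sum (R : realType) (I : Type) (s : seq I) (P : pred I) (F : I -> R[i]) :
  cm (\sum_(i <- s | P i) F i) <= \sum_(i <- s | P i) cm (F i).
Proof.
elim/big_rec2: _ => [|i x y _ h]; first by rewrite cm0.
by apply: le_trans (cmD _ _) _; rewrite lerD2l.
Qed.

Lemma cm_prod (R : realType) (I : Type) (s : seq I) (P : pred I) (F : I -> R[i]) :
  cm (\prod_(i <- s | P i) F i) = \prod_(i <- s | P i) cm (F i).
Proof. by elim/big_rec2: _ => [|i x y _ <-]; rewrite ?cm1 // cmM. Qed.

(** The entrywise l1 norm is submultiplicative and dominates the Frobenius norm, which suits sums of
    powers. *)
Definition N1 (R : realType) (p q : nat) (A : 'M[R]_(p, q)) : R := \sum_i \sum_j `|A i j|.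

Lemma N1_ge0 (R : realType) (p q : nat) (A : 'M[R]_(p, q)) : 0 <= N1 A.
Proof. by apply: sumr_ge0 => i _; apply: sumr_ge0. Qed.

Lemma N1D (R : realType) (p q : nat) (A B : 'M[R]_(p, q)) : N1 (A + B) <= N1 A + N1 B.
Proof.
rewrite /N1 -big_split; apply: ler_sum => i _ /=; rewrite -big_split; apply: ler_sum => j _ /=.
by rewrite mxE ler_normD.
Qed.

Lemma N10 (R : realType) (p q : nat) : N1 (0 : 'M[R]_(p, q)) = 0.
Proof. by rewrite /N1 big1 // => i _; rewrite big1 // => j _; rewrite mxE normr0. Qed.

Lemma N1_sum (R : realType) (p q : nat) (I : Type) (s : seq I) (P : pred I)
    (F : I -> 'M[R]_(p, q)) :
  N1 (\sum_(i <- s | P i) F i) <= \sum_(i <- s | P i) N1 (F i).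
Proof.
elim/big_rec2: _ => [|i x y _ h]; first by rewrite N10.
by apply: le_trans (N1D _ _) _; rewrite lerD2l.
Qed.

Lemma N1M (R : realType) (p q r : nat) (A : 'M[R]_(p, q)) (B : 'M[R]_(q, r)) :
  N1 (A *m B) <= N1 A * N1 B.
Proof.
rewrite /N1 mulr_suml; apply: ler_sum => i _.
apply: (@le_trans _ _ (\sum_(j < r) \sum_(k < q) `|A i k| * `|B k j|)).
  apply: ler_sum => j _; rewrite mxE (le_trans (ler_norm_sum _ _ _)) //.
  by apply: ler_sum => k _; rewrite normrM.
rewrite exchange_big mulr_suml /=; apply: ler_sum => k _; rewrite -mulr_sumr.
apply: ler_wpM2l => //; rewrite (bigD1 k) //= lerDl.
by apply: sumr_ge0 => l _; apply: sumr_ge0.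
Qed.

Lemma N1_entry (R : realType) (p q : nat) (M : 'M[R]_(p, q)) i j : `|M i j| <= N1 M.
Proof.
rewrite /N1 (bigD1 i) //= (bigD1 j) //= -addrA lerDl addr_ge0 //.
  by apply: sumr_ge0 => k _.
by apply: sumr_ge0 => k _; apply: sumr_ge0 => l _.
Qed.

Lemma sqn_N1 (R : realType) (p q : nat) (M : 'M[R]_(p, q)) : sqn M <= N1 M ^+ 2.
Proof.
rewrite /sqn expr2 {1}/N1 mulr_suml; apply: ler_sum => i _; rewrite mulr_suml.
apply: ler_sum => j _; rewrite -real_normK ?num_real // expr2.
by rewrite ler_wpM2l // N1_entry.
Qed.

Lemma summable_rec (R : realFieldType) (l F : R) (b f : nat -> R) :
  0 <= l -> l < 1 -> (forall k, 0 <= b k) ->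
  (forall m, \sum_(0 <= k < m) f k <= F) ->
  (forall k, b k.+1 <= l * b k + f k) ->
  forall m, \sum_(0 <= k < m) b k <= (b 0%N + F) / (1 - l).
Proof.
move=> l0 l1 b0 hF hb m; have l2 : 0 < 1 - l by rewrite subr_gt0.
rewrite ler_pdivlMr //.
suff : \sum_(0 <= k < m) b k <= b 0%N + l * (\sum_(0 <= k < m) b k) + F by lra.
case: m => [|m].
  by rewrite !big_geq // mulr0 addr0; have := hF 0%N; rewrite big_geq // => ?; rewrite addr_ge0.
rewrite big_nat_recl // -addrA lerD2l.
apply: (@le_trans _ _ (l * (\sum_(0 <= k < m) b k) + \sum_(0 <= k < m) f k)).
  by rewrite mulr_sumr -big_split /=; apply: ler_sum => k _.
rewrite lerD // ler_wpM2l // -big_nat_recl // big_nat_recr //= lerDl //.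
Qed.

(** One root [z] is peeled off the annihilating product: [X A^(k+1) = z X A^k + X (A - z) A^k],
    where the last term is summable by induction and [|z| < 1]. This replaces the Jordan form. *)
Lemma powers_summable_aux (R : realType) (n : nat) (A X : 'M[R[i]]_n.+1) (s : seq R[i]) :
  {in s, forall z, cm z < 1} -> X * \prod_(z <- s) (A - z%:M) = 0 ->
  exists S : R, forall m, \sum_(0 <= k < m) (\sum_i \sum_j cm ((X * A ^+ k) i j)) <= S.
Proof.
elim: s X => [|z s IH] X hs hX.
  exists 0 => m; rewrite big_nil mulr1 in hX; rewrite hX big1 // => k _.
  by rewrite big1 // => i _; rewrite big1 // => j _; rewrite mul0r mxE cm0.
have [||F hF] := IH (X * (A - z%:M)).
- by move=> w hw; apply: hs; rewrite inE hw orbT.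
- by rewrite -mulrA; rewrite big_cons in hX.
exists (((\sum_i \sum_j cm ((X * A ^+ 0) i j)) + F) / (1 - cm z)) => m.
apply: (summable_rec (cm_ge0 z) _ _ hF) => [|k|k].
- by apply: hs; rewrite inE eqxx.
- by apply: sumr_ge0 => i _; apply: sumr_ge0 => j _; exact: cm_ge0.
have -> : X * A ^+ k.+1 = z *: (X * A ^+ k) + X * (A - z%:M) * A ^+ k.
  rewrite exprS mulrA -mul_scalar_mx -[RHS]/(z%:M * (X * A ^+ k) + _).
  rewrite mulrA -mulrDl; congr (_ * _); rewrite mulrBr.
  have -> : z%:M * X = X * z%:M by rewrite -[LHS]/(z%:M *m X) -[RHS]/(X *m z%:M) mul_scalar_mx mul_mx_scalar.
  by rewrite addrC subrK.
rewrite mulr_sumr -big_split; apply: ler_sum => i _ /=.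
rewrite mulr_sumr -big_split; apply: ler_sum => j _ /=.
rewrite [X in cm X](_ : _ = z * (X * A ^+ k) i j + (X * (A - z%:M) * A ^+ k) i j); last by rewrite !mxE.
by rewrite (le_trans (cmD _ _)) // cmM.
Qed.

Lemma spectral_radius_roots (R : realType) (n : nat) (A : 'M[R]_n) (z : R[i]) :
  root (char_poly (map_mx (real_complex R) A)) z -> cm z <= spectral_radius A.
Proof.
move=> hz; apply: ub_le_sup; last by exists z => //; rewrite eigenvalue_root_char.
(* The supremum dominates its members only if the set is bounded; the sum of the moduli of all roots
   is a bound. *)
have [r hr] := closed_field_poly_normal (char_poly (map_mx (real_complex R) A)).
exists (\sum_(w <- r) cm w) => x [w]; rewrite eigenvalue_root_char => hw ->.
have : w \in r.
  move: hw; rewrite hr (monicP (char_poly_monic _)) scale1r root_prod_XsubC //.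
move=> wr; rewrite (big_rem w wr) /= lerDl; apply: sumr_ge0 => *; exact: cm_ge0.
Qed.

Lemma powers_summable (R : realType) (n : nat) (A : 'M[R]_n.+1) :
  spectral_radius A < 1 -> exists S : R, forall m, \sum_(0 <= k < m) N1 (A ^+ k) <= S.
Proof.
move=> hA; set f := real_complex R; pose Ac := map_mx f A.
have [r hr] := closed_field_poly_normal (char_poly Ac).
rewrite (monicP (char_poly_monic _)) scale1r in hr.
have hroot : {in r, forall z, cm z < 1}.
  move=> z zr; apply: le_lt_trans hA; apply: spectral_radius_roots.
  by rewrite -/f -/Ac hr root_prod_XsubC.
have [|S hS] := powers_summable_aux (X := 1) (A := Ac) hroot.
  rewrite mul1r; have := Cayley_Hamilton Ac; rewrite hr rmorph_prod /= => <-.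
  by apply: eq_bigr => z _; rewrite rmorphB /= horner_mx_X horner_mx_C.
exists S => m; apply: le_trans (hS m); apply: ler_sum => k _.
apply: ler_sum => i _; apply: ler_sum => j _.
by rewrite mul1r -rmorphXn /= mxE cmR.
Qed.

(** Since [a] lists [a_nx ... a_1], its entry [k] is the coefficient of degree [k] of the
    characteristic polynomial. The default values are the leading 1 at [k = nx] and 0 beyond. *)
Definition acoef (R : realType) (nx : nat) (a : 'rV[R]_nx) (k : nat) : R :=
  if insub k is Some k' then a 0 (k' : 'I_nx) else (k == nx)%:R.

Definition apoly (R : realType) (nx : nat) (a : 'rV[R]_nx) : {poly R} :=
  \poly_(k < nx.+1) acoef a k.

Lemma acoef_ord (R : realType) (nx : nat) (a : 'rV[R]_nx) (k : 'I_nx) : acoef a k = a 0 k.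
Proof. by rewrite /acoef valK. Qed.

Lemma acoef_max (R : realType) (nx : nat) (a : 'rV[R]_nx) : acoef a nx = 1.
Proof. by rewrite /acoef insubF ?ltnn // eqxx. Qed.

Lemma acoef_gt (R : realType) (nx : nat) (a : 'rV[R]_nx) k : (nx < k)%N -> acoef a k = 0.
Proof. by move=> h; rewrite /acoef insubF ?gtn_eqF // ltnNge (ltnW h). Qed.

Lemma coef_apoly (R : realType) (nx : nat) (a : 'rV[R]_nx) k : (apoly a)`_k = acoef a k.
Proof. by rewrite coef_poly ltnS; case: leqP => // h; rewrite acoef_gt. Qed.

Lemma size_apoly (R : realType) (nx : nat) (a : 'rV[R]_nx) : size (apoly a) = nx.+1.
Proof. by rewrite size_poly_eq // acoef_max oner_eq0. Qed.

Lemma apoly_monic (R : realType) (nx : nat) (a : 'rV[R]_nx) : apoly a \is monic.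
Proof. by rewrite monicE /lead_coef size_apoly coef_apoly acoef_max. Qed.

Lemma char_poly_cast (R : comNzRingType) (m n : nat) (e : m = n) (A : 'M[R]_m) :
  char_poly (castmx (e, e) A) = char_poly A.
Proof. by case: n / e; rewrite castmx_id. Qed.

(** Reversing the coordinates turns the canonical form into the transpose of a companion matrix; the
    sign of the reversal enters the determinant twice. *)
Lemma char_poly_canonical (R : realType) (n : nat) (a : 'rV[R]_n) :
  char_poly (canonical_AK a) = apoly a.
Proof.
have e : (size (apoly a)).-1 = n by rewrite size_apoly.
rewrite -[RHS](companionmxK (apoly_monic a)) -(char_poly_cast e).
set Q := castmx _ _; pose s := perm (@rev_ord_inj n).
rewrite /char_poly.
have -> : char_poly_mx (canonical_AK a) = col_perm s (row_perm s (char_poly_mx Q)^T).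
  apply/matrixP => i j; rewrite !mxE castmxE /= !mxE !permE /=.
  have -> : (rev_ord j == rev_ord i) = (i == j) by rewrite (inj_eq (@rev_ord_inj n)) eq_sym.
  congr (_ - _%:P); rewrite e.
  have -> : ((n - j.+1)%N == n.-1) = (j == 0%N :> nat).
    by case: i j {Q s} => i hi [j hj] /=; apply/eqP/eqP; lia.
  case: eqP => _; first by rewrite coef_apoly -[(n - i.+1)%N]/(nat_of_ord (rev_ord i)) acoef_ord.
  congr (_ %:R); congr (nat_of_bool _).
  by case: i j {Q s} => i hi [j hj] /=; apply/eqP/eqP; lia.
rewrite col_permE row_permE !det_mulmx det_tr !det_perm odd_permV.
by rewrite mulrAC -expr2 sqrr_sign mul1r.
Qed.

(** Each linear factor is at least the distance [1 - |w|] from its root to the circle. *)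
Lemma apoly_lb (R : realType) (n : nat) (a : 'rV[R]_n) :
  spectral_radius (canonical_AK a) < 1 ->
  exists2 c : R, 0 < c & forall z : R[i], cm z = 1 ->
    c <= cm (map_poly (real_complex R) (apoly a)).[z].
Proof.
move=> hA; set f := real_complex R.
have [r hr] := closed_field_poly_normal (map_poly f (apoly a)).
have mon : map_poly f (apoly a) \is monic by rewrite map_monic apoly_monic.
rewrite (monicP mon) scale1r in hr.
have hroot : {in r, forall z, cm z < 1}.
  move=> z zr; apply: le_lt_trans hA; apply: spectral_radius_roots.
  by rewrite -map_char_poly char_poly_canonical -/f hr root_prod_XsubC.
exists (\prod_(w <- r) (1 - cm w)).
  rewrite big_seq; elim/big_ind: _ => // [x y|w wr]; first exact: mulr_gt0.
  by rewrite subr_gt0 hroot.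
move=> z z1; rewrite hr horner_prod cm_prod.
rewrite !(big_seq _ _ r); apply: ler_prod => w wr; rewrite subr_ge0 ltW ?hroot //=.
by rewrite hornerXsubC -z1 -(cmN w) cmB.
Qed.

Lemma apoly_canonical0 (R : realType) (n : nat) (a : 'rV[R]_n.+1) :
  \sum_(k < n.+2) acoef a k *: canonical_AK a ^+ k = 0.
Proof.
have := Cayley_Hamilton (canonical_AK a); rewrite char_poly_canonical /apoly poly_def.
rewrite raddf_sum /= => h; rewrite -[RHS]h; apply: eq_bigr => k _.
by rewrite linearZ /= rmorphXn /= horner_mx_X.
Qed.

Lemma sum_triangle (V : nmodType) (F : nat -> nat -> V) (m : nat) :
  \sum_(0 <= k < m) \sum_(0 <= i < k.+1) F i (k - i)%N
  = \sum_(0 <= i < m) \sum_(0 <= j < m - i) F i j.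
Proof.
elim: m => [|m IH]; first by rewrite !big_geq.
rewrite big_nat_recr //= IH.
rewrite [RHS]big_nat_recr //= subSnn big_nat1.
rewrite [X in _ + X = _]big_nat_recr //= subnn addrA; congr (_ + _).
rewrite -big_split /=; apply: eq_big_nat => i /andP[_ im].
by rewrite subSn 1?ltnW // big_nat_recr.
Qed.

Lemma sum_conv_le (R : realDomainType) (f g : nat -> R) (m : nat) (S : R) :
  (forall i, 0 <= f i) -> (forall j, \sum_(0 <= j < m - j) g j <= S) ->
  \sum_(0 <= k < m) \sum_(0 <= i < k.+1) f i * g (k - i)%N
  <= (\sum_(0 <= i < m) f i) * S.
Proof.
move=> f0 hg; rewrite (sum_triangle (fun i j => f i * g j)) mulr_suml.
by apply: ler_sum => i _; rewrite -mulr_sumr ler_wpM2l.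
Qed.

(** A bootstrap: telescoping bounds the sum [D] of the differences by [eps S (S + D)], and
    [eps S <= 1/2] absorbs [D]. The bound is uniform in [m], so the stability of [B] comes out
    instead of going in. *)
Lemma powers_pert (R : realType) (n : nat) (A B : 'M[R]_n.+1) (S : R) :
  (forall m, \sum_(0 <= k < m) N1 (A ^+ k) <= S) -> N1 (B - A) * S <= 2^-1 ->
  forall m, \sum_(0 <= k < m) N1 (B ^+ k - A ^+ k) <= 2 * N1 (B - A) * S ^+ 2.
Proof.
move=> hS hB m; set eps := N1 (B - A).
have S0 : 0 <= S by have := hS 0%N; rewrite big_geq.
have e0 : 0 <= eps by exact: N1_ge0.
have tel k : B ^+ k.+1 - A ^+ k.+1 = \sum_(0 <= i < k.+1) B ^+ i * (B - A) * A ^+ (k - i).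
  elim: k => [|k IH]; first by rewrite big_nat1 !expr0 mul1r mulr1 !expr1.
  rewrite big_nat_recr //= subnn expr0 mulr1.
  have -> : \sum_(0 <= i < k.+1) B ^+ i * (B - A) * A ^+ (k.+1 - i) =
     (\sum_(0 <= i < k.+1) B ^+ i * (B - A) * A ^+ (k - i)) * A.
    rewrite mulr_suml; apply: eq_big_nat => i /andP[_ ik].
    by rewrite -[RHS]mulrA -exprSr subSn.
  by rewrite -IH mulrBl mulrBr -!exprSr addrC addrA subrK.
pose sh := \sum_(0 <= k < m) N1 (B ^+ k).
have conv : \sum_(0 <= k < m) N1 (B ^+ k - A ^+ k) <= eps * sh * S.
  case: m @sh => [|m] sh; first by rewrite big_geq // !mulr_ge0 // /sh big_geq.
  rewrite big_nat_recl // !expr0 subrr N10 add0r.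
  apply: (@le_trans _ _ (\sum_(0 <= k < m) \sum_(0 <= i < k.+1)
           (eps * N1 (B ^+ i)) * N1 (A ^+ (k - i)))).
    apply: ler_sum => k _; rewrite tel (le_trans (N1_sum _ _ _)) //.
    apply: ler_sum => i _.
    rewrite (le_trans (N1M _ _)) // ler_wpM2r ?N1_ge0 // [eps * _]mulrC; exact: N1M.
  apply: le_trans (sum_conv_le (f := fun i => eps * N1 (B ^+ i)) (g := fun i => N1 (A ^+ i)) (S := S) _ _) _ => //.
  - by move=> i; rewrite mulr_ge0 // N1_ge0.
  - rewrite ler_wpM2r // -mulr_sumr ler_wpM2l // /sh [leRHS]big_nat_recr //= lerDl.
    exact: N1_ge0.
have hsh : sh <= S + \sum_(0 <= k < m) N1 (B ^+ k - A ^+ k).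
  apply: (@le_trans _ _ (\sum_(0 <= k < m) N1 (A ^+ k) + \sum_(0 <= k < m) N1 (B ^+ k - A ^+ k))).
    rewrite -big_split /=; apply: ler_sum => k _.
    by rewrite -{1}[B ^+ k](subrK (A ^+ k)) addrC N1D.
  by rewrite lerD2r.
have D0 : 0 <= \sum_(0 <= k < m) N1 (B ^+ k - A ^+ k).
  by apply: sumr_ge0 => k _; exact: N1_ge0.
move: hB hsh conv D0; rewrite -/eps; move: (\sum_(0 <= k < m) _) => D hB hsh conv D0.
have eS : 0 <= eps * S by rewrite mulr_ge0.
have h1 : eps * sh * S <= eps * S * (S + D) by rewrite mulrAC ler_wpM2l.
have h2 : eps * S * D <= 2^-1 * D by rewrite ler_wpM2r.
rewrite expr2; lra.
Qed.

(** * Transforms on the unit circle *)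

(** Summability of nonnegative terms as a bound on all partial sums; in this form it passes to
    dominated sequences and convolutions without taking limits. *)
Definition asum (R : realType) (f : nat -> R) : Prop :=
  exists S : R, forall m, \sum_(0 <= k < m) f k <= S.

Lemma cvg_asum (R : realType) (f : nat -> R) :
  (forall k, 0 <= f k) -> cvgn (series f) -> asum f.
Proof.
move=> f0 h; exists (limn (series f)) => m.
have nd : nondecreasing_seq (series f).
  by apply: nondecreasing_series => i _ _; exact: f0.
exact: (nondecreasing_cvgn_le nd h m).
Qed.

Lemma asum_tail (R : realType) (f : nat -> R) (eps : R) :
  (forall k, 0 <= f k) -> asum f -> 0 < eps ->
  exists T0 : nat, forall T m, (T0 <= T)%N -> \sum_(T <= k < m) f k <= eps.
Proof.
move=> f0 [S hS] e0.
pose E := [set x : R | exists m, x = \sum_(0 <= k < m) f k].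
have hE : has_sup E.
  by split; [exists 0, 0%N; rewrite big_geq | exists S => _ [m ->]].
have [_ [T0 ->] hT0] := sup_adherent e0 hE.
exists T0 => T m hT; have [hm|hm] := leqP m T; first by rewrite big_geq // ltW.
have h1 : \sum_(0 <= k < m) f k <= sup E by apply: ub_le_sup; [case: hE | exists m].
have e1 : \sum_(0 <= k < m) f k = \sum_(0 <= k < T) f k + \sum_(T <= k < m) f k.
  by rewrite (big_cat_nat _ (n := T)) // ltnW.
have e2 : \sum_(0 <= k < T) f k = \sum_(0 <= k < T0) f k + \sum_(T0 <= k < T) f k.
  by rewrite (big_cat_nat _ (n := T0)).
have e3 : 0 <= \sum_(T0 <= k < T) f k by apply: sumr_ge0.
lra.
Qed.

Lemma asum_cvg (R : realType) (f : nat -> R) :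
  (forall k, 0 <= f k) -> asum f -> cvgn (series f).
Proof.
move=> f0 [S hS]; apply: nondecreasing_is_cvgn.
  by apply: nondecreasing_series => i _ _; exact: f0.
by exists S => _ [m _ <-]; exact: hS.
Qed.

Lemma asum_le (R : realType) (f g : nat -> R) :
  (forall k, f k <= g k) -> asum g -> asum f.
Proof. by move=> h [S hS]; exists S => m; apply: le_trans (hS m); apply: ler_sum. Qed.

Lemma asum_abs_cvg (R : realType) (s : nat -> R) : asum (fun k => `|s k|) -> cvgn (series s).
Proof. by move=> h; apply: normed_cvg; apply: (asum_cvg _ h) => k; exact: normr_ge0. Qed.

Lemma lim_tail (R : realType) (s : nat -> R) (T : nat) (eps : R) :
  asum (fun k => `|s k|) -> (forall m, \sum_(T <= k < m) `|s k| <= eps) ->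
  `|limn (series s) - \sum_(0 <= k < T) s k| <= eps.
Proof.
move=> hs h; have hc := asum_abs_cvg hs.
have c1 : (fun m => `|series s m - \sum_(0 <= k < T) s k|) @ \oo -->
    `|limn (series s) - \sum_(0 <= k < T) s k|.
  by apply: cvg_norm; apply: cvgB => //; apply: cvg_cst.
rewrite -(cvg_lim _ c1) //; apply: limr_le; first by apply/cvg_ex; eexists; exact: c1.
near=> m; have hT : (T <= m)%N by near: m; exists T.
rewrite /series /= (big_cat_nat _ (n := T)) //= addrAC subrr add0r.
by rewrite (le_trans (ler_norm_sum _ _ _)).
Unshelve. all: by end_near.
Qed.

(** A truncated transform as a polynomial, where [x] stands for [z^-1]. *)
Definition pev (R : realType) (c : nat -> R) (L : nat) (x : R[i]) : R[i] :=
  \sum_(0 <= k < L) (c k)%:C%C * x ^+ k.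

Lemma Re_sum (R : realType) (I : Type) (s : seq I) (P : pred I) (F : I -> R[i]) :
  complex.Re (\sum_(i <- s | P i) F i) = \sum_(i <- s | P i) complex.Re (F i).
Proof. by elim/big_rec2: _ => // i y1 y2 _ <-; case: (F i) y2 => [? ?] [? ?]. Qed.

Lemma Im_sum (R : realType) (I : Type) (s : seq I) (P : pred I) (F : I -> R[i]) :
  complex.Im (\sum_(i <- s | P i) F i) = \sum_(i <- s | P i) complex.Im (F i).
Proof. by elim/big_rec2: _ => // i y1 y2 _ <-; case: (F i) y2 => [? ?] [? ?]. Qed.

Lemma Re_le_cm (R : realType) (z : R[i]) : `|complex.Re z| <= cm z.
Proof. by rewrite -lecR -cmE normc_ge_Re. Qed.

Lemma Im_le_cm (R : realType) (z : R[i]) : `|complex.Im z| <= cm z.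
Proof.
case: z => a b; rewrite /cm normc_def /= -sqrtr_sqr ler_wsqrtr // lerDr sqr_ge0 //.
Qed.

Lemma cm_le_ReIm (R : realType) (z : R[i]) : cm z <= `|complex.Re z| + `|complex.Im z|.
Proof.
case: z => a b; rewrite /cm normc_def /=.
rewrite -[leRHS]ger0_norm ?addr_ge0 // -sqrtr_sqr ler_wsqrtr //.
rewrite sqrrD !real_normK ?num_real // -addrA lerD2l lerDr mulrn_wge0 // mulr_ge0 //.
Qed.

(** The factor 2 pays for treating real and imaginary parts separately, as [csum] does. *)
Lemma csum_tail (R : realType) (c : nat -> R[i]) (f : nat -> R) (T : nat) (eps : R) :
  (forall k, cm (c k) <= f k) -> asum f -> (forall m, \sum_(T <= k < m) f k <= eps) ->
  cm (csum c - \sum_(0 <= k < T) c k) <= 2 * eps.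
Proof.
move=> hc hf ht.
have hr k : `|complex.Re (c k)| <= f k := le_trans (Re_le_cm _) (hc k).
have hi k : `|complex.Im (c k)| <= f k := le_trans (Im_le_cm _) (hc k).
apply: le_trans (cm_le_ReIm _) _.
have -> : complex.Re (csum c - \sum_(0 <= k < T) c k)
   = limn (series (fun k => complex.Re (c k))) - \sum_(0 <= k < T) complex.Re (c k).
  by rewrite -Re_sum; case: (\sum_(0 <= k < T) c k).
have -> : complex.Im (csum c - \sum_(0 <= k < T) c k)
   = limn (series (fun k => complex.Im (c k))) - \sum_(0 <= k < T) complex.Im (c k).
  by rewrite -Im_sum; case: (\sum_(0 <= k < T) c k).
rewrite mulrDl mul1r; apply: lerD; apply: lim_tail.
- exact: asum_le hr hf.
- by move=> m; apply: le_trans (ht m); apply: ler_sum.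
- exact: asum_le hi hf.
- by move=> m; apply: le_trans (ht m); apply: ler_sum.
Qed.

Lemma cmV1 (R : realType) (z : R[i]) : cm z = 1 -> z^-1 = (z^*)%C.
Proof.
move=> h; have z0 : z != 0 by apply/eqP => z0; move: h; rewrite z0 cm0 => /esym/eqP; rewrite oner_eq0.
by apply: (mulfI z0); rewrite divff // cmJM h expr1n.
Qed.

Lemma cm_inv (R : realType) (z : R[i]) : cm z = 1 -> cm z^-1 = 1.
Proof. by move=> h; rewrite cmV1 // cmJ. Qed.

Lemma ztransform_lim (R : realType) (s : nat -> R) (eps : R) :
  asum (fun k => `|s k|) -> 0 < eps ->
  exists T0, forall T, (T0 <= T)%N -> forall z, cm z = 1 ->
    cm (ztransform s z - pev s T z^-1) <= eps.
Proof.
move=> hs e0; have e2 : 0 < eps / 2 by lra.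
have [T0 h] := asum_tail (fun k => normr_ge0 (s k)) hs e2.
exists T0 => T hT z z1; have -> : eps = 2 * (eps / 2) by lra.
rewrite /ztransform /pev; under [X in csum _ - X]eq_bigr do rewrite exprVn.
apply: (@csum_tail _ _ (fun k => `|s k|)) => // [k|m]; last exact: h.
by rewrite cmM cmR -exprVn cmX cm_inv // expr1n mulr1.
Qed.

(** [X^M - 1] is separable in characteristic 0, so it has [M] distinct roots and one of them is
    primitive. Its modulus is 1 because the [M]-th power of the modulus is. *)
Lemma prim_root_ex (R : realType) (M : nat) : (0 < M)%N ->
  exists2 w : R[i], M.-primitive_root w & cm w = 1.
Proof.
move=> M0; pose p : {poly R[i]} := 'X^M - 1.
have [r hr] := closed_field_poly_normal p.
have pm : p \is monic by rewrite monicXnsubC.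
rewrite (monicP pm) scale1r in hr.
have ur : uniq r.
  rewrite -(separable_prod_XsubC r) -hr; apply: separable_Xn_sub_1.
  by rewrite pnatr_eq0 -lt0n.
have sr : size r = M.
  by have := size_XnsubC (1 : R[i]) M0; rewrite -[_ - _]/p hr size_prod_XsubC => -[].
have : has M.-primitive_root r.
  apply: has_prim_root => //; last by rewrite sr.
  apply/allP => z zr; rewrite unity_rootE.
  have : root p z by rewrite hr root_prod_XsubC.
  by rewrite rootE /p hornerD hornerN hornerXn hornerC subr_eq0.
case/hasP => w _ hw; exists w => //.
have h := prim_expr_order hw.
have h2 : cm w ^+ M = 1 by rewrite -cmX h cm1.
by apply: (pexpIrn M0); rewrite ?nnegrE ?cm_ge0 // h2 expr1n.
Qed.

(** Orthogonality of characters; exponents below [M] cannot alias. The rotation [zeta] contributes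
    only a factor that equals 1 when [a = b]. *)
Lemma avg_unit (R : realType) (M : nat) (w zeta : R[i]) (a b : nat) :
  M.-primitive_root w -> cm w = 1 -> cm zeta = 1 -> (a < M)%N -> (b < M)%N ->
  \sum_(j < M) (zeta * w ^+ j) ^+ a * (((zeta * w ^+ j)^*)%C) ^+ b = (a == b)%:R * M%:R.
Proof.
move=> hw w1 z1 aM bM; pose v := w ^+ a * (w^*)%C ^+ b.
have -> : \sum_(j < M) (zeta * w ^+ j) ^+ a * (((zeta * w ^+ j)^*)%C) ^+ b
   = zeta ^+ a * (zeta^*)%C ^+ b * \sum_(j < M) v ^+ j.
  rewrite mulr_sumr; apply: eq_bigr => j _.
  rewrite rmorphM rmorphXn /= /v !exprMn -!exprM (mulnC j a) (mulnC j b) !exprM; ring.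
have w0 : w != 0 by apply/eqP => h; move: w1; rewrite h cm0 => /esym/eqP; rewrite oner_eq0.
have [ab|ab] := eqVneq a b.
  have cj (x : R[i]) : cm x = 1 -> x ^+ b * (x^*)%C ^+ b = 1.
    by move=> hx; rewrite -exprMn cmJM hx !expr1n.
  rewrite /v ab (cj _ w1) (cj _ z1) mul1r; under eq_bigr do rewrite expr1n.
  by rewrite sumr_const card_ord mul1r.
rewrite mul0r.
have v1 : v != 1.
  rewrite /v -(cmV1 w1); apply/eqP => h.
  have : w ^+ a = w ^+ b.
    by apply: (mulIf (x := w^-1 ^+ b)); rewrite ?expf_neq0 ?invr_eq0 // h -exprMn divff // expr1n.
  move/eqP; rewrite (eq_prim_root_expr hw) /= !modn_small // => /eqP; exact/eqP.
have : (v - 1) * \sum_(j < M) v ^+ j = 0.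
  rewrite -subrX1 /v -(cmV1 w1) exprMn -!exprM (mulnC a) (mulnC b) !exprM exprVn.
  by rewrite (prim_expr_order hw) invr1 !expr1n mul1r subrr.
by move/eqP; rewrite mulf_eq0 subr_eq0 (negbTE v1) /= => /eqP ->; rewrite mulr0.
Qed.

Lemma parseval (R : realType) (M L : nat) (w zeta : R[i]) (c : nat -> R) :
  M.-primitive_root w -> cm w = 1 -> cm zeta = 1 -> (L <= M)%N ->
  \sum_(j < M) cm (pev c L (zeta * w ^+ j)) ^+ 2 = M%:R * \sum_(0 <= k < L) c k ^+ 2.
Proof.
move=> hw w1 z1 LM; apply: complexI; rewrite rmorph_sum /=.
have e (j : 'I_M) : (cm (pev c L (zeta * w ^+ j)) ^+ 2)%:C%C =
    \sum_(0 <= k < L) \sum_(0 <= l < L) ((c k)%:C%C * (c l)%:C%C) *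
      ((zeta * w ^+ j) ^+ k * (((zeta * w ^+ j)^*)%C) ^+ l).
  rewrite -cmJM /pev rmorph_sum /= mulr_suml; apply: eq_bigr => k _.
  rewrite mulr_sumr; apply: eq_bigr => l _.
  have -> : (((c l)%:C%C * (zeta * w ^+ j) ^+ l)^*)%C = (c l)%:C%C * ((zeta * w ^+ j)^*)%C ^+ l.
    by rewrite rmorphM rmorphXn /= oppr0.
  by rewrite mulrACA.
rewrite (eq_bigr _ (fun j _ => e j)).
rewrite exchange_big /= rmorphM rmorph_nat rmorph_sum mulr_sumr /=.
apply: eq_big_nat => k /andP[_ kL].
rewrite exchange_big /= (bigD1_seq k) ?iota_uniq ?mem_index_iota //=.
rewrite -mulr_sumr (avg_unit hw) ?(leq_trans kL) // eqxx mul1r big1_seq ?addr0.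
  by rewrite rmorphXn expr2 mulrC.
move=> l /andP[lk]; rewrite mem_index_iota => /andP[_ lL].
by rewrite -mulr_sumr (avg_unit hw) ?(leq_trans kL) ?(leq_trans lL) // eq_sym (negbTE lk) mul0r mulr0.
Qed.

Lemma horner_avg (R : realType) (M : nat) (w : R[i]) (p : {poly R[i]}) :
  M.-primitive_root w -> cm w = 1 -> (size p <= M)%N -> (0 < M)%N ->
  \sum_(j < M) p.[w ^+ j] = M%:R * p`_0.
Proof.
move=> hw w1 sp M0.
have e (j : 'I_M) : p.[w ^+ j] = \sum_(k < M) p`_k * ((1 * w ^+ j) ^+ k * ((1 * w ^+ j)^*)%C ^+ 0).
  by rewrite (horner_coef_wide _ sp); apply: eq_bigr => k _; rewrite expr0 mulr1 mul1r.
rewrite (eq_bigr _ (fun j _ => e j)) exchange_big /=.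
under eq_bigr => k _ do rewrite -mulr_sumr (avg_unit (a := k) (b := 0) hw w1) ?cm1 //.
rewrite (bigD1 (Ordinal M0)) //= big1 ?addr0 ?mul1r 1?mulrC // => k.
by rewrite -val_eqE /= => /negbTE ->; rewrite mul0r mulr0.
Qed.

Lemma unif_prod (R : realType) (M : nat) (E : nat -> R[i] -> R[i]) (F : nat -> nat -> R[i] -> R[i])
    (D : set R[i]) (B : R) :
  0 <= B ->
  (forall j x, D x -> cm (E j x) <= B) ->
  (forall j (eps : R), 0 < eps -> exists T0, forall T, (T0 <= T)%N -> forall x, D x ->
     cm (E j x - F j T x) <= eps) ->
  forall eps : R, 0 < eps -> exists T0, forall T, (T0 <= T)%N -> forall x, D x ->
     cm (\prod_(j < M) E j x - \prod_(j < M) F j T x) <= eps.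
Proof.
move=> B0 hB hE; elim: M => [|M IH] eps e0.
  by exists 0%N => T _ x _; rewrite !big_ord0 subrr cm0 ltW.
have p0 : 0 < 1 + B + B ^+ M by rewrite !ltr_pwDl // ?exprn_ge0 // addr_gt0 // ltr_pwDl.
(* The minimum with 1 bounds the truncated factors by [B + 1]. *)
pose e1 := Num.min 1 (eps / 2 / (1 + B + B ^+ M)).
have e10 : 0 < e1 by rewrite /e1 lt_min ltr01 !divr_gt0.
have [T1 h1] := IH e1 e10; have [T2 h2] := hE M e1 e10.
exists (maxn T1 T2) => T; rewrite geq_max => /andP[hT1 hT2] x hx.
rewrite !big_ord_recr /=.
set P := \prod_(j < M) E j x; set Q := \prod_(j < M) F j T x.
have hP : cm P <= B ^+ M.
  rewrite /P cm_prod; apply: le_trans (_ : \prod_(j < M) B <= _); last by rewrite prodr_const card_ord.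
  by apply: ler_prod => j _; rewrite cm_ge0 hB.
have hF : cm (F M T x) <= B + 1.
  have -> : F M T x = E M x - (E M x - F M T x) by rewrite subKr.
  apply: le_trans (cmD _ _) _; rewrite cmN lerD ?hB //.
  by apply: le_trans (h2 T hT2 x hx) _; rewrite /e1 ge_min lexx.
have -> : P * E M x - Q * F M T x = P * (E M x - F M T x) + (P - Q) * F M T x by ring.
apply: le_trans (cmD _ _) _; rewrite !cmM.
have e2 : e1 * (1 + B + B ^+ M) <= eps / 2.
  by rewrite -ler_pdivlMr // /e1 ge_min lexx orbT.
have h3 : cm P * cm (E M x - F M T x) <= B ^+ M * e1 by rewrite ler_pM ?cm_ge0 ?h2.
have h4 : cm (P - Q) * cm (F M T x) <= e1 * (B + 1) by rewrite ler_pM ?cm_ge0 ?h1.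
have h5 := ltW e10; lra.
Qed.

(* Otherwise the product of the E (zeta w^j) vanishes on the unit circle, and
   so does the mean of its truncations, which is the power s_0^M. *)
Lemma nonzero_rotation (R : realType) (M : nat) (w : R[i]) (s : nat -> R) (E : R[i] -> R[i]) :
  cm w = 1 -> s 0%N != 0 -> (exists B, forall x, cm x = 1 -> cm (E x) <= B) ->
  (forall eps : R, 0 < eps -> exists T0, forall T, (T0 <= T)%N -> forall x, cm x = 1 ->
     cm (E x - pev s T x) <= eps) ->
  exists2 zeta : R[i], cm zeta = 1 & forall j, (j < M)%N -> E (zeta * w ^+ j) != 0.
Proof.
move=> w1 s0 [B hB] hE.
have B0 : 0 <= B by apply: le_trans (hB 1 (cm1 R)); rewrite cm_ge0.
apply: contrapT => hno.
have wj j : cm (w ^+ j) = 1 by rewrite cmX w1 expr1n.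
have hz x : cm x = 1 -> \prod_(j < M) E (x * w ^+ j) = 0.
  move=> hx; apply/eqP; apply: contrapT => /negP /prodf_neq0 h.
  by apply: hno; exists x => // j jM; have := h (Ordinal jM) isT.
pose eps := `|s 0%N| ^+ M / 2.
have sM : 0 < `|s 0%N| ^+ M by rewrite exprn_gt0 // normr_gt0.
have e0 : 0 < eps by rewrite divr_gt0.
have [||T0 hT] := @unif_prod R M (fun j x => E (x * w ^+ j)) (fun j T x => pev s T (x * w ^+ j))
   [set x | cm x = 1] B B0 _ _ eps e0.
- by move=> j x hx; apply: hB; rewrite cmM hx wj mulr1.
- move=> j e he; have [T0 h] := hE e he; exists T0 => T hT x hx; apply: h => //.
  by rewrite cmM hx wj mulr1.
pose T := T0.+1; pose q j : {poly R[i]} := \poly_(k < T) ((s k)%:C%C * (w ^+ j) ^+ k).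
pose p := \prod_(j < M) q j.
have ep x : p.[x] = \prod_(j < M) pev s T (x * w ^+ j).
  rewrite /p horner_prod; apply: eq_bigr => j _; rewrite /q horner_poly /pev big_mkord.
  by apply: eq_bigr => k _; rewrite exprMn; ring.
have p0 : p`_0 = (s 0%N)%:C%C ^+ M.
  rewrite -horner_coef0 ep -[RHS](_ : \prod_(j < M) (s 0%N)%:C%C = _); last by rewrite prodr_const card_ord.
  apply: eq_bigr => j _.
  rewrite mul0r /pev big_nat_recl // expr0 mulr1 big1 ?addr0 // => k _.
  by rewrite exprS mul0r mulr0.
pose M' := (size p).+1; have [v hv v1] := prim_root_ex R (ltn0Sn (size p)).
have := horner_avg hv v1 (leqnSn _) (ltn0Sn _); rewrite p0 => hs.
have : cm (\sum_(j < M') p.[v ^+ j]) <= M'%:R * eps.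
  apply: le_trans (cm_sum _ _ _) _; rewrite mulr_natl -[X in _ *+ X](card_ord M') -sumr_const.
  apply: ler_sum => j _.
  have vj : cm (v ^+ j) = 1 by rewrite cmX v1 expr1n.
  have := hT T (leqnSn _) _ vj; rewrite /= hz // sub0r cmN -ep //.
rewrite hs cmM cmX cmR -(rmorph_nat (real_complex R)) cmR normr_nat.
by rewrite ler_pM2l ?ltr0n // /eps; lra.
Qed.

Lemma ev_conv (R : realType) (a b c : nat -> R) (z : R[i]) :
  asum (fun k => `|a k|) -> asum (fun k => `|b k|) -> asum (fun k => `|c k|) ->
  (forall k, c k = \sum_(0 <= i < k.+1) a i * b (k - i)%N) -> cm z = 1 ->
  ztransform c z = ztransform a z * ztransform b z.
Proof.
move=> ha hb hc hconv z1; set x := z^-1; have x1 : cm x = 1 by rewrite cm_inv.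
have [Sa hSa] := ha; have [Sb hSb] := hb.
have Sa0 : 0 <= Sa by have := hSa 0%N; rewrite big_geq.
have Sb0 : 0 <= Sb by have := hSb 0%N; rewrite big_geq.
have bnd (s : nat -> R) S T : (forall m, \sum_(0 <= k < m) `|s k| <= S) -> cm (pev s T x) <= S.
  move=> h; apply: le_trans (cm_sum _ _ _) _; apply: le_trans (h T); apply: ler_sum => k _.
  by rewrite cmM cmR cmX x1 expr1n mulr1.
(* The truncated product exceeds the truncated convolution by the pairs [i, j < T] with
   [i + j >= T]. As [T >= Ta + Tb], each of them has [i >= Ta] or [j >= Tb], hence a factor in a
   small tail. *)
have conv_tail (eps : R) : 0 < eps -> exists T0, forall T, (T0 <= T)%N ->
    cm (pev c T x - pev a T x * pev b T x) <= eps.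
  move=> e0; have p0 : 0 < 1 + Sa + Sb by rewrite !ltr_pwDl.
  pose e1 := eps / (1 + Sa + Sb); have e10 : 0 < e1 by rewrite divr_gt0.
  have [Ta hTa] := asum_tail (fun k => normr_ge0 (a k)) ha e10.
  have [Tb hTb] := asum_tail (fun k => normr_ge0 (b k)) hb e10.
  exists (Ta + Tb)%N => T hT.
  have -> : pev c T x = \sum_(0 <= i < T) \sum_(0 <= j < T - i) ((a i)%:C%C * x ^+ i) * ((b j)%:C%C * x ^+ j).
    rewrite -(sum_triangle (fun i j => ((a i)%:C%C * x ^+ i) * ((b j)%:C%C * x ^+ j))).
    apply: eq_bigr => k _; rewrite hconv rmorph_sum mulr_suml; apply: eq_big_nat => i /andP[_ ik].
    rewrite rmorphM /= mulrACA -exprD subnKC //.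
  rewrite /pev mulr_suml -sumrB; apply: le_trans (cm_sum _ _ _) _.
  apply: (@le_trans _ _ (\sum_(0 <= i < T) `|a i| * \sum_(T - i <= j < T) `|b j|)).
    apply: ler_sum => i _; rewrite -mulr_sumr -mulrBr cmM cmM cmR cmX x1 expr1n mulr1.
    apply: ler_wpM2l => //.
    rewrite (@big_cat_nat _ _ _ (T - i)%N 0%N T) //= ?leq_subr // opprD addNKr cmN.
    apply: le_trans (cm_sum _ _ _) _; apply: ler_sum => j _.
    by rewrite cmM cmR cmX x1 expr1n mulr1.
  rewrite (@big_cat_nat _ _ _ Ta 0%N T) ?(leq_trans (leq_addr _ _) hT) //=.
  apply: (@le_trans _ _ (Sa * e1 + e1 * Sb)); last first.
    rewrite [_ * e1]mulrC -mulrDr /e1 mulrAC ler_pdivrMr // ler_wpM2l ?(ltW e0) //; lra.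
  apply: lerD.
    apply: (@le_trans _ _ (\sum_(0 <= i < Ta) `|a i| * e1)); last first.
      by rewrite -mulr_suml ler_wpM2r ?hSa // ltW.
    rewrite !big_nat; apply: ler_sum => i /andP[_ iT]; apply: ler_wpM2l => //.
    by apply: hTb; lia.
  apply: (@le_trans _ _ (\sum_(Ta <= i < T) `|a i| * Sb)); last first.
    by rewrite -mulr_suml ler_wpM2r ?hTa.
  apply: ler_sum => i _; apply: ler_wpM2l => //.
  apply: le_trans (hSb T); rewrite [leRHS](@big_cat_nat _ _ _ (T - i)%N) ?leq_subr //= lerDr.
  by apply: sumr_ge0.
apply/eqP; rewrite -subr_eq0; apply/eqP; apply: cm_eq0; apply/eqP; rewrite eq_le cm_ge0 andbT.
apply/ler_addgt0Pl => e e0; rewrite addr0.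
(* The summand [e] in the denominator makes [e1 <= 1], so that the quadratic error [e1 * e1] is at
   most [e1]. *)
pose e1 := e / (4 + Sa + Sb + e); have p0 : 0 < 4 + Sa + Sb + e by lra.
have e10 : 0 < e1 by rewrite divr_gt0.
have e1e : e1 * (4 + Sa + Sb + e) = e by rewrite divfK ?gt_eqF.
have [Tc hTc] := ztransform_lim hc e10.
have [Ta hTa] := ztransform_lim ha e10.
have [Tb hTb] := ztransform_lim hb e10.
have [Td hTd] := conv_tail e1 e10.
pose T := (Tc + Ta + Tb + Td)%N.
have {}hTc := hTc T ltac:(lia) z z1; have {}hTa := hTa T ltac:(lia) z z1.
have {}hTb := hTb T ltac:(lia) z z1; have {}hTd := hTd T ltac:(lia).
rewrite -/x in hTa hTb hTc.
have hA := bnd a Sa T hSa; have hB := bnd b Sb T hSb.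
set A := ztransform a z in hTa *; set B := ztransform b z in hTb *; set C := ztransform c z in hTc *.
move: (pev a T x) (pev b T x) (pev c T x) hTa hTb hTc hTd hA hB => A' B' C' hTa hTb hTc hTd hA hB.
have -> : C - A * B = (C - C') + ((C' - A' * B') - (A - A') * (B - B')) - (A - A') * B' - A' * (B - B') by ring.
apply: le_trans (cmD _ _) _; rewrite cmN.
apply: le_trans (lerD (le_trans (cmD _ _) (lerD (cmD _ _) (lexx _))) (lexx _)) _; rewrite cmN.
apply: le_trans (lerD (lerD (lerD (lexx _) (cmD _ _)) (lexx _)) (lexx _)) _; rewrite cmN !cmM.
have q1 : cm (A - A') * cm (B - B') <= e1 * e1 by rewrite ler_pM ?cm_ge0.
have q2 : cm (A - A') * cm B' <= e1 * Sb by rewrite ler_pM ?cm_ge0.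
have q3 : cm A' * cm (B - B') <= Sa * e1 by rewrite ler_pM ?cm_ge0.
have q4 : e1 <= 1.
  by rewrite /e1 ler_pdivrMr // mul1r; lra.
have q5 : e1 * e1 <= e1 * 1 by rewrite ler_wpM2l // ltW.
have q6 : 0 <= e1 * e by rewrite mulr_ge0 // ltW.
lra.
Qed.

Lemma ztransform_bound (R : realType) (s : nat -> R) (S : R) (z : R[i]) :
  (forall m, \sum_(0 <= k < m) `|s k| <= S) -> cm z = 1 -> cm (ztransform s z) <= S.
Proof.
move=> h z1; apply/ler_addgt0Pl => e e0.
have [T0 hT] := ztransform_lim (ex_intro _ S h) e0.
have -> : ztransform s z = (ztransform s z - pev s T0 z^-1) + pev s T0 z^-1 by rewrite subrK.
apply: le_trans (cmD _ _) _; apply: lerD; first exact: hT.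
apply: le_trans (cm_sum _ _ _) _; apply: le_trans (h T0); apply: ler_sum => k _.
by rewrite cmM cmR cmX cm_inv // expr1n mulr1.
Qed.

Lemma ztransform_lin (R : realType) (I : Type) (r : seq I) (a : I -> nat -> R) (c : nat -> R) (z : R[i]) :
  (forall i, asum (fun k => `|a i k|)) -> asum (fun k => `|c k|) ->
  (forall k, c k = \sum_(i <- r) a i k) -> cm z = 1 ->
  ztransform c z = \sum_(i <- r) ztransform (a i) z.
Proof.
move=> ha hc hs z1; set x := z^-1.
apply/eqP; rewrite -subr_eq0; apply/eqP; apply: cm_eq0; apply/eqP; rewrite eq_le cm_ge0 andbT.
apply/ler_addgt0Pl => e e0; rewrite addr0.
have e2 : 0 < e / 2 by lra.
have [Tc hTc] := ztransform_lim hc e2.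
suff : exists T0, forall T, (T0 <= T)%N ->
    cm (\sum_(i <- r) (pev (a i) T x - ztransform (a i) z)) <= e / 2.
  case=> T0 h; pose T := (Tc + T0)%N; have := hTc T ltac:(lia) z z1; have := h T ltac:(lia).
  have -> : pev c T z^-1 = \sum_(i <- r) pev (a i) T x.
    rewrite /pev exchange_big /=; apply: eq_bigr => k _; by rewrite hs rmorph_sum mulr_suml.
  rewrite sumrB; set P := \sum_(i <- r) pev _ _ _; set Q := \sum_(i <- r) _ => h1 h2.
  have -> : ztransform c z - Q = (ztransform c z - P) + (P - Q) by rewrite addrA subrK.
  by apply: le_trans (cmD _ _) _; lra.
elim: r {hs hc Tc hTc e0} (e / 2) e2 => [|i r IH] e1 e10.
  by exists 0%N => T _; rewrite big_nil cm0 ltW.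
have e3 : 0 < e1 / 2 by lra.
have [T0 h] := IH _ e3; have [T1 h1] := ztransform_lim (ha i) e3.
exists (T0 + T1)%N => T hT; rewrite big_cons; apply: le_trans (cmD _ _) _.
have := h T ltac:(lia); have := h1 T ltac:(lia) z z1; rewrite -cmN opprB -/x; lra.
Qed.

(** * Vector-valued transforms and their truncations *)

Definition csq (R : realType) (q : nat) (w : 'rV[R[i]]_q) : R := \sum_j cm (w 0 j) ^+ 2.

Lemma csq_ge0 (R : realType) (q : nat) (w : 'rV[R[i]]_q) : 0 <= csq w.
Proof. by apply: sumr_ge0 => j _; rewrite sqr_ge0. Qed.

Lemma csqD (R : realType) (q : nat) (v w : 'rV[R[i]]_q) : csq (v + w) <= 2 * csq v + 2 * csq w.
Proof.
rewrite /csq !mulr_sumr -big_split; apply: ler_sum => j _ /=; rewrite mxE.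
apply: (@le_trans _ _ ((cm (v 0 j) + cm (w 0 j)) ^+ 2)).
  by rewrite ler_pXn2r ?nnegrE ?addr_ge0 ?cm_ge0 // cmD.
have := sqr_ge0 (cm (v 0 j) - cm (w 0 j)); nra.
Qed.

Lemma csq_mul (R : realType) (p q : nat) (w : 'rV[R[i]]_p) (Q : 'M[R[i]]_(p, q)) (B : R) :
  0 <= B -> (forall i j, cm (Q i j) <= B) -> csq (w *m Q) <= (p * q)%:R * B ^+ 2 * csq w.
Proof.
move=> B0 hB; rewrite /csq.
apply: (@le_trans _ _ (\sum_(j < q) (csq w * (p%:R * B ^+ 2)))); last first.
  by rewrite sumr_const card_ord -mulr_natl natrM le_eqVlt; apply/orP; left; apply/eqP; rewrite /csq; ring.
apply: ler_sum => j _; rewrite mxE.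
apply: (@le_trans _ _ ((\sum_k cm (w 0 k) * cm (Q k j)) ^+ 2)).
  rewrite ler_pXn2r ?nnegrE ?cm_ge0 ?sumr_ge0 // => [|k _]; last by rewrite mulr_ge0 ?cm_ge0.
  apply: le_trans (cm_sum _ _ _) _; by apply: ler_sum => k _; rewrite cmM.
apply: le_trans (sum_CS _ _ _ _) _; apply: ler_wpM2l; first exact: csq_ge0.
apply: (@le_trans _ _ (\sum_(k < p) B ^+ 2)); last by rewrite sumr_const card_ord mulr_natl.
apply: ler_sum => k _; by rewrite ler_pXn2r ?nnegrE ?cm_ge0.
Qed.

Definition mev (R : realType) (p q : nat) (h : nat -> 'M[R]_(p, q)) (n : nat) (x : R[i]) :
  'M[R[i]]_(p, q) := \matrix_(i, j) pev (fun k => h k i j) n x.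

Lemma asum_entry (R : realType) (p q : nat) (h : nat -> 'M[R]_(p, q)) i j :
  asum (fun k => normF (h k)) -> asum (fun k => `|h k i j|).
Proof. by apply: asum_le => k; exact: entry_normF. Qed.

Lemma asum_conv (R : realType) (a b : nat -> R) :
  asum (fun k => `|a k|) -> asum (fun k => `|b k|) ->
  asum (fun k => `|\sum_(0 <= m < k.+1) a m * b (k - m)%N|).
Proof.
move=> [Sa hSa] [Sb hSb]; exists (Sa * Sb) => m.
apply: (@le_trans _ _ (\sum_(0 <= k < m) \sum_(0 <= i < k.+1) `|a i| * `|b (k - i)%N|)).
  apply: ler_sum => k _; apply: le_trans (ler_norm_sum _ _ _) _.
  by apply: ler_sum => l _; rewrite normrM.
apply: le_trans (sum_conv_le (f := fun i => `|a i|) (g := fun i => `|b i|) (S := Sb) _ _) _ => //.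
by rewrite ler_wpM2r // (le_trans _ (hSb 0%N)) // big_geq.
Qed.

Lemma asum_abs_sum (R : realType) (I : finType) (a : I -> nat -> R) :
  (forall i, asum (fun k => `|a i k|)) -> asum (fun k => `|\sum_i a i k|).
Proof.
move=> h; have [S hS] := choice h.
exists (\sum_i S i) => m; apply: (@le_trans _ _ (\sum_(0 <= k < m) \sum_i `|a i k|)).
  by apply: ler_sum => k _; exact: ler_norm_sum.
by rewrite exchange_big /=; apply: ler_sum.
Qed.

Lemma ztransform_row (R : realType) (q : nat) (h : nat -> 'M[R]_q) (g : nat -> 'rV[R]_q)
    (c : nat -> R) (j : 'I_q) (z : R[i]) :
  asum (fun k => normF (h k)) -> asum (fun k => normF (g k)) ->
  (forall k, c k = \sum_l \sum_(0 <= m < k.+1) g m 0 l * h (k - m)%N l j) -> cm z = 1 ->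
  ztransform c z = \sum_l transfer g z 0 l * transfer h z l j.
Proof.
move=> hh hg hc z1.
have ha l := asum_conv (asum_entry 0 l hg) (asum_entry l j hh).
rewrite (ztransform_lin ha _ hc z1); last first.
  under [X in asum X]eq_fun do rewrite hc; exact: (asum_abs_sum ha).
apply: eq_bigr => l _; rewrite !mxE.
by rewrite (ev_conv (asum_entry 0 l hg) (asum_entry l j hh) (ha l) (fun k => erefl) z1).
Qed.

Lemma ztransform_mulb (R : realType) (s : nat -> R) (b : bool) (z : R[i]) :
  ztransform (fun k => s k *+ b) z = ztransform s z *+ b.
Proof.
case: b; first by rewrite mulr1n.
rewrite /ztransform /csum mulr0n; under [X in series X]eq_fun do rewrite mulr0n mul0r.
under [X in Complex _ (limn (series X))]eq_fun do rewrite mulr0n mul0r.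
by rewrite /series /=; under eq_fun do rewrite big1 //; rewrite lim_cst.
Qed.

(** The rows [g i], divided by [dn i], form a bounded left inverse [Q] of the transfer matrix [H]
    wherever the denominators do not vanish. As [H] is square, [Q] is also a right inverse, so
    [w = w H Q]. The constant does not see how small the denominators are. *)
Lemma transfer_lb (R : realType) (q : nat) (h : nat -> 'M[R]_q)
    (g : 'I_q -> nat -> 'rV[R]_q) (dn : 'I_q -> nat -> R) (B : R) :
  asum (fun k => normF (h k)) -> (forall i, asum (fun k => normF (g i k))) ->
  (forall i k j, dn i k *+ (i == j) = \sum_l \sum_(0 <= m < k.+1) g i m 0 l * h (k - m)%N l j) ->
  (forall z : R[i], cm z = 1 -> forall i l,
     cm (transfer (g i) z 0 l) <= B * cm (ztransform (dn i) z)) ->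
  exists2 c : R, 0 < c & forall z, cm z = 1 -> (forall i, ztransform (dn i) z != 0) ->
    forall w : 'rV[R[i]]_q, c * csq w <= csq (w *m transfer h z).
Proof.
case: q h g dn => [|q] h g dn hh hg hrow hM.
  by exists 1 => // z _ _ w; rewrite /csq !big_ord0 mulr0.
pose B1 := 1 + `|B|; have B0 : 0 < B1 by rewrite ltr_pwDl.
have q0 : 0 < (q.+1 * q.+1)%:R * B1 ^+ 2 :> R by rewrite mulr_gt0 ?exprn_gt0 // ltr0n.
exists ((q.+1 * q.+1)%:R * B1 ^+ 2)^-1; first by rewrite invr_gt0.
move=> z z1 dz w; rewrite mulrC ler_pdivrMr // mulrC.
pose Q : 'M[R[i]]_q.+1 := \matrix_(i, l) (transfer (g i) z 0 l / ztransform (dn i) z).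
have hQ : Q *m transfer h z = 1%:M.
  apply/matrixP => i j; rewrite mxE [RHS]mxE.
  under eq_bigr => l _ do rewrite mxE mulrAC.
  rewrite -mulr_suml -(ztransform_row hh (hg i) (hrow i ^~ j) z1) ztransform_mulb.
  by case: (_ == _); rewrite ?mulr1n ?mulr0n ?mul0r // divff.
rewrite {1}(_ : w = w *m transfer h z *m Q); last by rewrite -mulmxA (mulmx1C hQ) mulmx1.
apply: csq_mul => [|i l]; first exact: ltW.
have cd : 0 < cm (ztransform (dn i) z).
  by rewrite lt0r cm_ge0 andbT; apply: contra (dz i) => /eqP /cm_eq0 ->.
have hV (y : R[i]) : y != 0 -> cm y^-1 = (cm y)^-1.
  move=> y0; have c0 : cm y != 0 by apply: contra y0 => /eqP /cm_eq0 ->.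
  by apply: (mulfI c0); rewrite -cmM !divff // cm1.
rewrite mxE cmM hV // ler_pdivrMr //; apply: le_trans (hM z z1 i l) _.
by rewrite ler_pM2r // /B1 (le_trans (ler_norm B)) // lerDr.
Qed.

Lemma transfer_mev (R : realType) (p q : nat) (h : nat -> 'M[R]_(p, q)) (eps : R) :
  asum (fun k => normF (h k)) -> 0 < eps ->
  exists n0, forall n, (n0 <= n)%N -> forall z : R[i], cm z = 1 -> forall i j,
    cm (transfer h z i j - mev h n z^-1 i j) <= eps.
Proof.
move=> hh e0; have [n0 hn0] := choice (fun ij : 'I_p * 'I_q => ztransform_lim (asum_entry ij.1 ij.2 hh) e0).
exists (\max_ij n0 ij)%N => n hn z z1 i j; rewrite !mxE.
by apply: (hn0 (i, j)) => //; apply: leq_trans hn; exact: leq_bigmax.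
Qed.

Lemma mev_bound (R : realType) (p q : nat) (h : nat -> 'M[R]_(p, q)) (S : R) (n : nat) (x : R[i]) i j :
  (forall m, \sum_(0 <= k < m) normF (h k) <= S) -> cm x = 1 -> cm (mev h n x i j) <= S.
Proof.
move=> hS x1; rewrite mxE; apply: le_trans (cm_sum _ _ _) _; apply: le_trans (hS n).
by apply: ler_sum => k _; rewrite cmM cmR cmX x1 expr1n mulr1 entry_normF.
Qed.

(** The threshold [n0] is uniform in [z], although the bound on the full transform is assumed point
    by point. *)
Lemma mev_lb (R : realType) (q : nat) (h : nat -> 'M[R]_q) (c : R) :
  asum (fun k => normF (h k)) -> 0 < c ->
  exists n0, forall n, (n0 <= n)%N -> forall z : R[i], cm z = 1 ->
    (forall w : 'rV[R[i]]_q, c * csq w <= csq (w *m transfer h z)) ->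
    forall w : 'rV[R[i]]_q, c / 4 * csq w <= csq (w *m mev h n z^-1).
Proof.
move=> hh c0.
(* [eps <= 1] replaces [eps^2] by [eps], and the other bound keeps the truncation error below
   [c / 4]. *)
pose eps := Num.min 1 (c / (4 * (1 + (q * q)%:R))).
have p0 : 0 < 4 * (1 + (q * q)%:R) :> R by rewrite mulr_gt0 // ltr_pwDl.
have e0 : 0 < eps by rewrite lt_min ltr01 divr_gt0.
have [n0 h0] := transfer_mev hh e0; exists n0 => n hn z z1 hz w.
have e1 : (q * q)%:R * eps ^+ 2 <= c / 4.
  apply: (@le_trans _ _ ((1 + (q * q)%:R) * eps)).
    rewrite ler_pM ?sqr_ge0 ?ler0n ?lerDr // expr2 ler_piMr ?(ltW e0) //.
    by rewrite /eps ge_min lexx.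
  have : eps <= c / (4 * (1 + (q * q)%:R)) by rewrite /eps ge_min lexx orbT.
  rewrite ler_pdivlMr //; lra.
have := csqD (w *m mev h n z^-1) (w *m (transfer h z - mev h n z^-1)).
rewrite -mulmxDr [mev _ _ _ + _]addrC subrK => h1.
have h2 : csq (w *m (transfer h z - mev h n z^-1)) <= (q * q)%:R * eps ^+ 2 * csq w.
  apply: csq_mul => [|i j]; first exact: ltW.
  have e (X Y : 'M[R[i]]_q) : (X - Y) i j = X i j - Y i j by rewrite !mxE.
  by rewrite e; exact: h0.
have h3 := hz w; have h4 := csq_ge0 w.
have h5 : (q * q)%:R * eps ^+ 2 * csq w <= c / 4 * csq w by rewrite ler_wpM2r.
lra.
Qed.

Lemma mev_ub (R : realType) (p q : nat) (h : nat -> 'M[R]_(p, q)) (S : R) (n : nat) (x : R[i]) w :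
  (forall m, \sum_(0 <= k < m) normF (h k) <= S) -> cm x = 1 ->
  csq (w *m mev h n x) <= (p * q)%:R * S ^+ 2 * csq w.
Proof.
move=> hS x1; apply: csq_mul; first by have := hS 0%N; rewrite big_geq.
by move=> i j; exact: mev_bound.
Qed.

(* The first 2 n coefficients of v(x) h_n(x), h_n being h truncated at n. *)
Definition tconv (R : realType) (p q : nat) (n : nat) (v : nat -> 'rV[R]_p) (h : nat -> 'M[R]_(p, q))
    (m : nat) : 'rV[R]_q :=
  \sum_(0 <= i < n) \sum_(0 <= l < n) (v i *m h l) *+ (i + l == m)%N.

(** Stated for any additive functional of the coefficients, since it serves both the evaluation at a
    point of the circle and the filtered regressor. *)
Lemma tconv_sum (R : realType) (p q : nat) (n : nat) (v : nat -> 'rV[R]_p) (h : nat -> 'M[R]_(p, q))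
    (V : zmodType) (f : nat -> 'rV[R]_q -> V) :
  (forall m a b, f m (a + b) = f m a + f m b) ->
  \sum_(0 <= m < n + n) f m (tconv n v h m) =
  \sum_(0 <= i < n) \sum_(0 <= l < n) f (i + l)%N (v i *m h l).
Proof.
move=> fD; have f0 m : f m 0 = 0 by apply: (@addrI _ (f m 0)); rewrite -fD !addr0.
have fS m := big_morph (f m) (fD m) (f0 m).
rewrite /tconv; under eq_bigr => m _ do rewrite fS.
rewrite exchange_big /=; apply: eq_big_nat => i /andP[_ hi].
under eq_bigr => m _ do rewrite fS.
rewrite exchange_big /=; apply: eq_big_nat => l /andP[_ hl].
rewrite (bigD1_seq (i + l)%N) ?iota_uniq ?mem_index_iota /= ?eqxx ?big1_seq ?addr0 ?mulr1n //.
  by move=> m /andP[hm _]; rewrite eq_sym (negbTE hm) mulr0n f0.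
lia.
Qed.

Definition vev (R : realType) (q : nat) (v : nat -> 'rV[R]_q) (n : nat) (x : R[i]) : 'rV[R[i]]_q :=
  \row_j pev (fun k => v k 0 j) n x.

Lemma vev_tconv (R : realType) (p q : nat) (n : nat) (v : nat -> 'rV[R]_p) (h : nat -> 'M[R]_(p, q))
    (x : R[i]) :
  vev (tconv n v h) (n + n) x = vev v n x *m mev h n x.
Proof.
apply/rowP => j; rewrite !mxE /pev.
pose f m (u : 'rV[R]_q) : R[i] := (u 0 j)%:C%C * x ^+ m.
have fD m u w : f m (u + w) = f m u + f m w by rewrite /f mxE rmorphD mulrDl.
rewrite [LHS](tconv_sum n v h fD) /f.
under [RHS]eq_bigr => k _ do rewrite !mxE mulr_suml.
rewrite [RHS]exchange_big /=; apply: eq_bigr => i _.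
under [RHS]eq_bigr => k _ do rewrite mulr_sumr.
rewrite [RHS]exchange_big /=; apply: eq_bigr => l _.
rewrite mxE rmorph_sum mulr_suml; apply: eq_bigr => k _.
by rewrite rmorphM exprD mulrACA.
Qed.

Lemma vparseval (R : realType) (M L q : nat) (w zeta : R[i]) (v : nat -> 'rV[R]_q) :
  M.-primitive_root w -> cm w = 1 -> cm zeta = 1 -> (L <= M)%N ->
  \sum_(j < M) csq (vev v L (zeta * w ^+ j)) = M%:R * \sum_(0 <= k < L) sqn (v k).
Proof.
move=> hw w1 z1 LM; rewrite /csq exchange_big /=.
under eq_bigr => i _.
  under eq_bigr => j _ do rewrite mxE.
  rewrite (parseval _ hw) //; over.
rewrite -mulr_sumr exchange_big /=; congr (_ * _); apply: eq_bigr => k _; by rewrite sqnE.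
Qed.

(** * Toeplitz forms as averages of the spectrum *)

Definition spterm (R : realType) (s : int -> R) (z : R[i]) (k : nat) : R[i] :=
  if k == 0%N then (s 0)%:C%C else (s k%:Z)%:C%C * z ^- k + (s (- k%:Z))%:C%C * z ^+ k.

(** [L <= T] keeps every lag below [L] in the truncated spectrum and [L + T <= M] excludes aliasing,
    so the average selects a single covariance. *)
Lemma spterm_avg (R : realType) (M L T : nat) (w zeta : R[i]) (s : int -> R) (m m' : nat) :
  M.-primitive_root w -> cm w = 1 -> cm zeta = 1 -> (L <= T)%N -> (L + T <= M)%N ->
  (m < L)%N -> (m' < L)%N ->
  \sum_(j < M) (let x := zeta * w ^+ j in
     x ^+ m' * ((x^*)%C) ^+ m * \sum_(0 <= k < T) spterm s x k) = M%:R * (s (m'%:Z - m%:Z))%:C%C.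
Proof.
move=> hw w1 z1 LT TM mL mL'.
have avg a b (c : R[i]) : (a < M)%N -> (b < M)%N ->
   \sum_(j < M) c * ((zeta * w ^+ j) ^+ a * ((zeta * w ^+ j)^*)%C ^+ b) = c * (a == b)%:R * M%:R.
  by move=> aM bM; rewrite -mulr_sumr (avg_unit hw w1 z1 aM bM) mulrA.
have inner k : (k < T)%N -> \sum_(j < M) (let x := zeta * w ^+ j in
    x ^+ m' * ((x^*)%C) ^+ m * spterm s x k) =
    (if k == 0%N then (s 0)%:C%C * (m' == m)%:R else
      (s k%:Z)%:C%C * (m' == m + k)%N%:R + (s (- k%:Z))%:C%C * (m' + k == m)%N%:R) * M%:R.
  case: k => [|k] kT; rewrite /spterm /=.
    rewrite -(avg m' m) ?(leq_trans mL') ?(leq_trans mL) ?(leq_trans (leq_addr _ _) TM) //.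
    by apply: eq_bigr => j _; rewrite mulrC.
  rewrite mulrDl -!avg; try lia.
  rewrite -big_split /=; apply: eq_bigr => j _; set x := zeta * w ^+ j.
  have x1 : cm x = 1 by rewrite /x cmM cmX w1 expr1n mulr1.
  rewrite -exprVn (cmV1 x1) !exprD; ring.
under eq_bigr => j _ do rewrite /= mulr_sumr.
rewrite exchange_big /=.
rewrite (eq_big_nat _ _ (F2 := fun k => (if k == 0%N then (s 0)%:C%C * (m' == m)%:R else
      (s k%:Z)%:C%C * (m' == m + k)%N%:R + (s (- k%:Z))%:C%C * (m' + k == m)%N%:R) * M%:R)); last first.
  by move=> k /andP[_ kT]; exact: inner.
rewrite -mulr_suml mulrC; congr (_ * _).
pose F k : R[i] := if k == 0%N then (s 0)%:C%C * (m' == m)%:R else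
      (s k%:Z)%:C%C * (m' == m + k)%N%:R + (s (- k%:Z))%:C%C * (m' + k == m)%N%:R.
have F0 (d k : nat) : (m + d = m' \/ m' + d = m)%N -> k != d -> F k = 0.
  move=> hd hk; rewrite /F; case: k hk => [|k] hk /=.
    have -> : (m' == m) = false by lia.
    by rewrite mulr0.
  have -> : (m' == m + k.+1)%N = false by lia.
  have -> : (m' + k.+1 == m)%N = false by lia.
  by rewrite !mulr0 addr0.
have Fsum d : (d < T)%N -> (m + d = m' \/ m' + d = m)%N -> \sum_(0 <= k < T) F k = F d.
  move=> dT hd; rewrite (bigD1_seq d) ?iota_uniq ?mem_index_iota //= big1_seq ?addr0 //.
  by move=> k /andP[hk _]; exact: F0 hd hk.
have [mm|mm] := leqP m m'.
  rewrite (Fsum (m' - m)%N); try lia.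
  rewrite /F; case: eqP => [e|e].
    have -> : m' = m by lia.
    by rewrite eqxx mulr1 subrr.
  have -> : (m' == m + (m' - m))%N by lia.
  have -> : (m' + (m' - m) == m)%N = false by lia.
  by rewrite mulr1 mulr0 addr0 subzn.
rewrite (Fsum (m - m')%N); try lia.
rewrite /F.
have -> : (m - m' == 0)%N = false by lia.
have -> : (m' == m + (m - m'))%N = false by lia.
have -> : (m' + (m - m') == m)%N by lia.
by rewrite mulr0 add0r mulr1 -subzn 1?ltnW // opprB.
Qed.

Definition spT (R : realType) (q : nat) (S : int -> 'M[R]_q) (T : nat) (z : R[i]) : 'M[R[i]]_q :=
  \matrix_(i, j) \sum_(0 <= k < T) spterm (fun tau => S tau i j) z k.

Definition hform (R : realType) (q : nat) (S : 'M[R[i]]_q) (p : 'rV[R[i]]_q) : R[i] :=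
  (map_mx (@conjc R) p *m S *m p^T) 0 0.

Lemma hformE (R : realType) (q : nat) (S : 'M[R[i]]_q) (p : 'rV[R[i]]_q) :
  hform S p = \sum_a \sum_b ((p 0 a)^*)%C * S a b * p 0 b.
Proof.
rewrite /hform mxE exchange_big /=; apply: eq_bigr => b _.
by rewrite !mxE mulr_suml; apply: eq_bigr => a _; rewrite mxE.
Qed.

Definition toepform (R : realType) (q : nat) (S : int -> 'M[R]_q) (L : nat) (c : nat -> 'rV[R]_q) : R :=
  \sum_(0 <= m < L) \sum_(0 <= m' < L) (c m *m S (m'%:Z - m%:Z) *m (c m')^T) 0 0.

Lemma hform_avg (R : realType) (M L T q : nat) (w zeta : R[i]) (S : int -> 'M[R]_q) (c : nat -> 'rV[R]_q) :
  M.-primitive_root w -> cm w = 1 -> cm zeta = 1 -> (L <= T)%N -> (L + T <= M)%N ->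
  \sum_(j < M) hform (spT S T (zeta * w ^+ j)) (vev c L (zeta * w ^+ j))
  = (M%:R * toepform S L c)%:C%C.
Proof.
move=> hw w1 z1 LT TM.
have scal (s : int -> R) (al be : nat -> R) :
  \sum_(j < M) (let x := zeta * w ^+ j in
    ((pev al L x)^*)%C * (\sum_(0 <= k < T) spterm s x k) * pev be L x) =
  M%:R * (\sum_(0 <= m < L) \sum_(0 <= m' < L) al m * s (m'%:Z - m%:Z) * be m')%:C%C.
  rewrite /= rmorph_sum mulr_sumr /=.
  transitivity (\sum_(0 <= m < L) \sum_(0 <= m' < L) (al m)%:C%C * (be m')%:C%C *
     \sum_(j < M) (let x := zeta * w ^+ j in
     x ^+ m' * ((x^*)%C) ^+ m * \sum_(0 <= k < T) spterm s x k)); last first.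
    apply: eq_big_nat => m /andP[_ mL]; rewrite rmorph_sum mulr_sumr; apply: eq_big_nat => m' /andP[_ mL'].
    rewrite (spterm_avg _ hw w1 z1 LT TM mL mL') !rmorphM /=; ring.
  under [RHS]eq_bigr => m _.
    under eq_bigr => m' _ do rewrite mulr_sumr.
    rewrite exchange_big /=; over.
  rewrite [RHS]exchange_big /=; apply: eq_bigr => j _.
  set x := zeta * w ^+ j; set X := \sum_(0 <= k < T) _.
  rewrite {1}/pev rmorph_sum /= mulr_suml mulr_suml; apply: eq_bigr => m _.
  rewrite /pev mulr_sumr; apply: eq_bigr => m' _.
  have -> : (((al m)%:C%C * x ^+ m)^*)%C = (al m)%:C%C * ((x^*)%C) ^+ m.
    by rewrite rmorphM rmorphXn /= oppr0.
  ring.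
under eq_bigr => j _ do rewrite hformE.
rewrite exchange_big /= rmorphM rmorph_nat /toepform.
transitivity (\sum_a \sum_b M%:R * (\sum_(0 <= m < L) \sum_(0 <= m' < L)
    c m 0 a * S (m'%:Z - m%:Z) a b * c m' 0 b)%:C%C).
  apply: eq_bigr => a _; rewrite exchange_big /=; apply: eq_bigr => b _.
  rewrite -(scal (fun tau => S tau a b) (fun k => c k 0 a) (fun k => c k 0 b)) /=.
  by apply: eq_bigr => j _; rewrite !mxE.
under eq_bigr => a _ do rewrite -mulr_sumr -rmorph_sum.
rewrite -mulr_sumr -rmorph_sum; congr (_ * (_)%:C%C).
under eq_bigr => a _ do rewrite exchange_big /=.
rewrite exchange_big /=; apply: eq_bigr => m _.
under eq_bigr => a _ do rewrite exchange_big /=.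
rewrite exchange_big /=; apply: eq_bigr => m' _.
rewrite mxE exchange_big /=; apply: eq_bigr => b _; rewrite !mxE mulr_suml.
by apply: eq_bigr => a _.
Qed.

Lemma hform_bound (R : realType) (q : nat) (S : 'M[R[i]]_q) (p : 'rV[R[i]]_q) (B : R) :
  0 <= B -> (forall i j, cm (S i j) <= B) -> cm (hform S p) <= q%:R * B * csq p.
Proof.
move=> B0 hB; rewrite hformE; apply: le_trans (cm_sum _ _ _) _.
apply: (@le_trans _ _ (\sum_a \sum_b B * (cm (p 0 a) * cm (p 0 b)))).
  apply: ler_sum => a _; apply: le_trans (cm_sum _ _ _) _; apply: ler_sum => b _.
  rewrite !cmM cmJ mulrAC [leRHS]mulrC ler_wpM2l ?mulr_ge0 ?cm_ge0 //.
under eq_bigr => a _ do rewrite -mulr_sumr -mulr_sumr.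
rewrite -mulr_sumr -mulr_suml [_ * B]mulrC -mulrA ler_wpM2l // -expr2.
by apply: le_trans (sqr_sum_le _) _; rewrite card_ord.
Qed.

Lemma csq_hform1 (R : realType) (q : nat) (p : 'rV[R[i]]_q) :
  (map_mx (@conjc R) p *m p^T) 0 0 = (csq p)%:C%C.
Proof.
rewrite mxE /csq rmorph_sum; apply: eq_bigr => j _; by rewrite !mxE mulrC cmJM.
Qed.

Definition spectrum_lb (R : realType) (q : nat) (S : int -> 'M[R]_q) (delta : R) : Prop :=
  forall z : R[i], cm z = 1 -> forall p : 'rV[R[i]]_q,
    delta * csq p <= complex.Re (hform (spectrum S z) p).

Lemma spectrum_spT (R : realType) (q : nat) (S : int -> 'M[R]_q) (eps : R) :
  cov_summable S -> 0 < eps ->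
  exists T0, forall T, (T0 <= T)%N -> forall z : R[i], cm z = 1 -> forall i j,
    cm ((spectrum S z - spT S T z) i j) <= eps.
Proof.
move=> hS e0; pose f k := normF (S k%:Z) + normF (S (- k%:Z)).
have f0 k : 0 <= f k by rewrite addr_ge0 // normF_ge0.
have hf : asum f by exact: cvg_asum.
have e2 : 0 < eps / 2 by lra.
have [T0 h] := asum_tail f0 hf e2; exists T0 => T hT z z1 i j.
rewrite !mxE; have -> : eps = 2 * (eps / 2) by lra.
apply: (@csum_tail _ _ f) => // [k|m]; last exact: h.
rewrite /f; case: eqP => [->|_].
  by rewrite cmR oppr0 (le_trans (entry_normF _ i j)) // lerDl normF_ge0.
rewrite (le_trans (cmD _ _)) // !cmM !cmR -exprVn !cmX cm_inv // z1 !expr1n !mulr1.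
by rewrite lerD // entry_normF.
Qed.

Lemma ReD (R : realType) (x y : R[i]) : complex.Re (x + y) = complex.Re x + complex.Re y.
Proof. by case: x y => [? ?] [? ?]. Qed.

Lemma hformD (R : realType) (q : nat) (S T : 'M[R[i]]_q) (p : 'rV[R[i]]_q) :
  hform (S + T) p = hform S p + hform T p.
Proof. by rewrite /hform mulmxDr mulmxDl mxE. Qed.

Lemma spT_bound (R : realType) (q : nat) (S : int -> 'M[R]_q) (B : R) (T : nat) (z : R[i]) i j :
  (forall m, \sum_(0 <= k < m) (normF (S k%:Z) + normF (S (- k%:Z))) <= B) -> cm z = 1 ->
  cm (spT S T z i j) <= B.
Proof.
move=> hB z1; rewrite mxE; apply: le_trans (cm_sum _ _ _) _; apply: le_trans (hB T).
apply: ler_sum => k _; rewrite /spterm; case: eqP => [->|_].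
  by rewrite cmR oppr0 (le_trans (entry_normF _ i j)) // lerDl normF_ge0.
rewrite (le_trans (cmD _ _)) // !cmM !cmR -exprVn !cmX cm_inv // z1 !expr1n !mulr1.
by rewrite lerD // entry_normF.
Qed.

(* The bounds hold at M equispaced points of the circle, M as large as needed,
   and the forms are the means over these points of the ones in the frequency domain. *)
Lemma toepform_bounds (R : realType) (q : nat) (h : nat -> 'M[R]_q) (S : int -> 'M[R]_q)
    (den : nat -> R) (delta c : R) :
  asum (fun k => normF (h k)) -> asum (fun k => `|den k|) -> den 0%N != 0 ->
  cov_summable S -> 0 < delta -> spectrum_lb S delta -> 0 < c ->
  (forall z, cm z = 1 -> ztransform den z != 0 ->
     forall w : 'rV[R[i]]_q, c * csq w <= csq (w *m transfer h z)) ->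
  exists c1 c2 C0 : R, 0 < c1 /\ exists n0, forall n, (n0 <= n)%N -> forall v : nat -> 'rV[R]_q,
    let nv := \sum_(0 <= i < n) sqn (v i) in
    [/\ c1 * nv <= toepform S (n + n) (tconv n v h),
        toepform S (n + n) (tconv n v h) <= c2 * nv &
        \sum_(0 <= m < n + n) sqn (tconv n v h m) <= C0 * nv].
Proof.
move=> hh hd d0 hS de0 hlb c0 hc.
have [n0 hn0] := mev_lb hh c0; have [Sh hSh] := hh.
have f0 k : 0 <= normF (S k%:Z) + normF (S (- k%:Z)) by rewrite addr_ge0 // normF_ge0.
have [B hB] : asum (fun k : nat => normF (S k%:Z) + normF (S (- k%:Z))) by exact: cvg_asum.
have B0 : 0 <= B by have := hB 0%N; rewrite big_geq.
(* With this [eps], replacing the spectrum by its truncation costs at most half of [delta]. *)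
pose eps := delta / (2 * (1 + q%:R)).
have p0 : 0 < 2 * (1 + q%:R) :> R by rewrite mulr_gt0 // ltr_pwDl.
have e0 : 0 < eps by rewrite divr_gt0.
have [T0 hT0] := spectrum_spT hS e0.
pose C0 := (q * q)%:R * Sh ^+ 2.
exists (delta / 2 * (c / 4)), (q%:R * B * C0), C0; split.
  by rewrite !mulr_gt0 ?invr_gt0.
exists n0 => n hn v nv; set ct := tconv n v h.
pose L := (n + n)%N; pose T := (T0 + L)%N; pose M := (L + T).+1.
have [w hw w1] := prim_root_ex R (ltn0Sn (L + T)).
have [Bd hBd] := hd; have hdE (eps' : R) : 0 < eps' -> exists T0, forall T, (T0 <= T)%N ->
    forall x, cm x = 1 -> cm (ztransform den x^-1 - pev den T x) <= eps'.
  move=> he; have [T1 h1] := ztransform_lim hd he; exists T1 => T' hT x x1.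
  by have := h1 T' hT x^-1 (cm_inv x1); rewrite invrK.
have [|zeta z1 hz] := @nonzero_rotation R M w den (fun x => ztransform den x^-1) w1 d0 _ hdE.
  by exists Bd => x x1; apply: ztransform_bound => //; rewrite cm_inv.
pose x j := zeta * w ^+ j; have x1 j : cm (x j) = 1 by rewrite /x cmM cmX w1 expr1n mulr1.
have ev j : vev ct L (x j) = vev v n (x j) *m mev h n (x j) by rewrite /L /ct vev_tconv.
have lb (j : 'I_M) : c / 4 * csq (vev v n (x j)) <= csq (vev ct L (x j)).
  rewrite ev; have := hn0 n hn (x j)^-1 (cm_inv (x1 j)); rewrite invrK; apply.
  by apply: hc; rewrite ?cm_inv // hz.
have ub (j : 'I_M) : csq (vev ct L (x j)) <= C0 * csq (vev v n (x j)).
  by rewrite ev; exact: mev_ub.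
have LM : (L <= M)%N by rewrite /M; lia.
have nM : (n <= M)%N by rewrite /M /L; lia.
have pv := vparseval v hw w1 z1 nM; have pc := vparseval ct hw w1 z1 LM.
have pS := hform_avg S ct hw w1 z1 (leq_addl T0 L) (leqnSn (L + T)).
have M0 : 0 < M%:R :> R by rewrite ltr0n.
have pSR : \sum_(j < M) complex.Re (hform (spT S T (x j)) (vev ct L (x j))) = M%:R * toepform S L ct.
  by rewrite -Re_sum pS.
have lo j : delta / 2 * csq (vev ct L (x j)) <= complex.Re (hform (spT S T (x j)) (vev ct L (x j))).
  have := hlb (x j) (x1 j) (vev ct L (x j)).
  rewrite -[spectrum S (x j)](subrK (spT S T (x j))) hformD ReD => h1.
  have h2 := hform_bound (vev ct L (x j)) (ltW e0) (hT0 T (leq_addr _ _) (x j) (x1 j)).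
  have h3 := le_trans (ler_norm _) (le_trans (Re_le_cm _) h2).
  have h4 : q%:R * eps * csq (vev ct L (x j)) <= delta / 2 * csq (vev ct L (x j)).
    rewrite ler_wpM2r ?csq_ge0 // /eps mulrA ler_pdivrMr //.
    lra.
  lra.
have hi j : complex.Re (hform (spT S T (x j)) (vev ct L (x j))) <= q%:R * B * csq (vev ct L (x j)).
  apply: le_trans (ler_norm _) _; apply: le_trans (Re_le_cm _) _.
  by apply: hform_bound => // i k; exact: spT_bound.
have slb : c / 4 * (M%:R * nv) <= M%:R * \sum_(0 <= k < L) sqn (ct k).
  by rewrite -pv -pc mulr_sumr; apply: ler_sum => j _; exact: lb.
have sub : M%:R * \sum_(0 <= k < L) sqn (ct k) <= C0 * (M%:R * nv).
  by rewrite -pv -pc mulr_sumr; apply: ler_sum => j _; exact: ub.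
have slo : delta / 2 * (M%:R * \sum_(0 <= k < L) sqn (ct k)) <= M%:R * toepform S L ct.
  by rewrite -pc -pSR mulr_sumr; apply: ler_sum => j _; exact: lo.
have shi : M%:R * toepform S L ct <= q%:R * B * (M%:R * \sum_(0 <= k < L) sqn (ct k)).
  by rewrite -pc -pSR mulr_sumr; apply: ler_sum => j _; exact: hi.
have dz : 0 <= delta / 2 by rewrite ltW // divr_gt0.
have qz : 0 <= q%:R * B by rewrite mulr_ge0.
split; rewrite -(ler_pM2l M0).
- apply: le_trans slo; apply: le_trans (ler_wpM2l dz slb).
  by rewrite le_eqVlt; apply/orP; left; apply/eqP; ring.
- apply: le_trans shi _; apply: le_trans (ler_wpM2l qz sub) _.
  by rewrite le_eqVlt; apply/orP; left; apply/eqP; ring.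
- by apply: le_trans sub _; rewrite mulrCA.
Qed.

(** * Sample covariances along a path *)

Lemma mul_le_of_sqr (R : realDomainType) (x y a : R) : x ^+ 2 <= a -> y ^+ 2 <= a -> x * y <= a.
Proof. by have := sqr_ge0 (x - y); rewrite sqrrB mulr2n; lra. Qed.

Lemma norm_mul_le (R : realDomainType) (x y a b : R) : x ^+ 2 <= a -> y ^+ 2 <= b -> `|x * y| <= a + b.
Proof.
have := sqr_ge0 (x - y); have := sqr_ge0 (x + y); have := sqr_ge0 x; have := sqr_ge0 y.
rewrite sqrrB sqrrD !mulr2n ler_norml => *; apply/andP; split; lra.
Qed.

Lemma nat_bound (R : realType) (x : R) : exists n : nat, x <= n%:R.
Proof. by exists (Num.truncn x).+1; apply: ltW; exact: truncnS_gt. Qed.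

Lemma cvg_bigsum (R : realType) (I : Type) (r : seq I) (F : set_system nat) (FF : Filter F)
    (u : I -> nat -> R) (l : I -> R) :
  (forall i, u i @ F --> l i) -> (fun n => \sum_(i <- r) u i n) @ F --> \sum_(i <- r) l i.
Proof.
move=> h; elim: r => [|i r IH].
  by rewrite big_nil; under eq_fun do rewrite big_nil; exact: cvg_cst.
by rewrite big_cons; under eq_fun do rewrite big_cons; apply: cvgD.
Qed.

Lemma mxBE (V : zmodType) (p q : nat) (A B : 'M[V]_(p, q)) i j : (A - B) i j = A i j - B i j.
Proof. by rewrite !mxE. Qed.

Definition win (R : realType) (f : int -> R) (M : nat) : R :=
  \sum_(0 <= i < M.*2.+1) f (i%:Z - M%:Z).

(** At most linear energy over windows takes the place of stationarity: it survives shifts, sums and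
    filters with summable [sqrt l |h_l|]. *)
Definition pbd (R : realType) (f : int -> R) : Prop :=
  exists C : R, 0 <= C /\ forall M, win f M <= C * M.+1%:R.

Lemma win_le (R : realType) (f g : int -> R) (M : nat) :
  (forall t, f t <= g t) -> win f M <= win g M.
Proof. by move=> h; apply: ler_sum. Qed.

Lemma win_sub (R : realType) (f : int -> R) (t0 : int) (n M : nat) :
  (forall t, 0 <= f t) -> - M%:Z <= t0 -> t0 + n%:Z <= M%:Z + 1 ->
  \sum_(0 <= k < n) f (t0 + k%:Z) <= win f M.
Proof.
move=> f0 h1 h2; have [d hd] : exists d : nat, t0 + M%:Z = d%:Z.
  by exists (absz (t0 + M%:Z)); lia.
have hdn : (d + n <= M.*2.+1)%N by lia.
have hd2 : (d <= d + n)%N by lia.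
rewrite /win (@big_cat_nat _ _ _ d 0%N M.*2.+1) ?(leq_trans hd2) //=.
rewrite (@big_cat_nat _ _ _ (d + n)%N d M.*2.+1) //= addrA -[leLHS]add0r -[leLHS]addr0.
apply: lerD; last by apply: sumr_ge0.
apply: lerD; first by apply: sumr_ge0.
rewrite -{1}[d]add0n big_addn addKn le_eqVlt; apply/orP; left; apply/eqP.
apply: eq_bigr => i _; congr f; lia.
Qed.

Lemma win_shift (R : realType) (f : int -> R) (l M : nat) :
  (forall t, 0 <= f t) -> win (fun t => f (t - l%:Z)) M <= win f (M + l).
Proof.
move=> f0; rewrite {1}/win.
rewrite (eq_bigr (fun i => f ((- (M + l)%N%:Z) + i%:Z))); last first.
  by move=> i _; congr f; lia.
by apply: win_sub => //; lia.
Qed.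

Lemma win_shiftz (R : realType) (f : int -> R) (l : int) (M : nat) :
  (forall t, 0 <= f t) -> win (fun t => f (t + l)) M <= win f (M + absz l).
Proof.
move=> f0; rewrite {1}/win.
rewrite (eq_bigr (fun i => f ((l - M%:Z) + i%:Z))); last first.
  by move=> i _; congr f; lia.
by apply: win_sub => //; lia.
Qed.

Lemma weighted_CS (R : realType) (I : Type) (s : seq I) (P : pred I) (w x : I -> R) :
  (forall i, 0 <= w i) ->
  (\sum_(i <- s | P i) w i * x i) ^+ 2 <=
  (\sum_(i <- s | P i) w i) * (\sum_(i <- s | P i) w i * x i ^+ 2).
Proof.
move=> w0; have := sum_CS s P (fun i => Num.sqrt (w i)) (fun i => Num.sqrt (w i) * x i).
under eq_bigr => i _ do rewrite mulrA -expr2 sqr_sqrtr //.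
under [X in _ <= X * _ -> _]eq_bigr => i _ do rewrite sqr_sqrtr //.
by under [X in _ <= _ * X -> _]eq_bigr => i _ do rewrite exprMn sqr_sqrtr //.
Qed.

Lemma normF_mul (R : realType) (p q : nat) (M : 'M[R]_(p, q)) (x : 'cV[R]_q) i :
  `|(M *m x) i 0| <= normF M * normF x.
Proof.
rewrite -sqrtr_sqr !normF_sqn -sqrtrM ?sqn_ge0 // ler_wsqrtr //.
by apply: le_trans (sqn_entry _ i 0) _; exact: sqn_mul.
Qed.

(* Weighting h_l by sqrt l, the square of the tail costs only 1 / L. *)
Lemma tail_fin (R : realType) (p q : nat) (h : nat -> 'M[R]_(p, q)) (s : int -> 'cV[R]_q) (C th : R)
    (L m M : nat) :
  0 <= C -> (forall M, win (fun t => sqn (s t)) M <= C * M.+1%:R) -> (0 < L)%N ->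
  \sum_(L <= l < m) normF (h l) * Num.sqrt l%:R <= th ->
  win (fun t => sqn (\sum_(L <= l < m) h l *m s (t - l%:Z))) M
    <= p%:R * C * th ^+ 2 * (M.+1%:R / L%:R + 1).
Proof.
move=> C0 hs L0 hth; pose w l : R := normF (h l) * Num.sqrt l%:R.
have w0 l : 0 <= w l by rewrite mulr_ge0 ?normF_ge0 ?sqrtr_ge0.
have th0 : 0 <= th by apply: le_trans hth; apply: sumr_ge0 => l _; exact: w0.
have pt t : sqn (\sum_(L <= l < m) h l *m s (t - l%:Z)) <=
    p%:R * (th * \sum_(L <= l < m) w l * (l%:R^-1 * sqn (s (t - l%:Z)))).
  rewrite sqn_colE.
  apply: (@le_trans _ _ (\sum_(i < p) (th * \sum_(L <= l < m) w l * (l%:R^-1 * sqn (s (t - l%:Z))))));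
    last by rewrite sumr_const card_ord mulr_natl.
  apply: ler_sum => i _; rewrite summxE.
  apply: (@le_trans _ _ ((\sum_(L <= l < m) w l * (normF (s (t - l%:Z)) / Num.sqrt l%:R)) ^+ 2)).
    rewrite -[leLHS]real_normK ?num_real // ler_pXn2r ?nnegrE //.
      2: by apply: sumr_ge0 => l _; rewrite mulr_ge0 // divr_ge0 ?normF_ge0 ?sqrtr_ge0.
    apply: le_trans (ler_norm_sum _ _ _) _; rewrite !big_nat; apply: ler_sum => l /andP[Ll _].
    apply: le_trans (normF_mul _ _ _) _.
    have sl : Num.sqrt l%:R != 0 :> R by rewrite gt_eqF // sqrtr_gt0 ltr0n (leq_trans L0).
    rewrite le_eqVlt; apply/orP; left; apply/eqP; rewrite /w; field; exact: sl.
  apply: le_trans (weighted_CS _ _ _ w0) _; apply: ler_pM => //.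
  - by apply: sumr_ge0.
  - by apply: sumr_ge0 => l _; rewrite mulr_ge0 // sqr_ge0.
  - apply: ler_sum => l _; apply: ler_wpM2l => //.
    by rewrite expr_div_n normF_sqr sqr_sqrtr // mulrC.
rewrite /win; apply: le_trans (ler_sum _ (fun i _ => pt _)) _.
rewrite -!mulr_sumr -!mulrA ler_wpM2l // exchange_big /=.
under eq_bigr => l _ do rewrite -!mulr_sumr.
apply: (@le_trans _ _ (th * \sum_(L <= l < m) w l * (C * (M.+1%:R / L%:R + 1)))).
  apply: ler_wpM2l => //; rewrite !big_nat; apply: ler_sum => l /andP[Ll _]; apply: ler_wpM2l => //.
  have l0 : (0 < l)%N by exact: leq_trans Ll.
  have h1 : \sum_(0 <= i < M.*2.+1) sqn (s (i%:Z - M%:Z - l%:Z)) <= C * (M + l).+1%:R.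
    apply: le_trans (hs _); exact: (win_shift l M (fun t => sqn_ge0 (s t))).
  rewrite mulrC ler_pdivrMr ?ltr0n //; apply: le_trans h1 _.
  rewrite -!mulrA ler_wpM2l // mulrDl mul1r -addSn natrD lerD2r.
  by rewrite mulrAC ler_pdivlMr ?ltr0n // ler_wpM2l // ler_nat.
rewrite -mulr_suml.
have -> : th * ((\sum_(L <= l < m) w l) * (C * (M.+1%:R / L%:R + 1))) =
   (\sum_(L <= l < m) w l) * (C * (th * (M.+1%:R / L%:R + 1))) by ring.
have -> : C * (th * (th * (M.+1%:R / L%:R + 1))) = th * (C * (th * (M.+1%:R / L%:R + 1))) by ring.
by rewrite ler_wpM2r // !mulr_ge0 // addr_ge0 // divr_ge0.
Qed.

Lemma filtered_entry (R : realType) (p q : nat) (h : nat -> 'M[R]_(p, q)) (s : int -> 'cV[R]_q)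
    (z : int -> 'cV[R]_p) t i :
  filtered h s z ->
  (fun k : nat => \sum_(0 <= l < k) (h l *m s (t - l%:Z)) i 0) @ \oo --> z t i 0.
Proof.
move=> hf; have := cvg_comp _ _ (hf t) (@coord_continuous R p 1 i 0 (z t)).
rewrite /comp; under eq_fun do rewrite summxE; by [].
Qed.

(** The bound on finite tails does not depend on [m], and a window has finitely many times, so it
    passes to the limit of the defining series. *)
Lemma tail_bound (R : realType) (p q : nat) (h : nat -> 'M[R]_(p, q)) (s : int -> 'cV[R]_q)
    (z : int -> 'cV[R]_p) (C th : R) (L M : nat) :
  filtered h s z ->
  0 <= C -> (forall M, win (fun t => sqn (s t)) M <= C * M.+1%:R) -> (0 < L)%N ->
  (forall m, \sum_(L <= l < m) normF (h l) * Num.sqrt l%:R <= th) ->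
  win (fun t => sqn (z t - \sum_(0 <= l < L) h l *m s (t - l%:Z))) M
    <= p%:R * C * th ^+ 2 * (M.+1%:R / L%:R + 1).
Proof.
move=> hf C0 hs L0 hth.
pose rho m t := \sum_(L <= l < m) h l *m s (t - l%:Z).
have c1 t i : (fun m => rho m t i 0) @ \oo --> (z t - \sum_(0 <= l < L) h l *m s (t - l%:Z)) i 0.
  have e : \forall m \near \oo, (fun k : nat => \sum_(0 <= l < k) (h l *m s (t - l%:Z)) i 0 -
      \sum_(0 <= l < L) (h l *m s (t - l%:Z)) i 0) m = rho m t i 0.
    exists L => // m /= Lm; rewrite /rho summxE (@big_cat_nat _ _ _ L 0%N m) //=.
    by rewrite addrAC subrr add0r.
  apply: cvg_trans (near_eq_cvg e) _.
  rewrite mxBE summxE.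
  by apply: cvgB; [exact: filtered_entry | exact: cvg_cst].
have c2 : (fun m => win (fun t => sqn (rho m t)) M) @ \oo -->
    win (fun t => sqn (z t - \sum_(0 <= l < L) h l *m s (t - l%:Z))) M.
  rewrite /win; apply: cvg_bigsum => k; rewrite sqn_colE; under eq_fun do rewrite sqn_colE.
  by apply: cvg_bigsum => i; rewrite expr2; under eq_fun do rewrite expr2; apply: cvgM.
rewrite -(cvg_lim _ c2) //; apply: limr_le; first by apply/cvg_ex; eexists; exact: c2.
by near=> m; exact: tail_fin.
Unshelve. all: by end_near.
Qed.

Lemma pbd_le (R : realType) (f g : int -> R) : (forall t, f t <= g t) -> pbd g -> pbd f.
Proof. by move=> h [C [C0 hC]]; exists C; split=> // M; apply: le_trans (hC M); exact: win_le. Qed.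

Lemma pbdD (R : realType) (f g : int -> R) : pbd f -> pbd g -> pbd (fun t => f t + g t).
Proof.
move=> [C [C0 hC]] [D [D0 hD]]; exists (C + D); split=> [|M]; first exact: addr_ge0.
by rewrite /win big_split mulrDl lerD ?hC ?hD.
Qed.

Lemma pbdZ (R : realType) (k : R) (f : int -> R) : 0 <= k -> pbd f -> pbd (fun t => k * f t).
Proof.
move=> k0 [C [C0 hC]]; exists (k * C); split=> [|M]; first exact: mulr_ge0.
by rewrite /win -mulr_sumr -mulrA ler_wpM2l // hC.
Qed.

Lemma pbd_shift (R : realType) (l : int) (f : int -> R) : (forall t, 0 <= f t) ->
  pbd f -> pbd (fun t => f (t + l)).
Proof.
move=> f0 [C [C0 hC]]; exists (C * (absz l).+1%:R); split=> [|M]; first exact: mulr_ge0.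
apply: le_trans (win_shiftz l M f0) _; apply: le_trans (hC _) _.
by rewrite -mulrA ler_wpM2l // -natrM ler_nat; lia.
Qed.

(** The tail bound with [L = 1]; the coefficient [h_0], whose weight [sqrt 0] vanishes, is treated
    apart. *)
Lemma pbd_filtered (R : realType) (p q : nat) (h : nat -> 'M[R]_(p, q)) (s : int -> 'cV[R]_q)
    (z : int -> 'cV[R]_p) :
  filtered h s z -> asum (fun l => normF (h l) * Num.sqrt l%:R) -> pbd (fun t => sqn (s t)) ->
  pbd (fun t => sqn (z t)).
Proof.
move=> hf [th hth] [C [C0 hC]].
have th0 : 0 <= th by have := hth 0%N; rewrite big_geq.
have ht m : \sum_(1 <= l < m) normF (h l) * Num.sqrt l%:R <= th.
  apply: le_trans (hth m); case: m => [|m]; first by rewrite !big_geq.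
  rewrite [leRHS]big_nat_recl // big_add1 lerDr mulr_ge0 ?normF_ge0 ?sqrtr_ge0 //.
apply: (@pbd_le _ _ (fun t => 2 * (sqn (h 0%N) * sqn (s t)) +
    2 * sqn (z t - \sum_(0 <= l < 1) h l *m s (t - l%:Z)))).
  move=> t; rewrite big_nat1 subr0 -{1}[z t](subrK (h 0%N *m s t)) addrC.
  apply: le_trans (sqnD _ _) _; rewrite lerD2r ler_wpM2l // sqn_mul //.
apply: pbdD; apply: pbdZ => //; first by apply: pbdZ; [exact: sqn_ge0 | exists C].
exists (2 * (p%:R * C * th ^+ 2)); split; first by rewrite !mulr_ge0 // sqr_ge0.
move=> M; apply: le_trans (tail_bound M hf C0 hC (ltn0Sn 0) ht) _.
have X0 : 0 <= p%:R * C * th ^+ 2 by rewrite !mulr_ge0 // sqr_ge0.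
rewrite divr1 -natr1; have : 0 <= p%:R * C * th ^+ 2 * M%:R by rewrite mulr_ge0.
lra.
Qed.

(** Block [i] of a row vector, extended by 0 so that sums run over natural numbers. *)
Definition vrow (R : realType) (n q : nat) (v : 'rV[R]_(n * q)) (i : nat) : 'rV[R]_q :=
  if insub i is Some i' then \row_j v 0 (mxtens_index (i' : 'I_n, j)) else 0.

Lemma vrow_ord (R : realType) (n q : nat) (v : 'rV[R]_(n * q)) (i : 'I_n) :
  vrow v i = \row_j v 0 (mxtens_index (i, j)).
Proof. by rewrite /vrow valK. Qed.

Lemma sum_mxtens (V : nmodType) (n q : nat) (F : 'I_(n * q) -> V) :
  \sum_l F l = \sum_(i < n) \sum_(j < q) F (mxtens_index (i, j)).
Proof.
rewrite pair_big /= (reindex (@mxtens_index n q)) /=; last first.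
  by exists (@mxtens_unindex n q) => ? _; rewrite (mxtens_indexK, mxtens_unindexK).
by apply: eq_bigr => -[i j].
Qed.

Lemma sqn_vrow (R : realType) (n q : nat) (v : 'rV[R]_(n * q)) :
  sqn v = \sum_(0 <= i < n) sqn (vrow v i).
Proof.
rewrite sqnE sum_mxtens big_mkord; apply: eq_bigr => i _; rewrite sqnE.
by apply: eq_bigr => j _; rewrite vrow_ord mxE.
Qed.

Lemma mul_regressor (R : realType) (n q : nat) (v : 'rV[R]_(n * q)) (z : int -> 'cV[R]_q) k :
  (v *m regressor z n k) 0 0 = \sum_(0 <= i < n) (vrow v i *m z (k - i.+1%:Z)) 0 0.
Proof.
rewrite mxE sum_mxtens big_mkord; apply: eq_bigr => i _; rewrite mxE.
by apply: eq_bigr => j _; rewrite vrow_ord !mxE mxtens_indexK.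
Qed.

Lemma qf_Rhat (R : realType) (n q N : nat) (v : 'rV[R]_(n * q)) (z : int -> 'cV[R]_q) :
  qf (Rhat z n N) v = N%:R^-1 * \sum_(1 <= k < N.+1) ((v *m regressor z n k%:Z) 0 0) ^+ 2.
Proof.
rewrite /qf /Rhat -scalemxAr -scalemxAl mxE mulmx_sumr mulmx_suml summxE; congr (_ * _).
apply: eq_bigr => k _; set w := regressor z n k%:Z.
have -> : v *m (w *m w^T) *m v^T = (v *m w) *m (v *m w)^T by rewrite trmx_mul !mulmxA.
by rewrite mxE big_ord1 [X in _ * X]mxE -expr2.
Qed.

Lemma Rhat_sym (R : realType) (n q N : nat) (z : int -> 'cV[R]_q) : (Rhat z n N)^T = Rhat z n N.
Proof.
rewrite /Rhat linearZ /= raddf_sum; congr (_ *: _); apply: eq_bigr => k _.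
by rewrite /= trmx_mul trmxK.
Qed.

Lemma dot_CS_col (R : realType) (q : nat) (u : 'rV[R]_q) (x : 'cV[R]_q) :
  ((u *m x) 0 0) ^+ 2 <= sqn u * sqn x.
Proof. by have := dot_CS u x^T; rewrite trmxK sqn_tr. Qed.

Lemma sum_dot_CS (R : realType) (q n : nat) (u : nat -> 'rV[R]_q) (x : nat -> 'cV[R]_q) :
  (\sum_(0 <= i < n) (u i *m x i) 0 0) ^+ 2 <=
  (\sum_(0 <= i < n) sqn (u i)) * (\sum_(0 <= i < n) sqn (x i)).
Proof.
apply: (@le_trans _ _ ((\sum_(0 <= i < n) normF (u i) * normF (x i)) ^+ 2)).
  rewrite -[leLHS]real_normK ?num_real // ler_pXn2r ?nnegrE //.
    apply: le_trans (ler_norm_sum _ _ _) _; apply: ler_sum => i _.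
    by rewrite -sqrtr_sqr !normF_sqn -sqrtrM ?sqn_ge0 // ler_wsqrtr // dot_CS_col.
  by apply: sumr_ge0 => i _; rewrite mulr_ge0 ?normF_ge0.
apply: le_trans (sum_CS _ _ _ _) _.
by under eq_bigr do rewrite normF_sqr; under [X in _ * X]eq_bigr do rewrite normF_sqr.
Qed.

(* The quadratic form of R_n is, up to the tail of the filter, the one of the
   sample covariance of s at the vector v * h. *)
Lemma Rhat_qf_bounds (R : realType) (q : nat) (h : nat -> 'M[R]_q) (s z : int -> 'cV[R]_q)
    (S : int -> 'M[R]_q) (C th kappa : R) (n N : nat) (v : 'rV[R]_(n * q)) :
  filtered h s z -> 0 <= C -> (forall M, win (fun t => sqn (s t)) M <= C * M.+1%:R) ->
  (0 < n)%N -> (n <= N)%N ->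
  (forall m, \sum_(n <= l < m) normF (h l) * Num.sqrt l%:R <= th) ->
  0 <= kappa ->
  (forall m m' i j, (m < n + n)%N -> (m' < n + n)%N ->
    `|N%:R^-1 * (\sum_(1 <= k < N.+1) s (k%:Z - m.+1%:Z) i 0 * s (k%:Z - m'.+1%:Z) j 0)
      - S (m'%:Z - m%:Z) i j| <= kappa / n%:R) ->
  let c := tconv n (vrow v) h in
  let Q := toepform S (n + n) c in
  let e := 2 * q%:R * kappa * \sum_(0 <= m < n + n) sqn (c m) in
  let e' := 3 * q%:R * C * th ^+ 2 * sqn v in
  (Q - e) / 2 - e' <= qf (Rhat z n N) v /\ qf (Rhat z n N) v <= 2 * (Q + e) + 2 * e'.
Proof.
move=> hf C0 hC n0 nN hth k0 hcov c Q e e'.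
have N0 : (0 < N)%N by exact: leq_trans nN.
have NR : 0 < N%:R :> R by rewrite ltr0n.
have nR : 0 < n%:R :> R by rewrite ltr0n.
pose rho t := z t - \sum_(0 <= l < n) h l *m s (t - l%:Z).
pose a (k : nat) := \sum_(0 <= m < n + n) (c m *m s (k%:Z - m.+1%:Z)) 0 0.
pose b (k : nat) := \sum_(0 <= i < n) (vrow v i *m rho (k%:Z - i.+1%:Z)) 0 0.
have dec k : (v *m regressor z n k%:Z) 0 0 = a k + b k.
  rewrite mul_regressor /a (tconv_sum n (vrow v) h (f := fun m u => (u *m s (k%:Z - m.+1%:Z)) 0 0)); last first.
    by move=> m u w; rewrite mulmxDl mxE.
  rewrite -big_split /=; apply: eq_bigr => i _.
  have -> : z (k%:Z - i.+1%:Z) = \sum_(0 <= l < n) h l *m s (k%:Z - i.+1%:Z - l%:Z) + rho (k%:Z - i.+1%:Z).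
    by rewrite /rho [RHS]addrC subrK.
  rewrite mulmxDr mxE; congr (_ + _); rewrite mulmx_sumr summxE.
  apply: eq_bigr => l _; rewrite mulmxA; congr ((_ *m s _) _ _); lia.
pose Sa := N%:R^-1 * \sum_(1 <= k < N.+1) a k ^+ 2.
pose Sb := N%:R^-1 * \sum_(1 <= k < N.+1) b k ^+ 2.
(* Cauchy-Schwarz over the [n] blocks costs a factor [n], compensated by the [1 / n] of the tail
   bound; the 3 covers [(N + 1 + n) / N]. *)
have hb : Sb <= e'.
  rewrite /Sb mulrC ler_pdivrMr //.
  apply: (@le_trans _ _ (\sum_(1 <= k < N.+1) sqn v * \sum_(0 <= i < n) sqn (rho (k%:Z - i.+1%:Z)))).
    by apply: ler_sum => k _; rewrite sqn_vrow; exact: sum_dot_CS.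
  rewrite -mulr_sumr exchange_big /=.
  apply: (@le_trans _ _ (sqn v * \sum_(0 <= i < n) win (fun t => sqn (rho t)) N)).
    apply: ler_wpM2l; first exact: sqn_ge0.
    rewrite !big_nat; apply: ler_sum => i /andP[_ iN].
    rewrite big_add1 /=.
    rewrite (eq_bigr (fun k => sqn (rho ((1 - i.+1%:Z) + k%:Z)))); last by move=> k _; congr (sqn (rho _)); lia.
    by apply: win_sub => [t||]; [exact: sqn_ge0 | lia | lia].
  rewrite sumr_const_nat subn0 -[X in _ * X]mulr_natl.
  have := tail_bound N hf C0 hC n0 hth; rewrite -/rho => hw.
  apply: (@le_trans _ _ (sqn v * (n%:R * (q%:R * C * th ^+ 2 * (N.+1%:R / n%:R + 1))))).
    by rewrite ler_wpM2l ?sqn_ge0 // ler_wpM2l.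
  have -> : sqn v * (n%:R * (q%:R * C * th ^+ 2 * (N.+1%:R / n%:R + 1))) =
     q%:R * C * th ^+ 2 * sqn v * (N.+1%:R + n%:R) by field; rewrite gt_eqF.
  have -> : e' * N%:R = q%:R * C * th ^+ 2 * sqn v * (3 * N%:R) by rewrite /e'; ring.
  apply: ler_wpM2l.
    by apply: mulr_ge0; [apply: mulr_ge0; [exact: mulr_ge0|exact: sqr_ge0]|exact: sqn_ge0].
  have : n%:R <= N%:R :> R by rewrite ler_nat.
  have : 1 <= N%:R :> R by rewrite ler1n.
  rewrite -natr1; lra.
(* An entrywise error [kappa / n] suffices because [c] has only [2 n] coefficients: the square of
   the l1 norm of [c] is at most [2 n q] times its squared l2 norm. *)
have ha : `|Sa - Q| <= e.
  pose X m m' i j := N%:R^-1 * (\sum_(1 <= k < N.+1) s (k%:Z - m.+1%:Z) i 0 * s (k%:Z - m'.+1%:Z) j 0).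
  have -> : Sa = \sum_(0 <= m < n + n) \sum_(0 <= m' < n + n) \sum_i \sum_j c m 0 i * X m m' i j * c m' 0 j.
    rewrite /Sa mulr_sumr.
    under eq_bigr => k _.
      rewrite expr2 {1}/a mulr_suml mulr_sumr.
      under eq_bigr => m _ do rewrite /a mulr_sumr mulr_sumr.
      over.
    rewrite exchange_big /=; apply: eq_bigr => m _; rewrite exchange_big /=; apply: eq_bigr => m' _.
    under eq_bigr => k _.
      rewrite !mxE mulr_suml mulr_sumr.
      under eq_bigr => i _ do rewrite mulr_sumr mulr_sumr.
      over.
    rewrite exchange_big /=; apply: eq_bigr => i _; rewrite exchange_big /=; apply: eq_bigr => j _.
    rewrite /X mulrA mulr_sumr mulr_suml; apply: eq_bigr => k _; ring.
  have -> : Q = \sum_(0 <= m < n + n) \sum_(0 <= m' < n + n) \sum_i \sum_j c m 0 i * S (m'%:Z - m%:Z) i j * c m' 0 j.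
    rewrite /Q /toepform; apply: eq_bigr => m _; apply: eq_bigr => m' _.
    rewrite mxE exchange_big /=; apply: eq_bigr => j _; rewrite !mxE mulr_suml.
    by apply: eq_bigr.
  rewrite -sumrB; apply: le_trans (ler_norm_sum _ _ _) _.
  apply: (@le_trans _ _ (\sum_(0 <= m < n + n) \sum_(0 <= m' < n + n) \sum_i \sum_j
      (kappa / n%:R) * (`|c m 0 i| * `|c m' 0 j|))).
    rewrite !big_nat; apply: ler_sum => m /andP[_ hm]; rewrite -sumrB.
    apply: le_trans (ler_norm_sum _ _ _) _; rewrite !big_nat; apply: ler_sum => m' /andP[_ hm'].
    rewrite -sumrB; apply: le_trans (ler_norm_sum _ _ _) _; apply: ler_sum => i _.
    rewrite -sumrB; apply: le_trans (ler_norm_sum _ _ _) _; apply: ler_sum => j _.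
    rewrite -mulrBl -mulrBr !normrM mulrAC [leRHS]mulrC ler_wpM2l ?mulr_ge0 //.
    exact: hcov.
  pose s1 m := \sum_i `|c m 0 i|.
  have -> : \sum_(0 <= m < n + n) \sum_(0 <= m' < n + n) \sum_i \sum_j
      (kappa / n%:R) * (`|c m 0 i| * `|c m' 0 j|) = kappa / n%:R * (\sum_(0 <= m < n + n) s1 m) ^+ 2.
    rewrite expr2 mulr_suml mulr_sumr; apply: eq_bigr => m _; rewrite mulr_sumr mulr_sumr; apply: eq_bigr => m' _.
    rewrite /s1 mulr_suml mulr_sumr; apply: eq_bigr => i _; rewrite mulr_sumr mulr_sumr; apply: eq_bigr => j _.
    by [].
  have h1 : (\sum_(0 <= m < n + n) s1 m) ^+ 2 <= (n + n)%:R * \sum_(0 <= m < n + n) q%:R * sqn (c m).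
    rewrite !big_mkord; apply: le_trans (sqr_sum_le _) _; rewrite card_ord ler_wpM2l //.
    apply: ler_sum => m _; rewrite /s1; apply: le_trans (sqr_sum_le _) _; rewrite card_ord ler_wpM2l //.
    by rewrite sqnE; apply: ler_sum => j _; rewrite real_normK ?num_real.
  apply: le_trans (ler_wpM2l _ h1) _; first by rewrite divr_ge0.
  rewrite -mulr_sumr natrD /e le_eqVlt; apply/orP; left; apply/eqP; field; rewrite gt_eqF //.
have qE : qf (Rhat z n N) v = N%:R^-1 * \sum_(1 <= k < N.+1) (a k + b k) ^+ 2.
  by rewrite qf_Rhat; under eq_bigr do rewrite dec.
have Ni : 0 <= N%:R^-1 :> R by rewrite invr_ge0 ltW.
have lo : Sa / 2 - Sb <= qf (Rhat z n N) v.
  rewrite qE /Sa /Sb -mulrA -mulrBr ler_wpM2l // mulr_suml -sumrB; apply: ler_sum => k _.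
  have := sqr_ge0 (a k + 2 * b k); nra.
have hi : qf (Rhat z n N) v <= 2 * Sa + 2 * Sb.
  rewrite qE /Sa /Sb ![2 * (_ * _)]mulrCA -mulrDr ler_wpM2l // !mulr_sumr -big_split; apply: ler_sum => k _ /=.
  have := sqr_ge0 (a k - b k); nra.
move: ha; rewrite ler_norml => /andP[ha1 ha2].
split; lra.
Qed.

(* Uniform consistency of the sample covariances, at the rate 1 / N^(1/4) for lags up to N^(1/4). *)
Definition ucov (R : realType) (q : nat) (s : int -> 'cV[R]_q) (S : int -> 'M[R]_q) : Prop :=
  forall kappa : R, 0 < kappa -> exists N0, forall N, (N0 <= N)%N -> forall N', (N' <= N)%N ->
  forall J, (J ^ 4 <= N)%N -> forall tau : int, (absz tau <= 4 * J)%N -> forall i j,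
  J%:R * `|\sum_(1 <= t < N'.+1) (s t%:Z i 0 * s (t%:Z - tau) j 0 - S tau i j)| <= kappa * N%:R.

(** The regressor shifts time by [m + 1]. This leaves a sum up to [N - m - 1], which is why [ucov]
    speaks of all partial sums, and a boundary of at most [2 n] terms. The boundary is [O(n)] by the
    energy bound, and [n * n <= sqrt N] is negligible against [N]. *)
Lemma ucov_shift (R : realType) (q : nat) (s : int -> 'cV[R]_q) (S : int -> 'M[R]_q) (B : R) :
  ucov s S -> pbd (fun t => sqn (s t)) -> (forall tau i j, `|S tau i j| <= B) ->
  forall kappa : R, 0 < kappa -> exists N0, forall N, (N0 <= N)%N ->
  forall n, (0 < n)%N -> (n ^ 4 <= N)%N ->
  forall m m' i j, (m < n + n)%N -> (m' < n + n)%N ->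
    `|N%:R^-1 * (\sum_(1 <= k < N.+1) s (k%:Z - m.+1%:Z) i 0 * s (k%:Z - m'.+1%:Z) j 0)
      - S (m'%:Z - m%:Z) i j| <= kappa / n%:R.
Proof.
move=> hu [C [C0 hC]] hB kappa k0.
have k2 : 0 < kappa / 2 by rewrite divr_gt0.
have [N0 hN0] := hu _ k2.
pose D := 10 * C + 2 * `|B|; have D0 : 0 <= D by rewrite addr_ge0 // mulr_ge0.
pose E := 2 * D / kappa; have E0 : 0 <= E by rewrite divr_ge0 ?mulr_ge0 // ltW.
have [NE hNE] := nat_bound (E ^+ 2).
exists (N0 + 4 + NE)%N => N hN n n0 nN m m' i j hm hm'.
have NR : 0 < N%:R :> R by rewrite ltr0n; clear -hN; lia.
have nR : 0 < n%:R :> R by rewrite ltr0n.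
have nsq : (n ^ 2 * n ^ 2 <= N)%N by rewrite -expnD.
have n2N : (n + n <= N)%N.
  case: n n0 nN nsq {hm hm' nR} => [|[|n]] // _ nN nsq; first by lia.
  by rewrite !expnS expn0 muln1 in nsq; nia.
have x1 : (n%:R ^+ 2) ^+ 2 <= N%:R :> R by rewrite -!natrX -expnM ler_nat.
clear nsq; set tau := m'%:Z - m%:Z.
pose Y (t : int) := s t i 0 * s (t - tau) j 0 - S tau i j.
have eY : \sum_(1 <= k < N.+1) s (k%:Z - m.+1%:Z) i 0 * s (k%:Z - m'.+1%:Z) j 0 - N%:R * S tau i j =
    \sum_(1 <= k < N.+1) Y (k%:Z - m.+1%:Z).
  rewrite /Y sumrB; congr (_ - _).
    apply: eq_bigr => k _; congr (_ * s _ _ _); rewrite /tau; clear; lia.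
  by rewrite sumr_const_nat subn1 /= mulr_natl.
have -> : N%:R^-1 * (\sum_(1 <= k < N.+1) s (k%:Z - m.+1%:Z) i 0 * s (k%:Z - m'.+1%:Z) j 0) - S tau i j
   = N%:R^-1 * \sum_(1 <= k < N.+1) Y (k%:Z - m.+1%:Z).
  by rewrite -eY mulrBr mulKf // gt_eqF.
rewrite normrM ger0_norm ?invr_ge0 ?(ltW NR) // mulrC ler_pdivrMr // mulrAC ler_pdivlMr //.
rewrite mulrC.
rewrite (@big_cat_nat _ _ _ m.+2 1%N N.+1) //=; last by clear -hm n2N; lia.
have h1 : n%:R * `|\sum_(1 <= k < m.+2) Y (k%:Z - m.+1%:Z)| <= kappa / 2 * N%:R.
  clear nN; have b1 : `|\sum_(1 <= k < m.+2) Y (k%:Z - m.+1%:Z)| <= D * n%:R.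
    apply: le_trans (ler_norm_sum _ _ _) _; rewrite big_add1 /=.
    apply: (@le_trans _ _ (\sum_(0 <= k < m.+1) (sqn (s (- m%:Z + k%:Z)) + sqn (s (- m'%:Z + k%:Z)) + `|B|))).
      apply: ler_sum => k _; rewrite /Y; apply: le_trans (ler_normB _ _) _; apply: lerD.
        have -> : k.+1%:Z - m.+1%:Z = - m%:Z + k%:Z by clear; lia.
        have -> : - m%:Z + k%:Z - tau = - m'%:Z + k%:Z by rewrite /tau; clear; lia.
        by apply: norm_mul_le; exact: sqn_entry.
      exact: le_trans (hB _ _ _) (ler_norm _).
    rewrite !big_split /= sumr_const_nat subn0 -mulr_natl.
    have w1 : \sum_(0 <= k < m.+1) sqn (s (- m%:Z + k%:Z)) <= C * (4 * n).+1%:R.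
      by apply: le_trans (hC _); apply: win_sub => [t||]; [exact: sqn_ge0 | clear -hm hm'; lia | clear -hm hm'; lia].
    have w2 : \sum_(0 <= k < m.+1) sqn (s (- m'%:Z + k%:Z)) <= C * (4 * n).+1%:R.
      by apply: le_trans (hC _); apply: win_sub => [t||]; [exact: sqn_ge0 | clear -hm hm'; lia | clear -hm hm'; lia].
    have w3 : (4 * n).+1%:R <= 5 * n%:R :> R by rewrite -natrM ler_nat; clear -hm n0; lia.
    have w4 : m.+1%:R <= 2 * n%:R :> R by rewrite -natrM ler_nat; clear -hm n0; lia.
    have w5 : m.+1%:R * `|B| <= 2 * n%:R * `|B| by rewrite ler_wpM2r.
    have w6 : C * (4 * n).+1%:R <= C * (5 * n%:R) by rewrite ler_wpM2l.
    rewrite /D; lra.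
  apply: le_trans (ler_wpM2l (ltW nR) b1) _.
  have x2 : E ^+ 2 <= N%:R.
    apply: le_trans hNE _; rewrite ler_nat; clear -hN; lia.
  have x3 : n%:R ^+ 2 * E <= N%:R by exact: mul_le_of_sqr.
  have -> : n%:R * (D * n%:R) = kappa / 2 * (n%:R ^+ 2 * E) by rewrite /E; field; rewrite gt_eqF.
  by rewrite ler_wpM2l // ltW.
have h2 : n%:R * `|\sum_(m.+2 <= k < N.+1) Y (k%:Z - m.+1%:Z)| <= kappa / 2 * N%:R.
  have -> : \sum_(m.+2 <= k < N.+1) Y (k%:Z - m.+1%:Z) = \sum_(1 <= t < (N - m.+1).+1) Y t%:Z.
    rewrite (_ : m.+2 = (1 + m.+1)%N) // big_addn.
    have -> : (N.+1 - m.+1)%N = (N - m.+1).+1 by clear -hm n2N; lia.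
    apply: eq_bigr => t _; congr Y; clear; lia.
  by apply: hN0 => //; rewrite /tau; clear -hm hm' hN; lia.
have := ler_normD (\sum_(1 <= k < m.+2) Y (k%:Z - m.+1%:Z)) (\sum_(m.+2 <= k < N.+1) Y (k%:Z - m.+1%:Z)).
move=> h3; apply: le_trans (ler_wpM2l (ltW nR) h3) _; rewrite mulrDr; lra.
Qed.

Lemma Rhat_qbd (R : realType) (q : nat) (h : nat -> 'M[R]_q) (s z : int -> 'cV[R]_q)
    (S : int -> 'M[R]_q) (B c1 c2 C0 : R) (nn : nat -> nat) :
  filtered h s z -> asum (fun l => normF (h l) * Num.sqrt l%:R) ->
  pbd (fun t => sqn (s t)) -> ucov s S -> (forall tau i j, `|S tau i j| <= B) ->
  0 < c1 -> (exists n0, forall n, (n0 <= n)%N -> forall v : nat -> 'rV[R]_q,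
    let nv := \sum_(0 <= i < n) sqn (v i) in
    [/\ c1 * nv <= toepform S (n + n) (tconv n v h),
        toepform S (n + n) (tconv n v h) <= c2 * nv &
        \sum_(0 <= m < n + n) sqn (tconv n v h m) <= C0 * nv]) ->
  (forall n0, exists N0, forall N, (N0 <= N)%N -> (n0 <= nn N)%N /\ (nn N ^ 4 <= N)%N) ->
  exists b1 b2 : R, [/\ 0 < b1, 0 < b2 &
    exists N0, forall N, (N0 <= N)%N -> qbd b1 b2 (Rhat z (nn N) N)].
Proof.
move=> hf hh hp hu hB c10 [n1 hn1] hnn; have [C [C_0 hC]] := hp.
(* [kappa] and [th] are set so that the two errors are at most [c1 / 4] and [c1 / 8]; what remains
   below is [(c1 - c1 / 4) / 2 - c1 / 8 = c1 / 4]. The summand [c1] in [D'] forces [th <= 1]. *)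
pose D := 8 * (1 + q%:R * `|C0|); have D0 : 0 < D by rewrite mulr_gt0 // ltr_pwDl // mulr_ge0.
pose kappa := c1 / D; have k0 : 0 < kappa by rewrite divr_gt0.
pose D' := 24 * (1 + q%:R * C) + c1; have D'0 : 0 < D'.
  by rewrite addr_gt0 // mulr_gt0 // ltr_pwDl // mulr_ge0.
pose th := c1 / D'; have th0 : 0 < th by rewrite divr_gt0.
have th1 : th <= 1.
  by rewrite /th ler_pdivrMr // mul1r /D' lerDr mulr_ge0 // addr_ge0 // mulr_ge0.
have [N1 hN1] := ucov_shift hu hp hB k0.
have f0 l : 0 <= normF (h l) * Num.sqrt l%:R by rewrite mulr_ge0 ?normF_ge0 ?sqrtr_ge0.
have [n2 hn2] := asum_tail f0 hh th0.
have [N2 hN2] := hnn (n1 + n2).+1.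
exists (c1 / 4), (2 * (`|c2| + c1) + c1); split.
- by rewrite divr_gt0.
- by rewrite addr_gt0 // mulr_gt0 // ltr_wpDl.
exists (N1 + N2)%N => N hN; have [hn n4] := hN2 N ltac:(lia); set n := nn N in hn n4 *.
have n0 : (0 < n)%N by lia.
split=> [|v]; first exact: Rhat_sym.
have nN : (n <= N)%N by apply: leq_trans n4; rewrite -{1}[n]expn1 leq_pexp2l.
have hth m : \sum_(n <= l < m) normF (h l) * Num.sqrt l%:R <= th by apply: hn2; lia.
have hcov := hN1 N ltac:(lia) n n0 n4.
have [h1 h2 h3] := hn1 n ltac:(lia) (vrow v); rewrite -sqn_vrow in h1 h2 h3.
have [l1 l2] := Rhat_qf_bounds v hf C_0 hC n0 nN hth (ltW k0) hcov.
set Q := toepform _ _ _ in h1 h2 l1 l2; set sc := \sum_(0 <= m < n + n) _ in h3 l1 l2.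
have sv := sqn_ge0 v; have sc0 : 0 <= sc by apply: sumr_ge0 => m _; exact: sqn_ge0.
have e1 : 2 * q%:R * kappa * sc <= c1 / 4 * sqn v.
  apply: (@le_trans _ _ (2 * q%:R * kappa * (`|C0| * sqn v))).
    apply: ler_wpM2l; first by rewrite mulr_ge0 ?(ltW k0) // mulr_ge0.
    apply: le_trans h3 _; by rewrite ler_wpM2r // ler_norm.
  have ek : kappa * D = c1 by rewrite /kappa divfK // gt_eqF.
  have : 0 <= kappa * sqn v by rewrite mulr_ge0 // ltW.
  rewrite -ek /D; lra.
have e2 : 3 * q%:R * C * th ^+ 2 * sqn v <= c1 / 8 * sqn v.
  rewrite ler_wpM2r //; apply: (@le_trans _ _ (3 * q%:R * C * th)).
    by rewrite ler_wpM2l ?mulr_ge0 // expr2 ler_piMr // ltW.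
  rewrite /th mulrA ler_pdivrMr // /D'.
  have : 0 <= c1 * (q%:R * C) by rewrite mulr_ge0 ?mulr_ge0 // ltW.
  have : 0 <= c1 * c1 by rewrite mulr_ge0 // ltW.
  lra.
have e3 : c2 * sqn v <= `|c2| * sqn v by rewrite ler_wpM2r // ler_norm.
have c1s : 0 <= c1 * sqn v by rewrite mulr_ge0 // ltW.
apply/andP; split; lra.
Qed.

(** * The residual of the regression *)

Lemma rhat_resid (R : realType) (n q N : nat) (y : int -> 'cV[R]_1) (z : int -> 'cV[R]_q)
    (g : 'rV[R]_(n * q)) :
  rhat y z n N - g *m Rhat z n N =
  N%:R^-1 *: \sum_(1 <= k < N.+1) (y k%:Z - g *m regressor z n k%:Z) *m (regressor z n k%:Z)^T.
Proof.
rewrite /rhat /Rhat -scalemxAr -scalerBr mulmx_sumr -sumrB; congr (_ *: _).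
by apply: eq_bigr => k _; rewrite mulmxBl mulmxA.
Qed.

(** If [p] is the correlation, then [|p|^2] is the mean of [w_k <p, z_k>], and the mean square of
    [<p, z_k>] is the form of [R_n] at [p]. Cauchy-Schwarz thus costs no factor [n]. This is enough
    for the truncation error, whose energy is small. *)
Lemma sqn_corr (R : realType) (n q N : nat) (w : int -> 'cV[R]_1) (z : int -> 'cV[R]_q) (b1 b2 : R) :
  0 < b1 -> 0 <= b2 -> qbd b1 b2 (Rhat z n N) ->
  sqn (N%:R^-1 *: \sum_(1 <= k < N.+1) w k%:Z *m (regressor z n k%:Z)^T) <=
  b2 * (N%:R^-1 * \sum_(1 <= k < N.+1) sqn (w k%:Z)).
Proof.
move=> b10 b20 hb; set p := _ *: _.
pose zr k := (p *m regressor z n k%:Z) 0 0.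
have Ni : 0 <= N%:R^-1 :> R by rewrite invr_ge0.
have e1 : sqn p = N%:R^-1 * \sum_(1 <= k < N.+1) w k%:Z 0 0 * zr k.
  rewrite sqn_dot {2}/p linearZ /= -scalemxAr mxE raddf_sum /= mulmx_sumr summxE; congr (_ * _).
  by apply: eq_bigr => k _; rewrite trmx_mul trmxK mulmxA mxE big_ord1 mulrC mxE.
have e2 : qf (Rhat z n N) p = N%:R^-1 * \sum_(1 <= k < N.+1) zr k ^+ 2 by rewrite qf_Rhat.
have [_ hq] := hb; have /andP[_ q2] := hq p.
have W0 : 0 <= \sum_(1 <= k < N.+1) sqn (w k%:Z) by apply: sumr_ge0 => k _; exact: sqn_ge0.
have cs : sqn p ^+ 2 <= (N%:R^-1 * \sum_(1 <= k < N.+1) sqn (w k%:Z)) * qf (Rhat z n N) p.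
  rewrite {1}e1 e2 exprMn expr2 [leRHS]mulrACA; apply: ler_wpM2l; first exact: mulr_ge0.
  apply: le_trans (sum_CS _ _ _ _) _; apply: ler_wpM2r.
    by apply: sumr_ge0 => k _; exact: sqr_ge0.
  by apply: ler_sum => k _; exact: sqn_entry.
have sp := sqn_ge0 p.
have [h|h] := ltP 0 (sqn p); last first.
  by apply: (le_trans h); apply: mulr_ge0 => //; exact: mulr_ge0.
rewrite -(ler_pM2r h) -expr2; apply: le_trans cs _.
by rewrite [b2 * _]mulrC -[leRHS]mulrA; apply: ler_wpM2l => //; exact: mulr_ge0.
Qed.

(** The energy of the noise is not small, so each of the [n q] coordinates must be decorrelated
    separately. A coordinate contributes a squared error of order [kappa^2 / n^2 + th^2 / n], and
    the sum stays of order [kappa^2 + th^2]. *)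
Lemma sqn_corr_filtered (R : realType) (q : nat) (h : nat -> 'M[R]_q) (s z : int -> 'cV[R]_q)
    (e : int -> 'cV[R]_1) (C Sh th kappa : R) (n N : nat) :
  filtered h s z -> 0 <= C -> (forall M, win (fun t => sqn (s t)) M <= C * M.+1%:R) ->
  (forall M, win (fun t => sqn (e t)) M <= C * M.+1%:R) ->
  (forall m, \sum_(0 <= l < m) normF (h l) <= Sh) ->
  (0 < n)%N -> (n <= N)%N ->
  (forall m, \sum_(n <= l < m) normF (h l) * Num.sqrt l%:R <= th) ->
  0 <= kappa ->
  (forall tau j, (0 < tau)%N -> (tau <= n + n)%N ->
    `|N%:R^-1 * \sum_(1 <= k < N.+1) e k%:Z 0 0 * s (k%:Z - tau%:Z) j 0| <= kappa / n%:R) ->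
  sqn (N%:R^-1 *: \sum_(1 <= k < N.+1) e k%:Z *m (regressor z n k%:Z)^T)
  <= 2 * q%:R ^+ 3 * Sh ^+ 2 * kappa ^+ 2 + 12 * q%:R ^+ 2 * C ^+ 2 * th ^+ 2.
Proof.
move=> hf C0 hC hCe hSh n0 nN hth k0 hcov.
have N0 : (0 < N)%N by exact: leq_trans nN.
have NR : 0 < N%:R :> R by rewrite ltr0n.
have nR : 0 < n%:R :> R by rewrite ltr0n.
have N1 : 1 <= N%:R :> R by rewrite ler1n.
have nN' : n%:R <= N%:R :> R by rewrite ler_nat.
have Ni : 0 <= N%:R^-1 :> R by rewrite invr_ge0 ltW.
pose rho t := z t - \sum_(0 <= l < n) h l *m s (t - l%:Z).
have Sh0 : 0 <= Sh by have := hSh 0%N; rewrite big_geq.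
have We : N%:R^-1 * \sum_(1 <= k < N.+1) e k%:Z 0 0 ^+ 2 <= 2 * C.
  rewrite mulrC ler_pdivrMr //; apply: (@le_trans _ _ (C * N.+1%:R)).
    apply: le_trans (hCe N); rewrite big_add1 /=.
    rewrite (eq_bigr (fun k => e (1 + k%:Z) 0 0 ^+ 2)); last by move=> k _; congr (e _ _ _ ^+ 2); lia.
    apply: le_trans (ler_sum _ (fun k _ => sqn_entry _ _ _)) _.
    by apply: win_sub => [t||]; [exact: sqn_ge0 | lia | lia].
  by rewrite -mulrA mulrCA ler_wpM2l // -natr1; lra.
have Wr i j : (i < n)%N -> N%:R^-1 * \sum_(1 <= k < N.+1) rho (k%:Z - i.+1%:Z) j 0 ^+ 2
    <= 3 * q%:R * C * th ^+ 2 / n%:R.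
  move=> iN; rewrite mulrC ler_pdivrMr //.
  apply: (@le_trans _ _ (q%:R * C * th ^+ 2 * (N.+1%:R / n%:R + 1))).
    have := tail_bound N hf C0 hC n0 hth; rewrite -/rho => hw; apply: le_trans hw.
    rewrite big_add1 /= (eq_bigr (fun k => rho ((- i%:Z) + k%:Z) j 0 ^+ 2)); last first.
      by move=> k _; congr (rho _ _ _ ^+ 2); lia.
    apply: le_trans (ler_sum _ (fun k _ => sqn_entry _ _ _)) _.
    by apply: win_sub => [t||]; [exact: sqn_ge0 | lia | lia].
  have X0 : 0 <= q%:R * C * th ^+ 2 by apply: mulr_ge0; [exact: mulr_ge0 | exact: sqr_ge0].
  have -> : 3 * q%:R * C * th ^+ 2 / n%:R * N%:R = q%:R * C * th ^+ 2 * (3 * N%:R / n%:R) by ring.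
  rewrite ler_wpM2l // ler_pdivlMr // mulrDl divfK ?gt_eqF // mul1r -natr1; lra.
have ent (i : 'I_n) (j : 'I_q) :
   (N%:R^-1 * \sum_(1 <= k < N.+1) e k%:Z 0 0 * z (k%:Z - i.+1%:Z) j 0) ^+ 2 <=
   2 * (q%:R * Sh * kappa / n%:R) ^+ 2 + 2 * (6 * q%:R * C ^+ 2 * th ^+ 2 / n%:R).
  have iN := ltn_ord i.
  pose A := \sum_(0 <= l < n) \sum_j' h l j j' * (N%:R^-1 * \sum_(1 <= k < N.+1) e k%:Z 0 0 * s (k%:Z - (i.+1 + l)%N%:Z) j' 0).
  pose Bb := N%:R^-1 * \sum_(1 <= k < N.+1) e k%:Z 0 0 * rho (k%:Z - i.+1%:Z) j 0.
  have -> : N%:R^-1 * \sum_(1 <= k < N.+1) e k%:Z 0 0 * z (k%:Z - i.+1%:Z) j 0 = A + Bb.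
    have -> : A = N%:R^-1 * \sum_(1 <= k < N.+1) e k%:Z 0 0 * \sum_(0 <= l < n) (h l *m s (k%:Z - i.+1%:Z - l%:Z)) j 0.
      rewrite /A mulr_sumr; under [RHS]eq_bigr => k _ do rewrite mulr_sumr mulr_sumr.
      rewrite [RHS]exchange_big /=; apply: eq_bigr => l _.
      under [RHS]eq_bigr => k _ do rewrite mxE mulr_sumr mulr_sumr.
      rewrite [RHS]exchange_big /=; apply: eq_bigr => j' _; rewrite mulr_sumr mulr_sumr.
      apply: eq_bigr => k _; have -> : k%:Z - (i.+1 + l)%N%:Z = k%:Z - i.+1%:Z - l%:Z by lia.
      ring.
    rewrite /Bb -mulrDr -big_split /=; congr (_ * _); apply: eq_bigr => k _.
    by rewrite -mulrDr; congr (_ * _); rewrite /rho mxBE summxE [RHS]addrC subrK.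
  have hA : `|A| <= q%:R * Sh * kappa / n%:R.
    apply: (@le_trans _ _ (\sum_(0 <= l < n) \sum_(j' < q) normF (h l) * (kappa / n%:R))).
      rewrite /A; apply: le_trans (ler_norm_sum _ _ _) _; rewrite !big_nat; apply: ler_sum => l /andP[_ ln].
      apply: le_trans (ler_norm_sum _ _ _) _; apply: ler_sum => j' _; rewrite normrM.
      apply: ler_pM => //; first exact: entry_normF.
      by apply: hcov => //; lia.
    have -> : q%:R * Sh * kappa / n%:R = Sh * (q%:R * (kappa / n%:R)) by ring.
    apply: (@le_trans _ _ ((\sum_(0 <= l < n) normF (h l)) * (q%:R * (kappa / n%:R)))).
      rewrite mulr_suml; apply: ler_sum => l _.
      by rewrite sumr_const card_ord -[_ *+ q]mulr_natl mulrCA.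
    by apply: ler_wpM2r; [rewrite mulr_ge0 // divr_ge0 // ltW | exact: hSh].
  have hBb : Bb ^+ 2 <= 6 * q%:R * C ^+ 2 * th ^+ 2 / n%:R.
    apply: (@le_trans _ _ ((2 * C) * (3 * q%:R * C * th ^+ 2 / n%:R))).
      apply: (@le_trans _ _ ((N%:R^-1 * \sum_(1 <= k < N.+1) e k%:Z 0 0 ^+ 2) *
          (N%:R^-1 * \sum_(1 <= k < N.+1) rho (k%:Z - i.+1%:Z) j 0 ^+ 2))).
        rewrite /Bb exprMn expr2 [leRHS]mulrACA; apply: ler_wpM2l; [exact: mulr_ge0 | exact: sum_CS].
      apply: ler_pM; [| |exact: We|exact: Wr].
      - by apply: mulr_ge0 => //; apply: sumr_ge0 => k _; exact: sqr_ge0.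
      - by apply: mulr_ge0 => //; apply: sumr_ge0 => k _; exact: sqr_ge0.
    by rewrite le_eqVlt; apply/orP; left; apply/eqP; ring.
  have hA2 : A ^+ 2 <= (q%:R * Sh * kappa / n%:R) ^+ 2.
    rewrite -[A ^+ 2]real_normK ?num_real // ler_pXn2r ?nnegrE //.
    by rewrite divr_ge0 // ?mulr_ge0 // ltW.
  by have := sqr_ge0 (A - Bb); rewrite sqrrB sqrrD !mulr2n; lra.
rewrite sqnE sum_mxtens.
apply: (@le_trans _ _ (\sum_(i < n) \sum_(j < q)
   (2 * (q%:R * Sh * kappa / n%:R) ^+ 2 + 2 * (6 * q%:R * C ^+ 2 * th ^+ 2 / n%:R)))).
  apply: ler_sum => i _; apply: ler_sum => j _; apply: le_trans (ent i j).
  rewrite le_eqVlt; apply/orP; left; apply/eqP; congr (_ ^+ 2).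
  rewrite mxE summxE; congr (_ * _); apply: eq_bigr => k _.
  by rewrite mxE big_ord1 !mxE mxtens_indexK.
set X := 2 * _ + 2 * _.
have -> : \sum_(i < n) \sum_(j < q) X = n%:R * (q%:R * X).
  by move: X => X; rewrite !sumr_const !card_ord [RHS]mulr_natl mulr_natl.
rewrite /X {X}.
have -> : n%:R * (q%:R * (2 * (q%:R * Sh * kappa / n%:R) ^+ 2 + 2 * (6 * q%:R * C ^+ 2 * th ^+ 2 / n%:R)))
  = (2 * q%:R ^+ 3 * Sh ^+ 2 * kappa ^+ 2) * n%:R^-1 + 12 * q%:R ^+ 2 * C ^+ 2 * th ^+ 2.
  by field; rewrite gt_eqF.
rewrite lerD2r; apply: ler_piMr; last by rewrite invf_le1 // ler1n.
by rewrite !mulr_ge0 ?exprn_ge0.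
Qed.

(** * The estimators near the true parameters *)

Lemma gblock_vrow (R : realType) (n q : nat) (g : 'rV[R]_(n * q)) i l : gblock g i l = vrow g i 0 l.
Proof. by rewrite /gblock /vrow; case: insubP => [i' _ _|_]; rewrite !mxE. Qed.

Lemma HplusE (R : realType) (nx n q : nat) (g : 'rV[R]_(n * q)) (i : 'I_nx) (j : 'I_(n - nx)) l :
  Hplus nx g i (mxtens_index (j, l)) = vrow g (i + j) 0 l.
Proof. by rewrite !mxE mxtens_indexK /= gblock_vrow. Qed.

Lemma HminusE (R : realType) (nx n q : nat) (g : 'rV[R]_(n * q)) (j : 'I_(n - nx)) l :
  Hminus nx g 0 (mxtens_index (j, l)) = vrow g (nx + j) 0 l.
Proof. by rewrite !mxE mxtens_indexK /= gblock_vrow addn0. Qed.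

Lemma toeplitzE (R : realType) (nx n : nat) (a : 'rV[R]_nx) (i : 'I_n) (j : 'I_(n - nx)) :
  toeplitz a n i j = if (j <= i)%N then acoef a (i - j) else 0.
Proof. by rewrite mxE. Qed.

Lemma KnE (R : realType) (nx n q : nat) (a : 'rV[R]_nx) (i : 'I_n) (j : 'I_(n - nx)) (l l' : 'I_q) :
  Kn n q a (mxtens_index (i, l)) (mxtens_index (j, l')) = toeplitz a n i j * (l == l')%:R.
Proof. by rewrite /Kn tensmxE [1%:M _ _]mxE. Qed.

(** Column [j] carries the coefficients in rows [j] to [j + nx], all of which exist because
    [j < n - nx]. *)
Lemma toeplitz_sum (R : realType) (V : lmodType R) (nx n : nat) (a : 'rV[R]_nx) (j : 'I_(n - nx))
    (F : nat -> V) :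
  \sum_(i < n) toeplitz a n i j *: F i = \sum_(0 <= k < nx.+1) acoef a k *: F (j + k)%N.
Proof.
have hj := ltn_ord j; have hjn : (j + nx.+1 <= n)%N by lia.
under eq_bigr => i _ do rewrite toeplitzE.
rewrite -(big_mkord xpredT (fun i => (if (j <= i)%N then acoef a (i - j) else 0) *: F i)).
rewrite (@big_cat_nat _ _ _ j 0%N n) /=; [|by []|by lia].
rewrite (@big_cat_nat _ _ _ (j + nx.+1)%N j n) /=; [|by lia|by []].
rewrite big_nat big1 ?add0r; last by move=> i /andP[_ ij]; rewrite leqNgt ij scale0r.
rewrite [X in _ + X]big_nat [X in _ + X]big1 ?addr0; last first.
  by move=> i /andP[ij _]; rewrite acoef_gt ?if_same ?scale0r //; lia.
rewrite -{1}[j : nat]add0n big_addn addKn; apply: eq_bigr => k _.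
by rewrite leq_addl addnK addnC.
Qed.

Lemma mul_Kn (R : realType) (nx n q : nat) (a : 'rV[R]_nx) (g : 'rV[R]_(n * q)) (j : 'I_(n - nx)) l :
  (g *m Kn n q a) 0 (mxtens_index (j, l)) = \sum_(0 <= k < nx.+1) acoef a k * vrow g (j + k) 0 l.
Proof.
rewrite -(toeplitz_sum a j (fun i => vrow g i 0 l : R^o)) mxE sum_mxtens.
apply: eq_bigr => i _; rewrite (bigD1 l) //= KnE eqxx mulr1 big1 ?addr0.
  by rewrite mulrC vrow_ord mxE.
by move=> l' ll; rewrite KnE (negbTE ll) mulr0 mulr0.
Qed.

(** Two forms of the Hankel residual: affine in [a], as least squares needs, and linear in [g], as
    the error analysis needs. *)
Lemma aHplus (R : realType) (nx n q : nat) (a : 'rV[R]_nx) (g : 'rV[R]_(n * q)) :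
  a *m Hplus nx g + Hminus nx g = g *m Kn n q a.
Proof.
apply/rowP => c; rewrite -[c]mxtens_unindexK; case: (mxtens_unindex c) => j l.
rewrite mul_Kn big_nat_recr //= acoef_max mul1r mxE HminusE addnC; congr (_ + _).
rewrite mxE big_mkord; apply: eq_bigr => k _; by rewrite HplusE acoef_ord addnC.
Qed.

(** Column [j] of the product is [C A_K^j] times the characteristic polynomial evaluated at [A_K].
    This holds for every [a], hence also at the estimate. *)
Lemma Phi_Kn (R : realType) (m n q : nat) (a : 'rV[R]_m.+1) :
  Phi (canonical_AK a) n q *m Kn n q a = 0.
Proof.
rewrite /Phi /Kn tensmx_mul mulmx1.
suff -> : (obsv (canonical_AK a) n)^T *m toeplitz a n = 0 by rewrite tens0mx.
apply/matrixP => i j; rewrite mxE [RHS]mxE.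
have := toeplitz_sum a j (fun k => (e1row R m.+1 *m canonical_AK a ^+ k)).
move=> h; have {h} : (\sum_(k < n) toeplitz a n k j *: (e1row R m.+1 *m canonical_AK a ^+ k)) 0 i =
   (\sum_(0 <= k < m.+2) acoef a k *: (e1row R m.+1 *m canonical_AK a ^+ (j + k))) 0 i by rewrite h.
have -> : \sum_(0 <= k < m.+2) acoef a k *: (e1row R m.+1 *m canonical_AK a ^+ (j + k)) = 0.
  transitivity (e1row R m.+1 *m canonical_AK a ^+ j *m \sum_(k < m.+2) acoef a k *: canonical_AK a ^+ k).
    rewrite mulmx_sumr big_mkord; apply: eq_bigr => k _.
    by rewrite -scalemxAr -mulmxA exprD.
  by rewrite apoly_canonical0 mulmx0.
rewrite summxE => h0; transitivity ((0 : 'rV[R]_m.+1) 0 i); last by rewrite mxE.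
rewrite -h0; apply: eq_bigr => k _.
by rewrite [RHS]mxE mulrC; congr (_ * _); rewrite !mxE.
Qed.

Lemma horner_pev (R : realType) (P : {poly R}) (n : nat) (x : R[i]) : (size P <= n)%N ->
  pev (fun k => P`_k) n x = (map_poly (real_complex R) P).[x].
Proof.
move=> sP; rewrite (@horner_coef_wide _ n); last by rewrite size_map_poly.
by rewrite /pev big_mkord; apply: eq_bigr => k _; rewrite coef_map.
Qed.

Definition rowcoef (R : realType) (p q : nat) (v : 'rV[R]_(p * q)) (l : 'I_q) (j : nat) : R := vrow v j 0 l.

Lemma sqn_rowcoef (R : realType) (p q : nat) (v : 'rV[R]_(p * q)) :
  sqn v = \sum_l \sum_(0 <= j < p) rowcoef v l j ^+ 2.
Proof.
by rewrite sqn_vrow [RHS]exchange_big /=; apply: eq_bigr => j _; rewrite sqnE.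
Qed.

(* Multiplication by K_n(a) is multiplication by a polynomial, so Parseval
   reduces its bounds to those of the polynomial on the circle. *)
Lemma Kn_tr_bounds (R : realType) (nx n q : nat) (a : 'rV[R]_nx) (lo hi : R) :
  0 <= lo -> (nx < n)%N ->
  (forall x : R[i], cm x = 1 -> lo <= cm (map_poly (real_complex R) (apoly a)).[x] <= hi) ->
  oplb (lo ^+ 2) (Kn n q a)^T /\ opub (hi ^+ 2) (Kn n q a)^T.
Proof.
move=> lo0 nxn hb; set f := real_complex R.
have n0 : (0 < n)%N by exact: leq_ltn_trans nxn.
(* [n] points suffice: a product of polynomials of sizes [nx + 1] and at most [n - nx] has size at
   most [n]. *)
have [w hw w1] := prim_root_ex R n0.
have n0R : 0 < n%:R :> R by rewrite ltr0n.
have key (v : 'rV[R]_((n - nx) * q)) (l : 'I_q) (V := \poly_(j < n - nx) rowcoef v l j) :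
  \sum_(0 <= i < n) rowcoef (v *m (Kn n q a)^T) l i ^+ 2 =
  n%:R^-1 * \sum_(j < n) (cm (map_poly f (apoly a)).[1 * w ^+ j] * cm (pev (rowcoef v l) (n - nx) (1 * w ^+ j))) ^+ 2.
  have sV : (size V <= n - nx)%N by exact: size_poly.
  have sAV : (size (apoly a * V)%R <= n)%N.
    apply: leq_trans (size_polyMleq _ _) _; rewrite size_apoly; lia.
  transitivity (\sum_(0 <= i < n) (apoly a * V)`_i ^+ 2).
    rewrite !big_mkord; apply: eq_bigr => i _; congr (_ ^+ 2).
    rewrite /rowcoef vrow_ord mxE mxE sum_mxtens coefMr.
    transitivity (\sum_(0 <= j < i.+1) rowcoef v l j * (if (j < n - nx)%N then acoef a (i - j) else 0)); last first.
      rewrite big_mkord; apply: eq_bigr => j _; rewrite coef_apoly coef_poly.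
      by case: ifP => _; rewrite ?mul0r ?mulr0 // mulrC.
    transitivity (\sum_(0 <= j < n - nx) rowcoef v l j * (if (j <= i)%N then acoef a (i - j) else 0)).
      rewrite big_mkord; apply: eq_bigr => j _; rewrite (bigD1 l) //= mxE KnE eqxx mulr1 toeplitzE big1 ?addr0.
        by rewrite /rowcoef vrow_ord mxE.
      by move=> l' ll; rewrite mxE KnE eq_sym (negbTE ll) mulr0 mulr0.
    have e1 m1 (P : pred nat) (F : nat -> R) : (m1 <= n)%N ->
        \sum_(0 <= j < m1) F j * (if P j then acoef a (i - j) else 0)
        = \sum_(0 <= j < n) F j * (if P j && (j < m1)%N then acoef a (i - j) else 0).
      move=> hm; rewrite [RHS](@big_cat_nat _ _ _ m1 0%N n) //= [X in _ = _ + X]big_nat [X in _ = _ + X]big1 ?addr0.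
        by apply: eq_big_nat => j /andP[_ jm]; rewrite jm andbT.
      by move=> j /andP[mj _]; rewrite ltnNge mj andbF mulr0.
    rewrite (e1 _ (fun j => (j <= i)%N)) ?leq_subr // (e1 i.+1 (fun j => (j < n - nx)%N)); last exact: ltn_ord.
    by apply: eq_bigr => j _; rewrite ltnS andbC.
  have := parseval (fun k => (apoly a * V)`_k) hw w1 (cm1 R) (leqnn n) => hp.
  rewrite -[LHS](mulKf (lt0r_neq0 n0R)) -hp; congr (_ * _); apply: eq_bigr => j _; congr (_ ^+ 2).
  rewrite horner_pev // rmorphM hornerM cmM; congr (_ * cm _).
  rewrite -(horner_pev _ sV) /pev; apply: eq_big_nat => k /andP[_ kn]; congr (_%:C%C * _).
  by rewrite coef_poly kn.
have par (v : 'rV[R]_((n - nx) * q)) (l : 'I_q) :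
    \sum_(0 <= j < n - nx) rowcoef v l j ^+ 2 =
    n%:R^-1 * \sum_(j < n) cm (pev (rowcoef v l) (n - nx) (1 * w ^+ j)) ^+ 2.
  by rewrite (parseval (rowcoef v l) hw w1 (cm1 R) (leq_subr _ _)) mulKf // gt_eqF.
have x1 j : cm (1 * w ^+ j) = 1 by rewrite mul1r cmX w1 expr1n.
have ni : 0 <= n%:R^-1 :> R by rewrite invr_ge0 ltW.
have hi0 : 0 <= hi by have /andP[h1 h2] := hb _ (x1 0%N); rewrite (le_trans lo0) ?(le_trans h1).
split=> v; rewrite !sqn_rowcoef mulr_sumr; apply: ler_sum => l _; rewrite key par mulrCA ler_wpM2l // mulr_sumr;
  apply: ler_sum => j _; rewrite -exprMn ler_pXn2r ?nnegrE ?mulr_ge0 ?cm_ge0 // ler_wpM2r ?cm_ge0 //;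
  by have /andP[] := hb _ (x1 j).
Qed.

Lemma opub_Kn (R : realType) (nx n q : nat) (a : 'rV[R]_nx) (hi : R) :
  0 <= hi -> opub (hi ^+ 2) (Kn n q a)^T -> opub (hi ^+ 2) (Kn n q a).
Proof. by move=> h1 h2; rewrite -[Kn n q a]trmxK; apply: opub_tr => //; exact: sqr_ge0. Qed.

Lemma apoly_ub (R : realType) (nx : nat) (a : 'rV[R]_nx) (x : R[i]) : cm x = 1 ->
  cm (map_poly (real_complex R) (apoly a)).[x] <= 1 + N1 a.
Proof.
move=> x1; rewrite -(horner_pev _ (eq_leq (size_apoly a))); apply: le_trans (cm_sum _ _ _) _.
rewrite big_nat_recr //= coef_apoly acoef_max cmM cmR normr1 mul1r cmX x1 expr1n addrC lerD2l.
rewrite /N1 big_ord1 big_mkord; apply: ler_sum => k _.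
by rewrite coef_apoly acoef_ord cmM cmR cmX x1 expr1n mulr1.
Qed.

Lemma apoly_pert (R : realType) (nx : nat) (a b : 'rV[R]_nx) (x : R[i]) : cm x = 1 ->
  cm ((map_poly (real_complex R) (apoly b)).[x] - (map_poly (real_complex R) (apoly a)).[x]) <= N1 (b - a).
Proof.
move=> x1; rewrite -!(horner_pev _ (eq_leq (size_apoly _))) /pev -sumrB; apply: le_trans (cm_sum _ _ _) _.
rewrite big_nat_recr //= !coef_apoly !acoef_max subrr cm0 addr0 /N1 big_ord1 big_mkord; apply: ler_sum => k _.
by rewrite !coef_apoly !acoef_ord -mulrBl -rmorphB cmM cmR cmX x1 expr1n mulr1 !mxE.
Qed.

Lemma Hplus_sub (R : realType) (nx n q : nat) (g g' : 'rV[R]_(n * q)) :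
  Hplus nx (g - g') = Hplus nx g - Hplus nx g'.
Proof.
apply/matrixP => i c; rewrite -[c]mxtens_unindexK; case: (mxtens_unindex c) => j l.
rewrite mxBE !HplusE /vrow; case: insubP => [i' _ _|_]; by rewrite !mxE ?subrr.
Qed.

(** Each row of the Hankel matrix is a window of [g], so only the number [nx] of rows enters. *)
Lemma sqn_Hplus (R : realType) (nx n q : nat) (g : 'rV[R]_(n * q)) : sqn (Hplus nx g) <= nx%:R * sqn g.
Proof.
rewrite /sqn; apply: (@le_trans _ _ (\sum_(i < nx) sqn g)); last by rewrite sumr_const card_ord mulr_natl.
apply: ler_sum => i _; rewrite sum_mxtens sqn_rowcoef exchange_big /=; apply: ler_sum => l _.
have [h|h] := ltnP nx n; last first.
  rewrite big1 => [|j _]; last by have := ltn_ord j; lia.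
  by apply: sumr_ge0 => j _; exact: sqr_ge0.
under eq_bigr => j _ do rewrite HplusE.
rewrite (@big_cat_nat _ _ _ i 0%N n) //=; last by have := ltn_ord i; lia.
rewrite (@big_cat_nat _ _ _ (i + (n - nx))%N i n) //=; [|lia|by have := ltn_ord i; lia].
have -> : \sum_(j < n - nx) vrow g (i + j) 0 l ^+ 2 = \sum_(i <= j < i + (n - nx)) rowcoef g l j ^+ 2.
  rewrite -{2}[i : nat]add0n big_addn addKn big_mkord; apply: eq_bigr => j _.
  by rewrite /rowcoef addnC.
rewrite addrCA lerDl addr_ge0 // sumr_ge0 // => j _; exact: sqr_ge0.
Qed.

Lemma opub_Hplus (R : realType) (nx n q : nat) (g : 'rV[R]_(n * q)) :
  opub (nx%:R * sqn g) (Hplus nx g).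
Proof. by apply: opub_le (opub_sqn _); exact: sqn_Hplus. Qed.

(* The estimate of a in the metric W; a_ols is the case W = I. *)
Definition aW (R : realType) (nx n q : nat) (W : 'M[R]_((n - nx) * q)) (g : 'rV[R]_(n * q)) : 'rV[R]_nx :=
  - Hminus nx g *m W *m (Hplus nx g)^T *m invmx (Hplus nx g *m W *m (Hplus nx g)^T).

Lemma a_olsE (R : realType) (nx n q : nat) (g : 'rV[R]_(n * q)) : a_ols nx g = aW 1%:M g.
Proof. by rewrite /a_ols /aW !mulmx1. Qed.

Lemma a_wlsE (R : realType) (nx n q : nat) (Rn : 'M[R]_(n * q)) (g : 'rV[R]_(n * q)) :
  a_wls nx Rn g = aW (invmx (Lambda_ols nx Rn g)) g.
Proof. by []. Qed.

(** [X = W H^T (H W H^T)^-1] is a right inverse of [H], so the distance from [aW] to any reference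
    [a] is the residual at [a] times [- X]. With the true parameter it is the estimation error, with
    [aW] itself the normal equation. *)
Lemma aW_err (R : realType) (nx n q : nat) (W : 'M[R]_((n - nx) * q)) (g : 'rV[R]_(n * q)) (a : 'rV[R]_nx) :
  Hplus nx g *m W *m (Hplus nx g)^T \in unitmx ->
  aW W g - a = - (g *m Kn n q a *m (W *m (Hplus nx g)^T *m invmx (Hplus nx g *m W *m (Hplus nx g)^T))).
Proof.
move=> hu; rewrite -aHplus /aW; set G := invmx _; set H := Hplus nx g; set X := W *m H^T *m G.
have HX : H *m X = 1%:M by rewrite /X !mulmxA mulmxV.
rewrite mulmxDl -(mulmxA a H X) HX mulmx1 opprD addrC; congr (_ + _); by rewrite /X !mulmxA !mulNmx.
Qed.

(* Step 3 is the normal equation of the weighted least squares problem. *)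
Lemma aW_normal (R : realType) (nx n q : nat) (W : 'M[R]_((n - nx) * q)) (g : 'rV[R]_(n * q)) :
  Hplus nx g *m W *m (Hplus nx g)^T \in unitmx ->
  g *m Kn n q (aW W g) *m (W *m (Hplus nx g)^T *m invmx (Hplus nx g *m W *m (Hplus nx g)^T)) = 0.
Proof.
by move=> hu; apply/eqP; rewrite -oppr_eq0 -aW_err // subrr.
Qed.

Lemma aW_bound (R : realType) (nx n q : nat) (W : 'M[R]_((n - nx) * q)) (g : 'rV[R]_(n * q)) (a : 'rV[R]_nx)
    (w1 w2 l u : R) :
  0 < w1 -> 0 < w2 -> 0 < l -> 0 < u -> qbd w1 w2 W -> oplb l (Hplus nx g) -> opub u (Hplus nx g) ->
  Hplus nx g *m W *m (Hplus nx g)^T \in unitmx /\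
  sqn (aW W g - a) <= w2 ^+ 2 * u * ((w1 * l)^-1) ^+ 2 * sqn (g *m Kn n q a).
Proof.
move=> w10 w20 l0 u0 hW hl hu.
have hM := qbd_cong (ltW w10) (ltW w20) hW hl hu.
have wl0 : 0 < w1 * l by rewrite mulr_gt0.
have wu0 : 0 < w2 * u by rewrite mulr_gt0.
have U := qbd_unit wl0 hM; split=> //.
rewrite aW_err // sqnN.
have h1 := qbd_opub (ltW w10) (ltW w20) hW.
have h2 := opub_tr (ltW u0) hu.
have h3 := qbd_opub _ _ (qbd_inv wl0 wu0 hM).
have h3' := h3 (ltW (_ : 0 < (w2 * u)^-1)) (ltW (_ : 0 < (w1 * l)^-1)).
apply: (opub_mul _ (opub_mul _ h1 h2) (h3' _ _)); rewrite ?invr_gt0 // ?sqr_ge0 // ltW //.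
Qed.

Lemma sqn_tens1 (R : realType) (p r q : nat) (X : 'M[R]_(p, r)) :
  sqn (X *t (1%:M : 'M[R]_q)) = q%:R * sqn X.
Proof.
rewrite /sqn sum_mxtens mulr_sumr; apply: eq_bigr => i _.
transitivity (\sum_(l < q) \sum_(j < r) X i j ^+ 2); last by rewrite sumr_const card_ord mulr_natl.
apply: eq_bigr => l _; rewrite sum_mxtens; apply: eq_bigr => j _.
rewrite (bigD1 l) //= tensmxE mxE eqxx mulr1 big1 ?addr0 // => l' ll.
by rewrite tensmxE mxE eq_sym (negbTE ll) mulr0 expr0n.
Qed.

Lemma sqn_unrvec (R : realType) (p q : nat) (w : 'rV[R]_(p * q)) : sqn (unrvec w) = sqn w.
Proof.
rewrite sqnE sum_mxtens; apply: eq_bigr => i _; apply: eq_bigr => j _; by rewrite mxE.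
Qed.

Lemma rvecK (R : realType) (p q : nat) (M : 'M[R]_(p, q)) : unrvec (rvec M) = M.
Proof. by apply/matrixP => i j; rewrite !mxE mxtens_indexK. Qed.

Lemma vrow_Phi (R : realType) (m n q i : nat) (A : 'M[R]_m) (w : 'rV[R]_(m * q)) : (i < n)%N ->
  vrow (w *m Phi A n q) i = e1row R m *m A ^+ i *m unrvec w.
Proof.
move=> hi; have -> : i = Ordinal hi :> nat by []. 
rewrite vrow_ord; apply/rowP => l; rewrite mxE mxE sum_mxtens [RHS]mxE; apply: eq_bigr => c _.
rewrite (bigD1 l) //= /Phi tensmxE [1%:M _ _]mxE eqxx mulr1 big1 ?addr0.
  by rewrite mulrC; congr (_ * _); rewrite !mxE.
by move=> l' ll; rewrite tensmxE [1%:M _ _]mxE (negbTE ll) mulr0 mulr0.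
Qed.

Lemma sqn_Phi (R : realType) (m n q : nat) (A : 'M[R]_m) (w : 'rV[R]_(m * q)) :
  sqn (w *m Phi A n q) = \sum_(0 <= k < n) sqn (e1row R m *m A ^+ k *m unrvec w).
Proof. by rewrite sqn_vrow; apply: eq_big_nat => i /andP[_ hi]; rewrite vrow_Phi. Qed.

Lemma sqn_e1row (R : realType) (m r : nat) (X : 'M[R]_(m, r)) : sqn (e1row R m *m X) <= sqn X.
Proof.
apply: le_trans (sqn_mul _ _) _; rewrite -[leRHS]mul1r ler_wpM2r ?sqn_ge0 // sqnE.
case: m {X} => [|m]; first by rewrite big_ord0.
rewrite big_ord_recl big1 ?addr0; first by rewrite mxE expr1n.
by move=> i _; rewrite mxE /= expr0n.
Qed.

Lemma sqn_Phi_sub (R : realType) (m n q : nat) (A B : 'M[R]_m) (D : R) :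
  \sum_(0 <= k < n) N1 (B ^+ k - A ^+ k) <= D -> sqn (Phi B n q - Phi A n q) <= q%:R * D ^+ 2.
Proof.
move=> hD; have -> : Phi B n q - Phi A n q = (obsv B n - obsv A n)^T *t (1%:M : 'M[R]_q).
  apply/matrixP => i j; rewrite -(mxtens_unindexK i) -(mxtens_unindexK j).
  case: (mxtens_unindex i) => i1 i2; case: (mxtens_unindex j) => j1 j2.
  by rewrite mxBE /Phi !tensmxE -mulrBl; congr (_ * _); rewrite !mxE.
rewrite sqn_tens1 ler_wpM2l // sqn_tr.
have Dk : 0 <= \sum_(0 <= k < n) N1 (B ^+ k - A ^+ k) by apply: sumr_ge0 => k _; exact: N1_ge0.
have D0 : 0 <= D by exact: le_trans hD.
apply: (@le_trans _ _ (\sum_(0 <= k < n) N1 (B ^+ k - A ^+ k) * D)).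
  rewrite /sqn big_mkord; apply: ler_sum => k _.
  apply: (@le_trans _ _ (sqn (e1row R m *m (B ^+ k - A ^+ k)))).
    by rewrite sqnE le_eqVlt; apply/orP; left; apply/eqP; apply: eq_bigr => j _; rewrite mulmxBr !mxE.
  apply: le_trans (sqn_e1row _) _; apply: le_trans (sqn_N1 _) _; rewrite expr2 ler_wpM2l ?N1_ge0 //.
  apply: le_trans hD; rewrite big_mkord (bigD1 k) //= lerDl sumr_ge0 // => j _; exact: N1_ge0.
by rewrite -mulr_suml expr2 ler_wpM2r.
Qed.

(** The canonical form is affine in [a], and differences are confined to the first column. *)
Lemma N1_canonical (R : realType) (m : nat) (a b : 'rV[R]_m.+1) :
  N1 (canonical_AK b - canonical_AK a) <= N1 (b - a).
Proof.
rewrite /N1 [leRHS]big_ord1 [leRHS](reindex_inj rev_ord_inj) /=; apply: ler_sum => i _.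
rewrite big_ord_recl big1 ?addr0.
  by rewrite !mxE /= -opprD normrN.
by move=> j _; rewrite !mxE /= subrr normr0.
Qed.

(** Output injection preserves observability: as long as [C A_K^j u = 0], the term [K C] does not
    act, and [A^i u = A_K^i u]. *)
Lemma obs_AK (R : realType) (m : nat) (A : 'M[R]_m) (C : 'rV[R]_m) (K : 'cV[R]_m) :
  observable A C -> forall u : 'cV[R]_m,
  (forall i, (i < m)%N -> C *m (A - K *m C) ^+ i *m u = 0) -> u = 0.
Proof.
move=> hobs u hu.
have e i : (i < m)%N -> A ^+ i *m u = (A - K *m C) ^+ i *m u.
  elim: i => [|i IH] hi; first by rewrite !expr0.
  rewrite exprS -[A * _]/(A *m _) -mulmxA IH ?(ltnW hi) // -{1}[A](subrK (K *m C)) mulmxDl.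
  rewrite [K *m C *m _]mulmxA -[K *m C *m _]mulmxA -[K *m _ *m u]mulmxA hu ?(ltnW hi) // mulmx0 addr0.
  by rewrite mulmxA exprS.
have : (\mxcol_(i < m) (C *m A ^+ i)) *m u = 0.
  rewrite mxcol_mul -[RHS]mxcol0; apply/eq_mxcol => i.
  by rewrite -mulmxA e // mulmxA hu.
move=> h; have : row_free (\mxcol_(i < m) (C *m A ^+ i))^T by rewrite /row_free mxrank_tr; apply/eqP.
move/row_free_inj => inj; apply: trmx_inj; apply: inj.
by rewrite -trmx_mul h !trmx0 mul0mx.
Qed.

(** Each [w A_K^i] kills [[B K]], hence its block [K], so the term [K C] drops out and
    [w A^i = w A_K^i]. *)
Lemma ctrb_AK (R : realType) (m q : nat) (A : 'M[R]_m) (BK : 'M[R]_(m, q)) (C : 'rV[R]_m) (K : 'cV[R]_m) :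
  controllable A BK -> (forall w : 'rV[R]_m, w *m BK = 0 -> w *m K = 0) ->
  forall w : 'rV[R]_m, (forall i, (i < m)%N -> w *m (A - K *m C) ^+ i *m BK = 0) -> w = 0.
Proof.
move=> hctr hK w hw.
have e i : (i < m)%N -> w *m A ^+ i = w *m (A - K *m C) ^+ i.
  elim: i => [|i IH] hi; first by rewrite !expr0.
  rewrite exprSr -[A ^+ i * A]/(A ^+ i *m A) mulmxA IH ?(ltnW hi) // -{2}[A](subrK (K *m C)) mulmxDr.
  by rewrite [_ *m (K *m C)]mulmxA hK ?hw ?(ltnW hi) // mul0mx addr0 -mulmxA exprSr.
have h : w *m (\mxrow_(i < m) (A ^+ i *m BK)) = 0.
  rewrite mul_mxrow -[RHS]mxrow0; apply/eq_mxrow => i.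
  by rewrite mulmxA e // hw.
have /row_free_inj inj : row_free (\mxrow_(i < m) (A ^+ i *m BK)) by rewrite /row_free; apply/eqP.
by apply: inj; rewrite h mul0mx.
Qed.

(** Stacking finitely many blocks turns injectivity in the fixed dimension [m] into a constant,
    which is what later bounds, uniform in the ARX order, are built from. *)
Lemma lower_rows (R : realType) (m r : nat) (X : nat -> 'M[R]_(m, r)) :
  (forall w : 'rV[R]_m, (forall i, (i < m)%N -> w *m X i = 0) -> w = 0) ->
  exists2 c : R, 0 < c & forall w : 'rV[R]_m, c * sqn w <= \sum_(0 <= i < m) sqn (w *m X i).
Proof.
move=> h; pose Y : 'M[R]_(m, m * r) := \matrix_(i, c) X (mxtens_unindex c).1 i (mxtens_unindex c).2.
have e (w : 'rV[R]_m) i : (i < m)%N -> vrow (w *m Y) i = w *m X i.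
  move=> hi; rewrite (vrow_ord _ (Ordinal hi)); apply/rowP => j; rewrite !mxE; apply: eq_bigr => k _.
  by rewrite mxE mxtens_indexK.
have [c c0 hc] : exists2 c : R, 0 < c & oplb c Y.
  apply: trivial_ker_oplb => w hw; apply: h => i hi; rewrite -e // hw.
  by rewrite (vrow_ord _ (Ordinal hi)); apply/rowP => j; rewrite !mxE.
exists c => // w; apply: le_trans (hc w) _; rewrite sqn_vrow le_eqVlt; apply/orP; left; apply/eqP.
by apply: eq_big_nat => i /andP[_ hi]; rewrite e.
Qed.

(** * Uniform continuity of the estimators at the true parameters *)

Section Estimators.
Variables (R : realType) (m q : nat) (a : 'rV[R]_m.+1) (BK : 'M[R]_(m.+1, q)).
Let nx := m.+1.
Let AK := canonical_AK a.
Let eta := rvec BK.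

Hypothesis AK_stable : spectral_radius AK < 1.
Hypothesis AK_obs : forall u : 'cV[R]_nx,
  (forall i, (i < nx)%N -> e1row R nx *m AK ^+ i *m u = 0) -> u = 0.
Hypothesis AK_ctrb : forall w : 'rV[R]_nx, (forall i, (i < nx)%N -> w *m AK ^+ i *m BK = 0) -> w = 0.

Lemma double_nx_lt n : (nx + nx <= n)%N -> (nx < n)%N.
Proof. by clear; rewrite /nx; lia. Qed.

Definition gtrue (n : nat) : 'rV[R]_(n * q) := eta *m Phi AK n q.

Lemma gtrue_Kn n : gtrue n *m Kn n q a = 0.
Proof. by rewrite /gtrue -mulmxA Phi_Kn mulmx0. Qed.

Lemma vrow_gtrue n i : (i < n)%N -> vrow (gtrue n) i = e1row R nx *m AK ^+ i *m BK.
Proof. by move=> hi; rewrite /gtrue vrow_Phi // rvecK. Qed.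

Lemma obsv_lb : exists2 c : R, 0 < c & forall (U : 'M[R]_(nx, q)),
  c * sqn U <= \sum_(0 <= k < nx) sqn (e1row R nx *m AK ^+ k *m U).
Proof.
have [|c c0 hc] := @lower_rows R nx 1 (fun k => (e1row R nx *m AK ^+ k)^T).
  move=> w hw; apply: trmx_inj; rewrite trmx0; apply: AK_obs => i hi.
  by apply: trmx_inj; rewrite trmx_mul trmxK trmx0 hw.
exists c => // U.
  have e : sqn U = \sum_(j < q) sqn (col j U)^T.
    rewrite -sqn_tr /sqn; apply: eq_bigr => j _; rewrite big_ord1.
    by apply: eq_bigr => i _; rewrite !mxE.
  rewrite e mulr_sumr; apply: le_trans (ler_sum _ (fun j _ => hc _)) _.
  rewrite exchange_big /=; apply: ler_sum => k _.
  rewrite sqnE le_eqVlt; apply/orP; left; apply/eqP; apply: eq_bigr => j _.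
  rewrite -trmx_mul sqn_tr sqnE big_ord1; congr (_ ^+ 2); rewrite !mxE; apply: eq_bigr => i _.
  by rewrite !mxE.
Qed.

(** By observability the first [nx] blocks already determine the vector; the other blocks only add,
    so the constant is free of [n]. *)
Lemma Phi_lb : exists2 c : R, 0 < c & forall n, (nx <= n)%N -> oplb c (Phi AK n q).
Proof.
have [c c0 hc] := obsv_lb; exists c => // n hn v.
rewrite sqn_Phi -sqn_unrvec; apply: le_trans (hc _) _.
rewrite [leRHS](@big_cat_nat _ _ _ nx 0%N n) //= lerDl; apply: sumr_ge0 => k _; exact: sqn_ge0.
Qed.

Lemma Phi_ub : exists2 c : R, 0 < c & forall n, opub c (Phi AK n q).
Proof.
have [S hS] := powers_summable AK_stable.
exists (q%:R * S ^+ 2 + 1); first by rewrite ltr_wpDl // mulr_ge0 // sqr_ge0.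
move=> n; apply: opub_le (opub_sqn _).
have S0 : 0 <= S by have := hS 0%N; rewrite big_geq.
apply: (@le_trans _ _ (q%:R * S ^+ 2)); last by rewrite lerDl.
rewrite /Phi sqn_tens1 sqn_tr ler_wpM2l //.
apply: (@le_trans _ _ (\sum_(0 <= k < n) N1 (AK ^+ k) * S)).
  rewrite /sqn big_mkord; apply: ler_sum => k _.
  apply: (@le_trans _ _ (sqn (e1row R nx *m AK ^+ k))).
    by rewrite sqnE le_eqVlt; apply/orP; left; apply/eqP; apply: eq_bigr => j _; rewrite !mxE.
  apply: le_trans (sqn_e1row _) _; apply: le_trans (sqn_N1 _) _; rewrite expr2 ler_wpM2l ?N1_ge0 //.
  apply: le_trans (hS n); rewrite big_mkord (bigD1 k) //= lerDl sumr_ge0 // => j _; exact: N1_ge0.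
by rewrite -mulr_suml expr2 ler_wpM2r.
Qed.

(** The Hankel matrix factors into observability times controllability; [n >= 2 nx] provides the
    [nx] block columns at which the second factor has full rank. *)
Lemma Hplus_gtrue_lb : exists2 c : R, 0 < c & forall n, (nx + nx <= n)%N -> oplb c (Hplus nx (gtrue n)).
Proof.
have [c1 c10 h1] := lower_rows (X := fun i => AK ^+ i *m BK) (fun w hw => AK_ctrb
  (fun i hi => etrans (esym (mulmxA w (AK ^+ i) BK)) (hw i hi))).
have Ou : obsv AK nx \in unitmx.
  rewrite -unitmx_tr -row_free_unit -kermx_eq0; apply/eqP/row_matrixP => k; rewrite row0.
  have hw : row k (kermx (obsv AK nx)^T) *m (obsv AK nx)^T = 0 by rewrite -row_mul mulmx_ker row0.
  apply: trmx_inj; rewrite trmx0; apply: AK_obs => i hi.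
  have h2 : obsv AK nx *m (row k (kermx (obsv AK nx)^T))^T = 0.
    by apply: trmx_inj; rewrite trmx_mul trmxK trmx0.
  have : row (Ordinal hi) (obsv AK nx) *m (row k (kermx (obsv AK nx)^T))^T = 0.
    by rewrite -row_mul h2 row0.
  by rewrite rowK.
have [c2 c20 h2] : exists2 c : R, 0 < c & oplb c (obsv AK nx).
  by apply: row_free_oplb; rewrite row_free_unit.
exists (c1 * c2); first exact: mulr_gt0.
move=> n hn v; rewrite -mulrA.
apply: (le_trans (ler_wpM2l (ltW c10) (h2 v))); apply: le_trans (h1 _) _.
have e (j : 'I_(n - nx)) : vrow (v *m Hplus nx (gtrue n)) j = v *m obsv AK nx *m (AK ^+ j *m BK).
  rewrite vrow_ord; apply/rowP => l; rewrite mxE mxE.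
  rewrite (eq_bigr (fun i => v 0 i * (e1row R nx *m AK ^+ (i + j) *m BK) 0 l)); last first.
    move=> i _; rewrite HplusE vrow_gtrue //; have := ltn_ord i; have := ltn_ord j; clear -hn.
    by rewrite /nx in hn *; lia.
  rewrite -mulmxA mxE; apply: eq_bigr => i _; congr (_ * _).
  rewrite exprD -[AK ^+ i * _]/(AK ^+ i *m _) !mulmxA.
  have -> : e1row R nx *m AK ^+ i = row i (obsv AK nx) by rewrite rowK.
  by rewrite -!row_mul mxE.
rewrite sqn_vrow [leRHS](@big_cat_nat _ _ _ nx 0%N (n - nx)) //=; last by clear -hn; rewrite /nx in hn *; lia.
rewrite -[leLHS]addr0; apply: lerD; last by apply: sumr_ge0 => k _; exact: sqn_ge0.
rewrite !big_nat; apply: ler_sum => j /andP[_ hj].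
have hj2 : (j < n - nx)%N by clear -hn hj; rewrite /nx in hn *; lia.
by rewrite (e (Ordinal hj2)).
Qed.

(** A tolerance for an error amplified by [k]; [d <= 1] also serves to bound [d^2] by [d]. *)
Lemma small_factor (k tau : R) : 0 <= k -> 0 < tau -> exists2 d : R, 0 < d & d <= 1 /\ k * d <= tau.
Proof.
move=> k0 t0; have k1 : 0 < k + 1 by rewrite ltr_wpDl.
exists (Num.min 1 (tau / (k + 1))); first by rewrite lt_min ltr01 divr_gt0.
split; first by rewrite ge_min lexx.
apply: (@le_trans _ _ (k * (tau / (k + 1)))); first by rewrite ler_wpM2l // ge_min lexx orbT.
by rewrite mulrA ler_pdivrMr // mulrC ler_pM2l // lerDl.
Qed.

Lemma Hplus_bounds : exists l u : R, [/\ 0 < l, 0 < u & exists2 d : R, 0 < d &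
  forall n g, (nx + nx <= n)%N -> sqn (g - gtrue n) <= d ->
  oplb l (Hplus nx g) /\ opub u (Hplus nx g)].
Proof.
have [c c0 hc] := Hplus_gtrue_lb; have [f f0 hf] := Phi_ub.
pose G := f * sqn eta; have G0 : 0 <= G by rewrite mulr_ge0 ?sqn_ge0 // ltW.
have c4 : 0 < c / 4 by rewrite divr_gt0.
have [d d0 [d1 hd]] := small_factor (ler0n R nx) c4.
exists (c / 4), (nx%:R * (2 * G + 2)); split=> //; first by rewrite mulr_gt0 ?ltr0n // ltr_wpDl // mulr_ge0.
exists d => // n g hn hg; split.
  have hp : opub (nx%:R * sqn (g - gtrue n)) (Hplus nx g - Hplus nx (gtrue n)).
    by rewrite -Hplus_sub; exact: opub_Hplus.
  apply: oplb_le (oplb_pert (hc n hn) hp).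
  have : nx%:R * sqn (g - gtrue n) <= nx%:R * d by rewrite ler_wpM2l.
  lra.
apply: opub_le (opub_Hplus _); rewrite ler_wpM2l //.
rewrite -[g](subrK (gtrue n)) addrC; apply: le_trans (sqnD _ _) _.
have : sqn (gtrue n) <= G by exact: hf.
lra.
Qed.

Lemma sqn_gKn n (g : 'rV[R]_(n * q)) : (nx < n)%N ->
  sqn (g *m Kn n q a) <= (1 + N1 a) ^+ 2 * sqn (g - gtrue n).
Proof.
move=> hn; have p0 : 0 <= 1 + N1 a by rewrite addr_ge0 // N1_ge0.
have [|_ hu] := @Kn_tr_bounds R nx n q a 0 (1 + N1 a) (lexx 0) hn.
  by move=> x x1; rewrite cm_ge0 /=; exact: apoly_ub.
have -> : g *m Kn n q a = (g - gtrue n) *m Kn n q a by rewrite mulmxBl gtrue_Kn subr0.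
exact: (opub_Kn p0 hu).
Qed.

(** Uniformity over all weights between [w1] and [w2] is essential: in Step 3 the weight is itself a
    function of [g] and [R_n]. *)
Lemma aW_close (w1 w2 : R) : 0 < w1 -> 0 < w2 -> forall tau : R, 0 < tau ->
  exists2 d : R, 0 < d & forall n g (W : 'M[R]_((n - nx) * q)), (nx + nx <= n)%N -> sqn (g - gtrue n) <= d ->
  qbd w1 w2 W -> Hplus nx g *m W *m (Hplus nx g)^T \in unitmx /\ sqn (aW W g - a) <= tau.
Proof.
move=> w10 w20 tau t0; have [l [u [l0 u0 [d d0 hd]]]] := Hplus_bounds.
pose k := w2 ^+ 2 * u * ((w1 * l)^-1) ^+ 2 * (1 + N1 a) ^+ 2.
have k0 : 0 <= w2 ^+ 2 * u * ((w1 * l)^-1) ^+ 2.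
  by apply: mulr_ge0; [apply: mulr_ge0; [exact: sqr_ge0 | exact: ltW] | exact: sqr_ge0].
have [d' d'0 [_ hd']] := small_factor (mulr_ge0 k0 (sqr_ge0 (1 + N1 a))) t0.
exists (Num.min d d'); first by rewrite lt_min d0.
move=> n g W hn; rewrite le_min => /andP[hg hg'] hW.
have [hl hu] := hd n g hn hg.
have [U hb] := aW_bound a w10 w20 l0 u0 hW hl hu; split=> //.
have nn := double_nx_lt hn.
apply: le_trans hb _; apply: le_trans (ler_wpM2l k0 (sqn_gKn _ nn)) _.
rewrite mulrA; apply: le_trans hd'; apply: ler_wpM2l => //; apply: mulr_ge0 => //; exact: sqr_ge0.
Qed.

Lemma sqn_N1_row (v : 'rV[R]_nx) : N1 v ^+ 2 <= nx%:R * sqn v.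
Proof.
rewrite /N1 big_ord1; apply: le_trans (sqr_sum_le _) _; rewrite card_ord ler_wpM2l // sqnE.
by apply: ler_sum => i _; rewrite real_normK ?num_real.
Qed.

Lemma N1_small (tau : R) : 0 < tau -> exists2 d : R, 0 < d & forall v : 'rV[R]_nx, sqn v <= d -> N1 v <= tau.
Proof.
move=> t0; have [d d0 [_ hd]] := small_factor (ler0n R nx) (exprn_gt0 2 t0).
exists d => // v hv; rewrite -(@ler_pXn2r _ 2) ?nnegrE ?N1_ge0 ?(ltW t0) //.
apply: le_trans (sqn_N1_row v) _; apply: le_trans hd; by rewrite ler_wpM2l.
Qed.

(** The unweighted estimate is close to [a], so its polynomial stays away from 0 on the circle, and
    [K_n] at this estimate is well conditioned uniformly in [n]. The weight is then a congruence of
    the inverse of [R_n]. *)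
Lemma Lambda_bounds (b1 b2 : R) : 0 < b1 -> 0 < b2 ->
  exists w1 w2 : R, [/\ 0 < w1, 0 < w2 & exists2 d : R, 0 < d &
  forall n (Rn : 'M[R]_(n * q)) g, (nx + nx <= n)%N -> qbd b1 b2 Rn -> sqn (g - gtrue n) <= d ->
  qbd w1 w2 (invmx (Lambda_ols nx Rn g))].
Proof.
move=> b10 b20; have [lo lo0 hlo] := apoly_lb AK_stable.
have lo2 : 0 < lo / 2 by rewrite divr_gt0.
have [d1 d10 h1] := N1_small lo2.
have [d d0 hd] := aW_close ltr01 ltr01 d10.
pose hi := 1 + N1 a + lo / 2; have hi0 : 0 < hi by rewrite /hi addrAC ltr_wpDr ?N1_ge0 // addr_gt0.
pose r1 := b2^-1 * (lo / 2) ^+ 2; pose r2 := b1^-1 * hi ^+ 2.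
have r10 : 0 < r1 by rewrite mulr_gt0 ?invr_gt0 ?exprn_gt0.
have r20 : 0 < r2 by rewrite mulr_gt0 ?invr_gt0 ?exprn_gt0.
exists r2^-1, r1^-1; rewrite !invr_gt0; split=> //; exists d => // n Rn g hn hR hg.
have [_ ha] := hd n g 1%:M hn hg (qbd_scalar R _); rewrite -a_olsE in ha.
have hN := h1 _ ha.
have nn := double_nx_lt hn.
have [|hl hu] := @Kn_tr_bounds R nx n q (a_ols nx g) (lo / 2) hi (ltW lo2) nn.
  move=> x x1; have p := apoly_pert a (a_ols nx g) x1.
  have l1 := hlo x x1; have u1 := apoly_ub a x1.
  set X := (map_poly _ (apoly a)).[x] in p l1 u1; set Y := _.[x] in p *.
  have e1 : cm Y <= cm X + cm (Y - X) by rewrite -{1}[Y](subrK X) addrC cmD.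
  have e2 : cm X <= cm Y + cm (Y - X).
    by rewrite -{1}[X](subKr Y) (le_trans (cmD _ _)) // cmN.
  apply/andP; split; rewrite /hi; lra.
have := qbd_cong (ltW _) (ltW _) (qbd_inv b10 b20 hR) hl hu.
rewrite trmxK !invr_gt0 => /(_ b20 b10) hL.
exact: qbd_inv.
Qed.

Lemma wls_close (b1 b2 tau : R) : 0 < b1 -> 0 < b2 -> 0 < tau ->
  exists2 d : R, 0 < d & forall n (Rn : 'M[R]_(n * q)) g, (nx + nx <= n)%N -> qbd b1 b2 Rn ->
  sqn (g - gtrue n) <= d -> Mhat nx Rn g \in unitmx /\ sqn (a_wls nx Rn g - a) <= tau.
Proof.
move=> b10 b20 t0; have [w1 [w2 [w10 w20 [d d0 hd]]]] := Lambda_bounds b10 b20.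
have [d' d'0 hd'] := aW_close w10 w20 t0.
exists (Num.min d d'); first by rewrite lt_min d0.
move=> n Rn g hn hR; rewrite le_min => /andP[hg hg'].
exact: (hd' n g _ hn hg' (hd n Rn g hn hR hg)).
Qed.

(* Ke = I + X Y with g X = 0 (normal equation) and Phihat X = 0
   (Cayley-Hamilton), so both g and Phihat are fixed by Ke and the weight
   (Ke^T R^-1 Ke)^-1 may be replaced by R. *)
Lemma eta_wlsE n (Rn : 'M[R]_(n * q)) (g : 'rV[R]_(n * q)) :
  Rn \in unitmx -> Mhat nx Rn g \in unitmx -> Lambda_wls nx Rn g \in unitmx ->
  eta_wls nx Rn g = g *m Rn *m (Phihat nx Rn g)^T *m invmx (Phihat nx Rn g *m Rn *m (Phihat nx Rn g)^T).
Proof.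
move=> hR hM; rewrite /eta_wls /Lambda_wls; set Ke := Kn_eta _ _ _ _ => hL.
set P := Phihat nx Rn g.
pose X := Kn n q (a_wls nx Rn g) *m (invmx (Lambda_ols nx Rn g) *m (Hplus nx g)^T *m invmx (Mhat nx Rn g)).
have [Y hY] : exists Y, Ke = 1%:M + X *m Y.
  by eexists; rewrite /Ke /Kn_eta /X !mulmxA -mulmxA; reflexivity.
have gX : g *m X = 0.
  by rewrite /X mulmxA a_wlsE; exact: aW_normal.
have PX : P *m X = 0 by rewrite /X mulmxA Phi_Kn mul0mx.
have gK : g *m Ke = g by rewrite hY mulmxDr mulmx1 mulmxA gX mul0mx addr0.
have PK : P *m Ke = P by rewrite hY mulmxDr mulmx1 mulmxA PX mul0mx addr0.
have uK : Ke \in unitmx by move: hL; rewrite !unitmx_mul => /andP[].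
have gKi : g *m invmx Ke = g by rewrite -{1}gK mulmxK.
have PKi : P *m invmx Ke = P by rewrite -{1}PK mulmxK.
have eL : invmx (Ke^T *m invmx Rn *m Ke) = invmx Ke *m Rn *m (invmx Ke)^T.
  have e1 : (Ke^T *m invmx Rn *m Ke) *m (invmx Ke *m Rn *m (invmx Ke)^T) = 1%:M.
    rewrite -!mulmxA (mulmxA Ke) mulmxV // mul1mx (mulmxA (invmx Rn)) mulVmx // mul1mx.
    by rewrite -trmx_mul mulVmx // trmx1.
  by rewrite -[LHS]mulmx1 -e1 mulmxA mulVmx // mul1mx.
rewrite eL; have e2 : (invmx Ke)^T *m P^T = P^T by rewrite -trmx_mul PKi.
have e3 (r : nat) (Z : 'M[R]_(r, n * q)) : Z *m invmx Ke = Z ->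
   Z *m (invmx Ke *m Rn *m (invmx Ke)^T) *m P^T = Z *m Rn *m P^T.
  by move=> hZ; rewrite -!mulmxA e2 !mulmxA hZ.
by rewrite (e3 _ g) // (e3 _ P).
Qed.

(** The [n] blocks do not accumulate error: the differences of the powers are summable, with a sum
    proportional to the error in [A_K]. *)
Lemma Phihat_close (tau : R) : 0 < tau -> exists2 d : R, 0 < d & forall n (b : 'rV[R]_nx),
  sqn (b - a) <= d -> sqn (Phi (canonical_AK b) n q - Phi AK n q) <= tau.
Proof.
move=> t0; have [S hS] := powers_summable AK_stable.
have S0 : 0 <= S by have := hS 0%N; rewrite big_geq.
have [e e0 [e1 he]] := small_factor S0 (ltac:(by rewrite invr_gt0) : 0 < 2^-1).
pose k := q%:R * (2 * S ^+ 2) ^+ 2.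
have [e' e'0 [e'1 he']] := small_factor (mulr_ge0 (ler0n R q) (sqr_ge0 (2 * S ^+ 2))) t0.
have me : 0 < Num.min e e' by rewrite lt_min e0.
have [d d0 hd] := N1_small me; exists d => // n b hb.
have := hd _ hb; rewrite le_min => /andP[he1 he2].
have hN := N1_canonical a b; rewrite -/AK in hN.
have hN0 := N1_ge0 (canonical_AK b - AK).
have hp := @powers_pert _ _ AK (canonical_AK b) S hS.
have hs : N1 (canonical_AK b - AK) * S <= 2^-1.
  by apply: le_trans he; rewrite mulrC ler_wpM2l // (le_trans hN).
apply: le_trans (sqn_Phi_sub q (hp hs n)) _; apply: le_trans he'.
have -> : 2 * N1 (canonical_AK b - AK) * S ^+ 2 = (2 * S ^+ 2) * N1 (canonical_AK b - AK) by ring.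
rewrite exprMn mulrA; apply: ler_wpM2l; first by rewrite mulr_ge0 // sqr_ge0.
have x1 : N1 (canonical_AK b - AK) <= e' by exact: le_trans hN he2.
rewrite expr2; apply: le_trans (_ : 1 * e' <= _); last by rewrite mul1r.
by apply: ler_pM => //; exact: le_trans x1 e'1.
Qed.

(** Least squares with weight [R_n] reproduces [eta] from [eta P]. Its error is thus the image of
    [g - eta P = (g - g_n) + eta (Phi - P)], a sum of two small terms, under a matrix bounded
    uniformly in [n]. *)
Lemma estimates_close (b1 b2 tau : R) : 0 < b1 -> 0 < b2 -> 0 < tau ->
  exists2 d : R, 0 < d & forall n (Rn : 'M[R]_(n * q)) g, (nx + nx <= n)%N -> qbd b1 b2 Rn ->
  sqn (g - gtrue n) <= d -> sqn (a_wls nx Rn g - a) <= tau /\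
    (Lambda_wls nx Rn g \in unitmx -> sqn (eta_wls nx Rn g - eta) <= tau).
Proof.
move=> b10 b20 t0; have [c c0 hc] := Phi_lb; have [f f0 hf] := Phi_ub.
pose u := 2 * f + 2; have u0 : 0 < u by rewrite addr_gt0 // mulr_gt0.
have c4 : 0 < c / 4 by rewrite divr_gt0.
pose k := b2 ^+ 2 * u * ((b1 * (c / 4))^-1) ^+ 2.
have k0 : 0 <= k by apply: mulr_ge0; [apply: mulr_ge0; [exact: sqr_ge0 | exact: ltW] | exact: sqr_ge0].
have k20 : 0 <= k * (2 + 2 * sqn eta) by rewrite mulr_ge0 // addr_ge0 // mulr_ge0 // sqn_ge0.
have [e e0 [e1 he]] := small_factor k20 t0.
have me : 0 < Num.min e (c / 4) by rewrite lt_min e0.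
have [d1 d10 h1] := Phihat_close me.
have md : 0 < Num.min tau d1 by rewrite lt_min t0.
have [d2 d20 h2] := wls_close b10 b20 md.
exists (Num.min d2 e); first by rewrite lt_min d20.
move=> n Rn g hn hR; rewrite le_min => /andP[hg2 hge].
have [hM] := h2 n Rn g hn hR hg2; rewrite le_min => /andP[hat had]; split=> // hL.
have := h1 n _ had; rewrite le_min => /andP[hPe hPc].
have RU := qbd_unit b10 hR.
rewrite eta_wlsE //; set P := Phihat nx Rn g.
have hP : opub (sqn (P - Phi AK n q)) (P - Phi AK n q) by exact: opub_sqn.
have nn := ltnW (double_nx_lt hn).
have pl : oplb (c / 4) P.
  by apply: oplb_le (oplb_pert (hc n nn) hP); move: hPc; rewrite -/(Phihat nx Rn g) -/P; lra.
have pu : opub u P.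
  apply: opub_le (opub_pert (hf n) hP); rewrite /u; move: hPe; rewrite -/(Phihat nx Rn g) -/P; lra.
have hG := qbd_cong (ltW b10) (ltW b20) hR pl pu.
have bc0 : 0 < b1 * (c / 4) by rewrite mulr_gt0.
have bu0 : 0 < b2 * u by rewrite mulr_gt0.
have GU := qbd_unit bc0 hG.
have eq1 : g *m Rn *m P^T *m invmx (P *m Rn *m P^T) - eta =
    (g - eta *m P) *m (Rn *m P^T *m invmx (P *m Rn *m P^T)).
  rewrite mulmxBl !mulmxA; congr (_ - _).
  by rewrite -(mulmxA eta P Rn) -(mulmxA eta (P *m Rn)) -(mulmxA eta _ (invmx _)) mulmxV // mulmx1.
rewrite eq1.
have h3 := qbd_opub (ltW b10) (ltW b20) hR.
have h4 := opub_tr (ltW u0) pu.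
have h5 := qbd_opub (ltW (_ : 0 < (b2 * u)^-1)) (ltW (_ : 0 < (b1 * (c / 4))^-1)) (qbd_inv bc0 bu0 hG).
have h6 : opub k (Rn *m P^T *m invmx (P *m Rn *m P^T)).
  apply: (opub_mul _ (opub_mul _ h3 h4) (h5 _ _)); rewrite ?invr_gt0 // ?sqr_ge0 // ltW //.
apply: le_trans (h6 _) _.
have e2 : sqn (g - eta *m P) <= (2 + 2 * sqn eta) * e.
  have -> : g - eta *m P = (g - gtrue n) + eta *m (Phi AK n q - P).
    by rewrite mulmxBr addrA /gtrue subrK.
  apply: le_trans (sqnD _ _) _.
  have x1 : sqn (eta *m (Phi AK n q - P)) <= sqn eta * e.
    apply: le_trans (sqn_mul _ _) _; apply: ler_wpM2l; first exact: sqn_ge0.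
    by rewrite -sqnN opprB.
  lra.
by apply: le_trans he; rewrite -mulrA ler_wpM2l.
Qed.

End Estimators.

(** * Consistency of the ARX estimate along a path *)

Lemma pbd_sum (R : realType) (I : finType) (f : I -> int -> R) :
  (forall i, pbd (f i)) -> pbd (fun t => \sum_i f i t).
Proof.
move=> h; rewrite /index_enum; elim: (Finite.enum _) => [|i r IH].
  exists 0; split=> // M; rewrite mul0r /win big1 // => k _; by rewrite big_nil.
by under [X in pbd X]eq_fun do rewrite big_cons; apply: pbdD.
Qed.

Lemma pbd_mulmx (R : realType) (p q : nat) (M : 'M[R]_(p, q)) (z : int -> 'cV[R]_q) :
  pbd (fun t => sqn (z t)) -> pbd (fun t => sqn (M *m z t)).
Proof.
move=> h; apply: pbd_le (pbdZ (sqn_ge0 M) h) => t; exact: sqn_mul.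
Qed.

Lemma pbd_sub (R : realType) (f g : int -> R) :
  pbd (fun t => f t ^+ 2) -> pbd (fun t => g t ^+ 2) -> pbd (fun t => (f t - g t) ^+ 2).
Proof.
move=> hf hg; apply: pbd_le (pbdD (pbdZ (ler0n R 2) hf) (pbdZ (ler0n R 2) hg)) => t.
by have := sqr_ge0 (f t + g t); rewrite sqrrD sqrrB !mulr2n; lra.
Qed.

Section Pathwise.
Variables (R : realType) (m q : nat) (a : 'rV[R]_m.+1) (BK : 'M[R]_(m.+1, q)).
Let nx := m.+1.
Let AK := canonical_AK a.
Variables (x : int -> 'cV[R]_nx) (z : int -> 'cV[R]_q) (y e : int -> 'cV[R]_1).

Hypothesis state_eq : forall t, x (t + 1) = AK *m x t + BK *m z t.
Hypothesis output_eq : forall t, y t = e1row R nx *m x t + e t.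

(* Row i of the state equation gives the coordinate i + 1 of x_t from the
   coordinate i of x_(t+1), by the canonical form. *)
Lemma state_pbd : pbd (fun t => sqn (z t)) -> pbd (fun t => sqn (y t)) -> pbd (fun t => sqn (e t)) ->
  pbd (fun t => sqn (x t)).
Proof.
move=> hz hy he; under [X in pbd X]eq_fun do rewrite sqn_colE.
apply: pbd_sum => -[i hi].
have e1x t : (e1row R nx *m x t) 0 0 = x t 0 0.
  rewrite mxE big_ord_recl mxE /= mul1r big1 ?addr0 // => j _; by rewrite mxE /= mul0r.
have ent (v : int -> 'cV[R]_1) : pbd (fun t => sqn (v t)) -> pbd (fun t => v t 0 0 ^+ 2).
  by apply: pbd_le => t; exact: sqn_entry.
have x0 : pbd (fun t => x t 0 0 ^+ 2).
  have -> : (fun t => x t 0 0 ^+ 2) = (fun t => (y t 0 0 - e t 0 0) ^+ 2).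
    by apply/funext => t; rewrite output_eq mxE e1x addrK.
  by apply: pbd_sub; exact: ent.
elim: i hi => [|i IH] hi; first by rewrite (_ : Ordinal hi = 0) //; exact: val_inj.
have hi' : (i < nx)%N by exact: ltnW.
have := IH hi' => hxi.
have -> : (fun t => x t (Ordinal hi) 0 ^+ 2) = (fun t => ((x (t + 1) (Ordinal hi') 0 - AK (Ordinal hi') 0 * x t 0 0) -
    (BK *m z t) (Ordinal hi') 0) ^+ 2).
  apply/funext => t; congr (_ ^+ 2); rewrite state_eq mxE -[LHS]addr0 -[X in _ = X - _]addrA -!addrA.
  have -> : (AK *m x t) (Ordinal hi') 0 = AK (Ordinal hi') 0 * x t 0 0 + x t (Ordinal hi) 0.
    rewrite mxE (bigD1 0) //= (bigD1 (Ordinal hi)) //= [AK _ (Ordinal hi)]mxE /= eqxx mul1r big1 ?addr0 // => j /andP[j0 j1].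
    rewrite mxE; case: eqP => [j00|_]; first by move: j0; rewrite -val_eqE /= j00.
    by case: eqP => [j11|_]; [move: j1; rewrite -val_eqE /= j11 eqxx | rewrite mul0r].
  ring.
apply: pbd_sub; last by apply: pbd_le (pbd_mulmx BK hz) => t; exact: sqn_entry.
apply: pbd_sub.
  by apply: (pbd_shift 1 (f := fun t => x t (Ordinal hi') 0 ^+ 2)) => // t; exact: sqr_ge0.
by under [X in pbd X]eq_fun do rewrite exprMn; apply: pbdZ => //; exact: sqr_ge0.
Qed.

Lemma state_iter n t : x t = AK ^+ n *m x (t - n%:Z) + \sum_(0 <= i < n) AK ^+ i *m BK *m z (t - i.+1%:Z).
Proof.
elim: n => [|n IH]; first by rewrite big_geq // expr0 mul1mx subr0 addr0.
rewrite {1}IH big_nat_recr //= [X in _ = _ + X]addrC addrA; congr (_ + _).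
have -> : t - n%:Z = t - n.+1%:Z + 1 by lia.
by rewrite state_eq mulmxDr !mulmxA exprSr.
Qed.

(** Carrying the truncation by the state [n] steps back avoids an infinite predictor expansion: the
    energy of the state grows linearly, and the factor [A_K^n] is small. *)
Lemma output_resid n t :
  y t - gtrue a BK n *m regressor z n t = e t + e1row R nx *m AK ^+ n *m x (t - n%:Z).
Proof.
have -> : gtrue a BK n *m regressor z n t = \sum_(0 <= i < n) e1row R nx *m AK ^+ i *m BK *m z (t - i.+1%:Z).
  apply/matrixP => i j; rewrite !ord1 mul_regressor summxE; apply: eq_big_nat => k /andP[_ kn].
  by rewrite vrow_gtrue.
rewrite output_eq (state_iter n t) mulmxDr mulmx_sumr.
under eq_bigr => i _ do rewrite !mulmxA.
by rewrite mulmxA addrAC addrK addrC.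
Qed.

Variables (h : nat -> 'M[R]_q) (s : int -> 'cV[R]_q) (S : int -> 'M[R]_q) (B b1 b2 : R) (nn : nat -> nat)
  (ie : 'I_q).
Hypothesis hf : filtered h s z.
Hypothesis hh : asum (fun l => normF (h l) * Num.sqrt l%:R).
Hypothesis hh1 : asum (fun l => normF (h l)).
Hypothesis hp : pbd (fun t => sqn (s t)).
Hypothesis hu : ucov s S.
Hypothesis hz_y : pbd (fun t => sqn (z t)) -> pbd (fun t => sqn (y t)).
Hypothesis es : forall t, e t 0 0 = s t ie 0.
Hypothesis S_white : forall k j, S k.+1%:Z ie j = 0.
Hypothesis hnn : forall n0, exists N0, forall N, (N0 <= N)%N -> (n0 <= nn N)%N /\ (nn N ^ 4 <= N)%N.
Hypothesis AK_stable : spectral_radius AK < 1.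
Hypothesis b10 : 0 < b1.
Hypothesis b20 : 0 < b2.
Hypothesis hR : exists N0, forall N, (N0 <= N)%N -> qbd b1 b2 (Rhat z (nn N) N).

Lemma ghat_close (tau : R) : 0 < tau -> exists N0, forall N, (N0 <= N)%N ->
  sqn (ghat y z (nn N) N - gtrue a BK (nn N)) <= tau.
Proof.
move=> t0.
have pe : pbd (fun t => sqn (e t)).
  by apply: pbd_le hp => t; rewrite sqn_colE big_ord1 es; exact: sqn_entry.
have pz : pbd (fun t => sqn (z t)) := pbd_filtered hf hh hp.
have [Cx [Cx0 hCx]] := state_pbd pz (hz_y pz) pe.
have [C1 [C10 hC1]] := hp; have [C2 [C20 hC2]] := pe.
pose C := C1 + C2; have C0 : 0 <= C by rewrite addr_ge0.
have hCs M : win (fun t => sqn (s t)) M <= C * M.+1%:R.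
  by apply: le_trans (hC1 M) _; rewrite ler_wpM2r // lerDl.
have hCe M : win (fun t => sqn (e t)) M <= C * M.+1%:R.
  by apply: le_trans (hC2 M) _; rewrite ler_wpM2r // lerDr.
have [Sh hSh] := hh1; have Sh0 : 0 <= Sh by have := hSh 0%N; rewrite big_geq.
have [NR hNR] := hR.
pose c := (b1^-1) ^+ 2; have c0 : 0 < c by rewrite exprn_gt0 // invr_gt0.
(* The noise is allotted [2 t1] and the truncation [t1]; after doubling by [sqnD] this is [6 t1],
   below [8 t1 = tau / c]. *)
pose t1 := tau / (8 * c); have t10 : 0 < t1 by rewrite divr_gt0 // mulr_gt0.
have k1 : 0 <= 2 * q%:R ^+ 3 * Sh ^+ 2 by rewrite !mulr_ge0 ?exprn_ge0.
have k2 : 0 <= 12 * q%:R ^+ 2 * C ^+ 2 by rewrite !mulr_ge0 ?exprn_ge0.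
have k3 : 0 <= 2 * b2 * Cx by rewrite !mulr_ge0 // ltW.
have [d1 d10 [d11 hd1]] := small_factor k1 t10.
have [d2 d20 [d21 hd2]] := small_factor k2 t10.
have [d3 d30 [d31 hd3]] := small_factor k3 t10.
have sq_small (k d : R) : 0 <= k -> 0 < d -> d <= 1 -> k * d <= t1 -> k * d ^+ 2 <= t1.
  move=> k0 d0 dd hk; apply: le_trans hk; apply: ler_wpM2l => //.
  by rewrite expr2 ler_piMr // ltW.
have f0 l : 0 <= normF (h l) * Num.sqrt l%:R by rewrite mulr_ge0 ?normF_ge0 ?sqrtr_ge0.
have [n1 hn1] := asum_tail f0 hh d20.
have [n2 hn2] := asum_tail (fun k => N1_ge0 (AK ^+ k)) (powers_summable AK_stable) d30.
have [N1' hN1] := hu d10.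
have [N2 hN2] := hnn (n1 + n2).+1.
exists (NR + N1' + N2)%N => N hN; have [hn n4] := hN2 N ltac:(clear -hN; lia); set n := nn N in hn n4 *.
have n0 : (0 < n)%N by clear -hn; lia.
have nN : (n <= N)%N by apply: leq_trans n4; rewrite -{1}[n]expn1 leq_pexp2l.
have N0 : (0 < N)%N by exact: leq_trans nN.
have NR0 : 0 < N%:R :> R by rewrite ltr0n.
have nR0 : 0 < n%:R :> R by rewrite ltr0n.
have hQ := hNR N ltac:(clear -hN; lia); rewrite -/n in hQ.
have RU := qbd_unit b10 hQ.
have -> : ghat y z n N - gtrue a BK n = (rhat y z n N - gtrue a BK n *m Rhat z n N) *m invmx (Rhat z n N).
  by rewrite mulmxBl mulmxK.
have b1i : 0 < b1^-1 by rewrite invr_gt0.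
have b2i : 0 < b2^-1 by rewrite invr_gt0.
have hop := qbd_opub (ltW b2i) (ltW b1i) (qbd_inv b10 b20 hQ).
apply: le_trans (hop _) _; rewrite -/c rhat_resid.
pose w t := e1row R nx *m AK ^+ n *m x (t - n%:Z).
under eq_bigr => k _ do rewrite output_resid mulmxDl.
rewrite big_split scalerDr /=.
have hE : sqn (N%:R^-1 *: \sum_(1 <= k < N.+1) e k%:Z *m (regressor z n k%:Z)^T) <= 2 * t1.
  apply: le_trans (sqn_corr_filtered (th := d2) (kappa := d1) hf C0 hCs hCe hSh n0 nN _ (ltW d10) _) _.
  - by move=> k; apply: hn1; clear -hn; lia.
  (* The regressor stops at time [k - 1], so only positive lags occur, and there the limit
     covariance of [e] with [s] is 0. *)
  - move=> tau' j tau0 taun.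
    have := hN1 N ltac:(clear -hN; lia) N (leqnn N) n n4 tau'%:Z ltac:(clear -taun; lia) ie j.
    rewrite (eq_bigr (fun k => e k%:Z 0 0 * s (k%:Z - tau'%:Z) j 0)); last first.
      by move=> k _; rewrite es; case: tau' tau0 taun => // tau' _ _; rewrite S_white subr0.
    move=> hb; rewrite normrM ger0_norm ?invr_ge0 ?(ltW NR0) //.
    by rewrite mulrC ler_pdivrMr // mulrAC ler_pdivlMr // mulrC.
  - have := sq_small _ _ k1 d10 d11 hd1; have := sq_small _ _ k2 d20 d21 hd2; lra.
have hW : sqn (N%:R^-1 *: \sum_(1 <= k < N.+1) w k%:Z *m (regressor z n k%:Z)^T) <= t1.
  apply: le_trans (sqn_corr w b10 (ltW b20) hQ) _.
  have an : N1 (AK ^+ n) <= d3.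
    have := hn2 n n.+1 ltac:(clear -hn; lia); by rewrite big_nat1.
  have hw : N%:R^-1 * \sum_(1 <= k < N.+1) sqn (w k%:Z) <= d3 ^+ 2 * (2 * Cx).
    rewrite mulrC ler_pdivrMr //.
    apply: (@le_trans _ _ (\sum_(1 <= k < N.+1) d3 ^+ 2 * sqn (x (k%:Z - n%:Z)))).
      apply: ler_sum => k _; apply: le_trans (sqn_mul _ _) _; apply: ler_wpM2r; first exact: sqn_ge0.
      apply: le_trans (sqn_e1row _) _; apply: le_trans (sqn_N1 _) _.
      by rewrite ler_pXn2r ?nnegrE ?N1_ge0 // ltW.
    rewrite -mulr_sumr -[leRHS]mulrA; apply: ler_wpM2l; first exact: sqr_ge0.
    apply: (@le_trans _ _ (Cx * N.+1%:R)).
      apply: le_trans (hCx N); rewrite big_add1 /=.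
      rewrite (eq_bigr (fun k => sqn (x ((1 - n%:Z) + k%:Z)))); last first.
        by move=> k _; congr (sqn (x _)); clear; lia.
      by apply: win_sub => [t||]; [exact: sqn_ge0 | clear -nN; lia | clear -n0; lia].
    have : 1 <= N%:R :> R by rewrite ler1n.
    rewrite -natr1 => N11; have : Cx * 1 <= Cx * N%:R by rewrite ler_wpM2l.
    lra.
  apply: le_trans (ler_wpM2l (ltW b20) hw) _.
  have := sq_small _ _ k3 d30 d31 hd3; lra.
rewrite -/(w _); apply: (@le_trans _ _ (c * (8 * t1))).
  apply: ler_wpM2l; first exact: ltW.
  apply: le_trans (sqnD _ _) _; lra.
by rewrite /t1 le_eqVlt; apply/orP; left; apply/eqP; field; rewrite gt_eqF.
Qed.

End Pathwise.

(** * Strong laws for orthogonal sequences *)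

Section Mean.
Context (R : realType) d (T : measurableType d) (P : probability T R).

Definition has_mean (f : T -> R) (c : R) : Prop :=
  P.-integrable setT (EFin \o f) /\ (\int[P]_w (f w)%:E = c%:E)%E.

Lemma has_mean_cst (c : R) : has_mean (cst c) c.
Proof.
split; first exact: finite_measure_integrable_cst.
by rewrite (integral_cst P measurableT c%:E) [X in (_ * X)%E](probability_setT P) mule1.
Qed.

Lemma has_meanD f g a b : has_mean f a -> has_mean g b -> has_mean (fun w => f w + g w) (a + b).
Proof.
move=> [f1 f2] [g1 g2]; split; first exact: (integrableD measurableT f1 g1).
by under eq_integral => w _ do rewrite EFinD; rewrite (integralD measurableT f1 g1) f2 g2.
Qed.

Lemma has_meanZ k f a : has_mean f a -> has_mean (fun w => k * f w) (k * a).
Proof.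
move=> [f1 f2]; split; first exact: (integrableZl measurableT k f1).
by under eq_integral => w _ do rewrite EFinM; rewrite (integralZl measurableT f1) f2.
Qed.

Lemma has_mean_ext f g a : f =1 g -> has_mean f a -> has_mean g a.
Proof. by move=> /funext ->. Qed.

Lemma has_mean_sum (I : Type) (s : seq I) (f : I -> T -> R) (a : I -> R) :
  (forall i, has_mean (f i) (a i)) ->
  has_mean (fun w => \sum_(i <- s) f i w) (\sum_(i <- s) a i).
Proof.
move=> h; elim: s => [|i s IH].
  apply: (@has_mean_ext (cst 0)); last by rewrite big_nil; exact: has_mean_cst.
  by move=> w; rewrite big_nil.
rewrite big_cons; apply: (@has_mean_ext (fun w => f i w + \sum_(j <- s) f j w)).
  by move=> w; rewrite big_cons.
exact: has_meanD.
Qed.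

Definition mean_le (f : T -> R) (C : R) : Prop := exists2 c, c <= C & has_mean f c.

Lemma mean_leD f g a b : mean_le f a -> mean_le g b -> mean_le (fun w => f w + g w) (a + b).
Proof. by move=> [x hx fx] [y hy gy]; exists (x + y); [exact: lerD | exact: has_meanD]. Qed.

Lemma mean_leZ k f a : 0 <= k -> mean_le f a -> mean_le (fun w => k * f w) (k * a).
Proof. by move=> k0 [x hx fx]; exists (k * x); [exact: ler_wpM2l | exact: has_meanZ]. Qed.

Lemma mean_le_sum (I : Type) (s : seq I) (f : I -> T -> R) (a : R) :
  (forall i, mean_le (f i) a) ->
  mean_le (fun w => \sum_(i <- s) f i w) ((size s)%:R * a).
Proof.
move=> h; elim: s => [|i s IH].
  exists 0; first by rewrite mul0r.
  apply: (@has_mean_ext (cst 0)); last exact: has_mean_cst.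
  by move=> w; rewrite big_nil.
have -> : (size (i :: s))%:R * a = a + (size s)%:R * a by rewrite /= -[(size s).+1]add1n natrD mulrDl mul1r.
by have [c h1 h2] := mean_leD (h i) IH; exists c => //; apply: has_mean_ext h2 => w; rewrite big_cons.
Qed.

Definition orth (X : nat -> T -> R) (C : R) : Prop :=
  (forall k, mean_le (fun w => X k w ^+ 2) C) /\
  (forall k l, k != l -> has_mean (fun w => X k w * X l w) 0).

Lemma orth_shift X C k0 : orth X C -> orth (fun k => X (k0 + k)%N) C.
Proof. by move=> [h1 h2]; split=> // k l kl; apply: h2; rewrite eqn_add2l. Qed.

Lemma orth_sum X C n : orth X C -> mean_le (fun w => (\sum_(0 <= k < n) X k w) ^+ 2) (n%:R * C).
Proof.
move=> [h1 h2]; elim: n => [|n IH].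
  exists 0; first by rewrite mul0r.
  apply: (@has_mean_ext (cst 0)); last exact: has_mean_cst.
  by move=> w; rewrite big_nil expr0n.
have hc : has_mean (fun w => \sum_(0 <= k < n) X k w * X n w) 0.
  suff: has_mean (fun w => \sum_(k <- iota 0 n) (if k == n then 0 else X k w * X n w))
      (\sum_(k <- iota 0 n) 0).
    rewrite big1 //; apply: has_mean_ext => w; rewrite [RHS]big_nat -[index_iota 0 n]/(iota 0 (n - 0)) subn0.
    rewrite big_seq [RHS]big_seq_cond; apply: eq_big => k; rewrite mem_iota /= add0n ?andbT //.
      by case: (k < n)%N.
    by move=> kn; rewrite ltn_eqF.
  apply: has_mean_sum => k; case: eqVneq => [_|kn]; first exact: has_mean_cst.
  exact: h2.
have [c h3 h4] := mean_leD IH (h1 n); exists c.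
  by rewrite -addn1 natrD mulrDl mul1r.
have := has_meanD h4 (has_meanZ 2 hc); rewrite mulr0 addr0; apply: has_mean_ext => w.
by rewrite big_nat_recr //= -mulr_suml; ring.
Qed.

End Mean.

(* Dyadic sums of squares, as in the Rademacher-Menshov inequality. *)
Fixpoint dyadicQ (R : pzRingType) (m : nat) (x : nat -> R) : R :=
  if m is m'.+1 then
    (\sum_(0 <= t < 2 ^ m) x t) ^+ 2 + dyadicQ m' x + dyadicQ m' (fun t => x (2 ^ m' + t)%N)
  else x 0%N ^+ 2.

Lemma dyadicQ_ge0 (R : realDomainType) m (x : nat -> R) : 0 <= dyadicQ m x.
Proof. by elim: m x => [|m IH] x /=; [exact: sqr_ge0 | rewrite !addr_ge0 ?sqr_ge0]. Qed.

Lemma dyadicQ_full (R : realDomainType) m (x : nat -> R) :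
  (\sum_(0 <= t < 2 ^ m) x t) ^+ 2 <= dyadicQ m x.
Proof.
case: m => [|m]; first by rewrite big_nat1.
by rewrite /= -addrA lerDl addr_ge0 ?dyadicQ_ge0.
Qed.

(** Beyond the midpoint, a partial sum is the full left half [a] plus a partial right half [b]. The
    weighted inequality [(m+1) (a+b)^2 <= (m+2) ((m+1) a^2 + b^2)], whose defect is
    [((m+1) a - b)^2], makes the factor grow only by one per level. *)
Lemma dyadicQ_max (R : realFieldType) m N (x : nat -> R) : (N <= 2 ^ m)%N ->
  (\sum_(0 <= t < N) x t) ^+ 2 <= m.+1%:R * dyadicQ m x.
Proof.
elim: m N x => [|m IH] N x hN.
  rewrite mul1r; case: N hN => [|[|]] // _; last by rewrite big_nat1.
  by rewrite big_nil expr0n sqr_ge0.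
have q1 := dyadicQ_ge0 m x; have q2 := dyadicQ_ge0 m (fun t => x (2 ^ m + t)%N).
have q3 := sqr_ge0 (\sum_(0 <= t < 2 ^ m.+1) x t).
have m0 : 0 <= m%:R :> R by [].
have -> : dyadicQ m.+1 x = (\sum_(0 <= t < 2 ^ m.+1) x t) ^+ 2 + dyadicQ m x +
   dyadicQ m (fun t => x (2 ^ m + t)%N) by [].
have -> : m.+2%:R = m%:R + 2 :> R by rewrite -addn2 natrD.
have mS : m.+1%:R = m%:R + 1 :> R by rewrite -addn1 natrD.
have [h|h] := leqP N (2 ^ m).
  by have := IH N x h; rewrite mS; nra.
rewrite (@big_cat_nat _ _ _ (2 ^ m)) //=; last exact: ltnW.
rewrite -{2}[(2 ^ m)%N]add0n big_addn.
under [X in _ + X]eq_bigr do rewrite addnC.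
have h2 : (N - 2 ^ m <= 2 ^ m)%N by rewrite leq_subLR addnn -mul2n -expnS.
have := IH _ (fun t => x (2 ^ m + t)%N) h2; have := dyadicQ_full m x; rewrite mS.
set a := \sum_(0 <= t < 2 ^ m) _; set b := \sum_(0 <= t < N - _) _.
move=> ha hb.
have key : (m%:R + 1) * (a + b) ^+ 2 <= (m%:R + 2) * ((m%:R + 1) * a ^+ 2 + b ^+ 2).
  have := sqr_ge0 ((m%:R + 1) * a - b); nra.
have : (m%:R + 1) * (a + b) ^+ 2 <= (m%:R + 1) * ((m%:R + 2) * (dyadicQ m x + dyadicQ m (fun t => x (2 ^ m + t)%N))).
  apply: (le_trans key); nra.
rewrite ler_pM2l; last by lra.
nra.
Qed.

(** Each of the [m + 1] levels of the dyadic tree consists of disjoint blocks of total length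
    [2^m]. *)
Lemma orth_dyadicQ (R : realType) d (T : measurableType d) (P : probability T R)
    (X : nat -> T -> R) (C : R) m : orth P X C ->
  mean_le P (fun w => dyadicQ m (X ^~ w)) (m.+1%:R * 2 ^+ m * C).
Proof.
elim: m X => [|m IH] X h.
  by rewrite expr0 !mul1r; apply: (proj1 h).
have -> : m.+2%:R * 2 ^+ m.+1 * C =
    ((2 ^ m.+1)%:R * C + (m.+1%:R * 2 ^+ m * C)) + (m.+1%:R * 2 ^+ m * C).
  by rewrite natrX exprS -[m.+2]addn1 natrD; ring.
apply: mean_leD; last by have := IH _ (orth_shift (2 ^ m)%N h).
by apply: mean_leD; [exact: orth_sum | exact: IH].
Qed.

(** The quotient [(4j+1)^2 (2/3)^j] peaks at [j = 5], below 60; from there on a step multiplies the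
    square by at most 3/2. *)
Lemma poly_exp_bound j : ((4 * j).+1 ^ 2 * 2 ^ j <= 60 * 3 ^ j)%N.
Proof.
elim: j => [|j IH] //; have [h|h] := ltnP j 5.
  by move: h {IH}; do 5![case: j => [|j] //].
rewrite !expnS; have : (0 < 3 ^ j)%N by rewrite expn_gt0.
have : (2 * (4 * j.+1).+1 ^ 2 <= 3 * (4 * j).+1 ^ 2)%N by rewrite !expnS !expn0; nia.
move: IH; set p := (3 ^ j)%N; set q := (2 ^ j)%N; nia.
Qed.

Section Maximal.
Context (R : realType) d (T : measurableType d) (P : probability T R).
Variables (X : nat -> nat -> T -> R) (C : R).
Hypothesis hX : forall c, orth P (X c) C.

(* For 16^(j-1) < N <= 16^j and J^4 <= N, J^2 S^2 <= 256 N^2 Y_j for all partial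
   sums S up to N and all lags up to 4 J, while E Y_j is summable. *)
Let Y j w : R := 64 ^- j * ((4 * j).+1%:R * \sum_(0 <= c < (4 * 2 ^ j).+1) dyadicQ (4 * j) ((X c) ^~ w)).

Let Y_ge0 j w : 0 <= Y j w.
Proof.
by rewrite mulr_ge0 ?invr_ge0 ?exprn_ge0 // mulr_ge0 // sumr_ge0 // => c _; exact: dyadicQ_ge0.
Qed.

Let C_ge0 : 0 <= C.
Proof.
have [c hc [_ h2]] := (proj1 (hX 0%N)) 0%N; apply: le_trans hc.
by rewrite -lee_fin -h2; apply: integral_ge0 => w _; rewrite lee_fin sqr_ge0.
Qed.

(** The exponential factors give [2^j * 16^j / 64^j = 2^-j], and the logarithmic factor [(4j+1)^2]
    is absorbed in passing to [(3/4)^j]; here [300 = 5 * 60]. *)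
Let Y_mean j : mean_le P (Y j) (300 * C * (3 / 4) ^+ j).
Proof.
have h : mean_le P (Y j) (64 ^- j * ((4 * j).+1%:R * ((4 * 2 ^ j).+1%:R * ((4 * j).+1%:R * 2 ^+ (4 * j) * C)))).
  apply: mean_leZ; first by rewrite invr_ge0 exprn_ge0.
  apply: mean_leZ => //.
  have := @mean_le_sum _ _ _ P _ (index_iota 0 (4 * 2 ^ j).+1) (fun c w => dyadicQ (4 * j) ((X c) ^~ w))
    _ (fun c => orth_dyadicQ (4 * j) (hX c)).
  by rewrite size_iota subn0.
case: h => c hc h; exists c => //; apply: le_trans hc _.
rewrite exprM; have -> : 2 ^+ 4 = 16 :> R by ring.
have h1 : (4 * 2 ^ j).+1%:R <= 5 * 2 ^+ j :> R.
  rewrite -natrX -natrM ler_nat; have : (0 < 2 ^ j)%N by rewrite expn_gt0.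
  lia.
have h2 : (4 * j).+1%:R ^+ 2 * 2 ^+ j <= 60 * 3 ^+ j :> R.
  by rewrite -!natrX -!natrM ler_nat poly_exp_bound.
have p16 : 0 < 16 ^+ j :> R by rewrite exprn_gt0.
have p4 : 0 < 4 ^+ j :> R by rewrite exprn_gt0.
have -> : 64 ^+ j = 16 ^+ j * 4 ^+ j :> R by rewrite -exprMn -natrM.
rewrite expr_div_n.
set a := (4 * j).+1%:R; set D := (4 * 2 ^ j).+1%:R.
have -> : (16 ^+ j * 4 ^+ j)^-1 * (a * (D * (a * 16 ^+ j * C))) = (4 ^+ j)^-1 * C * (a ^+ 2 * D).
  by field; rewrite !gt_eqF.
have -> : 300 * C * (3 ^+ j / 4 ^+ j) = (4 ^+ j)^-1 * C * (300 * 3 ^+ j).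
  by field; rewrite !gt_eqF.
rewrite ler_wpM2l ?mulr_ge0 ?invr_ge0 ?(ltW p4) //.
have : a ^+ 2 * D <= a ^+ 2 * (5 * 2 ^+ j) by rewrite ler_wpM2l ?sqr_ge0.
move: h2; rewrite -/a; lra.
Qed.

(** A nonnegative series with finite expectation converges almost surely, so its terms tend to 0;
    [1200 = 300 * 4] sums the geometric series. *)
Let Y_cvg : {ae P, forall w, (Y ^~ w) @ \oo --> (0 : R)}.
Proof.
have mY j : measurable_fun setT ((EFin \o Y j) : T -> \bar R).
  by have [c _ [/measurable_int]] := Y_mean j.
have Y0 j w : setT w -> (0 <= (EFin \o Y j) w)%E by move=> _; rewrite lee_fin.
pose f w : \bar R := (\sum_(0 <= j <oo) (Y j w)%:E)%E.
have mf : measurable_fun setT (f : T -> \bar R).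
  exact: (@ge0_emeasurable_sum _ _ _ setT (fun j w => (Y j w)%:E) xpredT (fun j w h _ => Y0 j w h)
     (fun j _ => mY j)).
have hi : (\int[P]_w f w <= (1200 * C)%:E)%E.
  rewrite (integral_nneseries P measurableT mY Y0).
  apply: lime_le; first by apply: is_cvg_nneseries => j _ _; apply: integral_ge0 => w _; rewrite lee_fin; exact: Y_ge0.
  near=> n; apply: (@le_trans _ _ (\sum_(0 <= j < n) (300 * C * (3 / 4) ^+ j)%:E)%E).
    by apply: lee_sum => j _; have [c hc [_ ->]] := Y_mean j; rewrite lee_fin.
  rewrite sumEFin lee_fin -mulr_sumr.
  have -> : \sum_(0 <= j < n) (3 / 4 : R) ^+ j = 4 * (1 - (3 / 4) ^+ n).
    elim: (n) => [|k IH]; first by rewrite big_nil expr0 subrr mulr0.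
    by rewrite big_nat_recr //= IH exprS; field.
  have := @exprn_ge0 R n (3 / 4); have h4 : 0 <= C * (3 / 4 ) ^+ n by rewrite mulr_ge0 ?exprn_ge0.
  by move=> _; lra.
have fi : P.-integrable setT f.
  apply/integrableP; split=> //; under eq_integral => w _.
    rewrite gee0_abs; last by apply: nneseries_ge0 => *; rewrite lee_fin; exact: Y_ge0.
    over.
  by apply: le_lt_trans hi _; rewrite ltry.
have := integrable_ae measurableT fi; apply: filterS => w /(_ I) hw.
have hb : cvgn (series (Y ^~ w)).
  apply: nondecreasing_is_cvgn; first by apply: nondecreasing_series.
  exists (fine (f w)) => _ [n _ <-]; rewrite -lee_fin fineK // /series /= -sumEFin.
  by apply: nneseries_lim_ge => j _ _; rewrite lee_fin; exact: Y_ge0.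
exact: cvg_series_cvg_0.
Unshelve. all: by end_near.
Qed.

Lemma orth_strong_law :
  {ae P, forall w, forall kappa : R, 0 < kappa -> exists N0, forall N, (N0 <= N)%N ->
    forall N', (N' <= N)%N -> forall J, (J ^ 4 <= N)%N -> forall c, (c <= 4 * J)%N ->
      J%:R * `|\sum_(0 <= t < N') X c t w| <= kappa * N%:R}.
Proof.
apply: filterS Y_cvg => w hw kappa k0.
have e0 : 0 < kappa ^+ 2 / 256 by apply: divr_gt0; [exact: exprn_gt0 | rewrite ltr0n].
have [j0 _ hj0] : \forall j \near \oo, Y j w <= kappa ^+ 2 / 256.
  exact: (cvgr_le _ hw _ e0).
exists (16 ^ j0)%N.+1 => N hN N' hN' J hJ c hc.
have N1 : (1 < N)%N by apply: leq_trans hN; rewrite ltnS expn_gt0.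
(* Base 16 is the fourth power of 2, so [J^4 <= N <= 16^j] gives [J <= 2^j]. *)
pose j := up_log 16 N; have /andP[hj1 hj2] := up_log_bounds (isT : 1 < 16)%N N1.
rewrite -/j in hj1 hj2.
have jp : (0 < j)%N by rewrite up_log_gt0.
have jj : (j0 <= j)%N by rewrite -(@leq_exp2l 16) //; apply: leq_trans hj2; exact: ltnW.
have hJ2 : (J <= 2 ^ j)%N.
  by rewrite -(@leq_exp2r _ _ 4) // -expnM mulnC expnM; apply: leq_trans hJ _.
have hY := hj0 j jj.
have hS : (\sum_(0 <= t < N') X c t w) ^+ 2 <= 64 ^+ j * Y j w.
  rewrite /Y mulrA mulfV ?expf_neq0 // mul1r.
  apply: le_trans (@dyadicQ_max _ (4 * j) _ _ _) _.
    by rewrite expnM; exact: leq_trans hN' _.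
  rewrite ler_wpM2l // (bigD1_seq c) ?mem_index_iota ?iota_uniq //=.
    by rewrite lerDl sumr_ge0 // => i _; exact: dyadicQ_ge0.
  by rewrite ltnS (leq_trans hc) // leq_mul2l hJ2 orbT.
have hN16 : (16 ^+ j : R) <= 16 * N%:R.
  by rewrite -natrX -natrM ler_nat -(prednK jp) expnS leq_mul2l; apply/orP; right; exact: ltnW.
rewrite -(@ler_pXn2r _ 2) ?nnegrE ?mulr_ge0 // ?(ltW k0) //.
rewrite !exprMn real_normK ?num_real //.
apply: (@le_trans _ _ ((2 ^+ j) ^+ 2 * (64 ^+ j * (kappa ^+ 2 / 256)))).
  apply: ler_pM; rewrite ?sqr_ge0 //; first by rewrite ler_pXn2r ?nnegrE // -natrX ler_nat.
  by apply: le_trans hS _; rewrite ler_wpM2l // exprn_ge0.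
have -> : (2 ^+ j) ^+ 2 * (64 ^+ j * (kappa ^+ 2 / 256)) = (16 ^+ j) ^+ 2 * (kappa ^+ 2 / 256).
  rewrite mulrA; congr (_ * _); rewrite exprAC -exprMn [RHS]exprAC; congr (_ ^+ _); ring.
have : ((16 : R) ^+ j) ^+ 2 <= (16 * N%:R) ^+ 2 by rewrite ler_pXn2r ?nnegrE ?exprn_ge0.
rewrite exprMn => h; have k2 := exprn_ge0 2 (ltW k0).
have -> : kappa ^+ 2 * N%:R ^+ 2 = (16 ^+ 2 * N%:R ^+ 2) * (kappa ^+ 2 / 256) by field.
by rewrite ler_wpM2r ?(ltW e0).
Qed.

End Maximal.

Import HBNNSimple.

(** * Conditionally centred variables *)

Section CondExp.
Context (R : realType) d (T : measurableType d) (P : probability T R).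
Variable G : set (set T).
Hypothesis hG : <<s G>> `<=` (@measurable d T).

(** A copy of the sample space carries the smaller sigma-algebra, so that closure properties and
    approximation by simple functions apply to it directly. *)
Definition gmeas (Y : T -> R) : Prop :=
  measurable_fun (setT : set (g_sigma_algebraType G)) (Y : g_sigma_algebraType G -> R).

Lemma gmeasP (Y : T -> R) : gmeas Y <-> (forall U : set R, measurable U -> <<s G>> (Y @^-1` U)).
Proof.
split=> [h U mU|h _ U mU]; last by rewrite setTI; exact: h.
by have := h measurableT U mU; rewrite setTI.
Qed.

Lemma gmeas_measurable (Y : T -> R) : gmeas Y -> measurable_fun (setT : set T) Y.
Proof. by move=> /gmeasP h _ U mU; rewrite setTI; apply: hG; exact: h. Qed.

Variable X : T -> R.
Hypothesis hX : P.-integrable setT (EFin \o X).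
Hypothesis hX0 : forall E, <<s G>> E -> (\int[P]_(w in E) (X w)%:E = 0)%E.

Let simple_mean (g : {nnsfun (g_sigma_algebraType G) >-> R}) : has_mean P (fun w => X w * g w) 0.
Proof.
have [A hA] : exists A : seq R, forall w, g w = \sum_(y <- A) y * \1_(g @^-1` [set y]) w.
  eexists => w; rewrite {1}(fimfunE g w) fsbig_finite //=; exact: fimfunP.
apply: (@has_mean_ext _ _ _ _ (fun w => \sum_(y <- A) y * (X w * \1_(g @^-1` [set y]) w))).
  move=> w; rewrite [in RHS]hA mulr_sumr; apply: eq_bigr => y _; ring.
suff h y : has_mean P (fun w => X w * \1_(g @^-1` [set y]) w) 0.
  have := has_mean_sum A (fun y => has_meanZ y (h y)).
  by rewrite [X in has_mean _ _ X]big1 // => y _; rewrite mulr0.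
have mE : <<s G>> (g @^-1` [set y]).
  have := @measurable_funPT _ _ _ _ g measurableT [set y] (measurable_set1 y); by rewrite setTI.
set E := g @^-1` [set y] in mE *.
have mE' : d.-measurable E by exact: hG.
have hr : (EFin \o (fun w => X w * \1_E w)) = ((EFin \o X) \_ E).
  apply/funext => w /=; rewrite /patch indicE; case: (w \in E) => //=; by rewrite ?mulr1 ?mulr0.
split.
  rewrite hr; apply/(integrable_mkcond (EFin \o X) mE').
  exact: (integrableS measurableT mE' (@subsetT _ E) hX).
have <- : (\int[P]_(w in E) (X w)%:E = 0%:E)%E by exact: hX0.
rewrite [RHS]integral_mkcond; apply: eq_integral => w _.
by have := congr1 (@^~ w) hr.
Qed.

(** Simple functions increasing to [Y] give products dominated by [|X Y|], so it is the
    integrability of the product that matters. *)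
Let nonneg_mean (Y : T -> R) : gmeas Y -> (forall w, 0 <= Y w) ->
  P.-integrable setT (EFin \o (fun w => X w * Y w)) -> has_mean P (fun w => X w * Y w) 0.
Proof.
move=> mY Y0 hXY; split=> //.
have mY' : measurable_fun (setT : set (g_sigma_algebraType G)) (EFin \o (Y : g_sigma_algebraType G -> R)).
  exact/measurable_EFinP.
have Y0' t : (setT : set (g_sigma_algebraType G)) t -> (0 <= (EFin \o (Y : g_sigma_algebraType G -> R)) t)%E.
  by move=> _; rewrite lee_fin.
have [g [g1 g2]] := approximation measurableT mY' Y0'.
have gr w : (fun n => g n w) @ \oo --> Y w by exact: (fine_cvg (g2 w I)).
have hg n w : 0 <= g n w <= Y w.
  rewrite fun_ge0 /= -(cvg_lim (@Rhausdorff R) (gr w)).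
  apply: nondecreasing_cvgn_le; last exact: cvgP (gr w).
  by move=> k l kl; have /lefP := g1 k l kl; apply.
have hi : P.-integrable setT (abse \o (EFin \o (fun w => X w * Y w))) by exact: integrable_abse.
have := @dominated_convergence _ _ _ P setT measurableT
  (fun n w => (X w * g n w)%:E) (fun w => (X w * Y w)%:E) (abse \o (EFin \o (fun w => X w * Y w))).
case.
- by move=> n; have [/measurable_int] := simple_mean (g n).
- exact: measurable_int hXY.
- apply: aeW => w _; apply: cvg_EFin; first exact: nearW.
  apply: cvgMr; exact: gr.
- exact: hi.
- apply: aeW => w n _; rewrite /= lee_fin !normrM; apply: ler_wpM2l => //.
  by have /andP[h1 h2] := hg n w; rewrite !ger0_norm // (le_trans h1).
move=> _ _; rewrite (_ : [sequence _]_n = cst 0%E); last first.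
  by apply/funext => n /=; have [_ ->] := simple_mean (g n).
move=> h; exact: (cvg_unique _ h (cvg_cst _)).
Qed.

(** The pull-out property when [E(X | G) = 0], the latter being expressed by integrals over events.
    It serves for the noise against its past and also for independence. *)
Lemma cond_mean0_mul (Y : T -> R) : gmeas Y ->
  P.-integrable setT (EFin \o (fun w => X w * Y w)) -> has_mean P (fun w => X w * Y w) 0.
Proof.
move=> mY hXY.
have h (Z : T -> R) : gmeas Z -> (forall w, 0 <= Z w <= `|Y w|) -> has_mean P (fun w => X w * Z w) 0.
  move=> mZ hZ; apply: nonneg_mean => //; first by move=> w; have /andP[] := hZ w.
  apply: (le_integrable measurableT _ _ hXY).
    apply/measurable_EFinP; apply: measurable_funM; last exact: gmeas_measurable.
    by have /measurable_int/measurable_EFinP := hX.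
  move=> w _ /=; rewrite lee_fin !normrM ler_wpM2l //.
  by have /andP[h1 h2] := hZ w; rewrite ger0_norm.
have h1 := h (fun w => Num.max (Y w) 0) _ _; have h2 := h (fun w => Num.max (- Y w) 0) _ _.
apply: (@has_mean_ext _ _ _ _ (fun w => X w * Num.max (Y w) 0 + (-1) * (X w * Num.max (- Y w) 0))).
  move=> w; case: (lerP 0 (Y w)) => hy.
    by rewrite (max_idPr _) ?oppr_le0 //; ring.
  by rewrite (max_idPl _) ?oppr_ge0 ?(ltW hy) //; ring.
suff [k1 k2] : has_mean P (fun w => X w * Num.max (Y w) 0) 0 /\
    has_mean P (fun w => X w * Num.max (- Y w) 0) 0.
  by have := has_meanD k1 (has_meanZ (-1) k2); rewrite mulr0 addr0.
split; [apply: h1 | apply: h2].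
- exact: (measurable_maxr mY (measurable_cst _)).
- by move=> w; rewrite le_max lexx orbT /= ge_max ler_norm /=.
- exact: (measurable_maxr (measurableT_comp (@oppr_measurable R setT) mY) (measurable_cst _)).
- by move=> w; rewrite le_max lexx orbT /= ge_max normr_ge0 andbT -normrN ler_norm.
Qed.

End CondExp.

Section Moments.
Context (R : realType) d (T : measurableType d) (P : probability T R).

Lemma integrable_dom (f g : T -> R) (c : R) : measurable_fun setT f ->
  (forall w, `|f w| <= g w) -> has_mean P g c -> P.-integrable setT (EFin \o f).
Proof.
move=> mf hfg [ig _]; apply: (le_integrable measurableT _ _ ig); first exact/measurable_EFinP.
by move=> w _ /=; rewrite lee_fin; apply: le_trans (hfg w) (ler_norm _).
Qed.

Lemma has_meanE (f : T -> R) : P.-integrable setT (EFin \o f) -> exists c, has_mean P f c.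
Proof.
move=> hf; exists (fine (\int[P]_w (f w)%:E)%E); split=> //.
by rewrite fineK //; exact: integrable_fin_num.
Qed.

Lemma mean_le_dom (f g : T -> R) (c : R) : measurable_fun setT f ->
  (forall w, `|f w| <= g w) -> mean_le P g c -> mean_le P f c.
Proof.
move=> mf hfg [c' cc' hg]; have hf := integrable_dom mf hfg hg.
have [b hb] := has_meanE hf; exists b => //; apply: le_trans cc'.
have [_ h1] := hb; have [h2 h3] := hg; rewrite -lee_fin -h1 -h3.
by apply: le_integral => // w _; rewrite lee_fin; apply: le_trans (hfg w); exact: ler_norm.
Qed.

Definition L4 (f : T -> R) : Prop :=
  measurable_fun setT f /\ exists c, mean_le P (fun w => f w ^+ 4) c.

Lemma L4_cst a : L4 (cst a).
Proof. split; first exact: measurable_cst.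
by exists (a ^+ 4), (a ^+ 4) => //; exact: (has_mean_cst P (a ^+ 4)). Qed.

Lemma prod4_le (a b c e : R) : `|a * b * c * e| <= a ^+ 4 + b ^+ 4 + c ^+ 4 + e ^+ 4.
Proof.
have h (x y : R) : `|x * y| <= x ^+ 2 + y ^+ 2 by exact: norm_mul_le.
apply: (@le_trans _ _ (`|(a * b) * (c * e)|)); first by rewrite !mulrA.
apply: le_trans (h _ _) _.
have s (x y : R) : (x * y) ^+ 2 <= x ^+ 4 + y ^+ 4.
  rewrite exprMn; have := h (x ^+ 2) (y ^+ 2); rewrite -!exprM ger0_norm //.
  by rewrite mulr_ge0 ?sqr_ge0.
by rewrite -addrA; apply: lerD; exact: s.
Qed.

Lemma L4_prod (a b c e : T -> R) : L4 a -> L4 b -> L4 c -> L4 e ->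
  P.-integrable setT (EFin \o (fun w => a w * b w * c w * e w)).
Proof.
move=> [ma [xa [? _ ha]]] [mb [xb [? _ hb]]] [mc [xc [? _ hc]]] [me [xe [? _ he]]].
apply: (integrable_dom (c := _) _ (fun w => prod4_le (a w) (b w) (c w) (e w))).
  by do 3![apply: measurable_funM => //].
exact: has_meanD (has_meanD (has_meanD ha hb) hc) he.
Qed.

Lemma L4_prod2 (a b : T -> R) : L4 a -> L4 b -> P.-integrable setT (EFin \o (fun w => a w * b w)).
Proof.
move=> ha hb; have := L4_prod ha hb (L4_cst 1) (L4_cst 1).
by congr (_.-integrable _ _); apply/funext => w /=; rewrite !mulr1.
Qed.

End Moments.

Section Generated.
Context (R : realType) d (T : measurableType d) (P : probability T R).

Definition sgen (D : set (T -> R)) : set (set T) :=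
  [set E | exists2 X, D X & exists2 U : set R, measurable U & E = X @^-1` U].

Lemma sgen_measurable (D : set (T -> R)) : (forall X, D X -> measurable_fun (setT : set T) X) ->
  <<s sgen D>> `<=` (@measurable d T).
Proof.
move=> h; apply: smallest_sub; first exact: sigma_algebra_measurable.
move=> _ [X DX [U mU ->]]; by have := h X DX measurableT U mU; rewrite setTI.
Qed.

Lemma gmeas_gen (D : set (T -> R)) X : D X -> gmeas (sgen D) X.
Proof.
by move=> DX; apply/gmeasP => U mU; apply: sub_sigma_algebra; exists X => //; exists U.
Qed.

Lemma cond_exp_mean0 (D : set (T -> R)) (X Y : T -> R) (c : R) :
  (forall X, D X -> measurable_fun (setT : set T) X) ->
  is_cond_exp P (sigma_gen D) X (cst c) -> gmeas (sgen D) Y ->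
  P.-integrable setT (EFin \o (fun w => (X w - c) * Y w)) ->
  has_mean P (fun w => (X w - c) * Y w) 0.
Proof.
move=> hD [h1 h2 h3 h4] mY hi; have hG := sgen_measurable hD.
apply: (@cond_mean0_mul _ _ _ _ _ hG (fun w => X w - c)) => //.
  exact: (integrableB measurableT h1 h2).
move=> E hE; have mE := hG _ hE.
have j1 := integrableS measurableT mE (@subsetT _ E) h1.
have j2 := integrableS measurableT mE (@subsetT _ E) h2.
under eq_integral => w _ do rewrite EFinB.
rewrite (integralB mE j1 j2) (h4 _ hE) subee //.
exact: integrable_fin_num.
Qed.

End Generated.

(** * Orthogonality of the noise products *)

Lemma gmeasM (R : realType) (d : measure_display) (U : measurableType d) (G : set (set U)) (X Y : U -> R) :
  gmeas G X -> gmeas G Y -> gmeas G (fun w => X w * Y w).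
Proof. exact: measurable_funM. Qed.

Lemma gmeasBc (R : realType) (d : measure_display) (U : measurableType d) (G : set (set U)) (X : U -> R) c :
  gmeas G X -> gmeas G (fun w => X w - c).
Proof. by move=> h; apply: (measurable_funB h (measurable_cst _)). Qed.

Section Families.
Context (R : realType) d (T : measurableType d) (P : probability T R) (nu : nat).
Variables (u r : int -> T -> 'cV[R]_nu) (e : int -> T -> 'cV[R]_1) (sigma_e : R).
Hypothesis (mu : random_signal u) (mr : random_signal r) (me : random_signal e).
Hypothesis hN : noise_assumption P u e sigma_e.
Hypothesis hI : independent_sigma P (sigma_signal r) (sigma_signal e).

Let eps (k : int) (w : T) : R := e k w 0 0.

(** [x^4 <= 1 + x^10] turns the bound on tenth moments into one on fourth moments, which control the
    second moments of noise products. *)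
Let eps4 : exists2 C4, 0 <= C4 & forall k, mean_le P (fun w => eps k w ^+ 4) C4.
Proof.
have [_ _ [c hc]] := hN.
have e10 k : has_mean P (fun w => eps k w ^+ 10) (fine ('E_P[(fun w => normF (e k w) ^+ 10)%R])%E)
   /\ (fine ('E_P[(fun w => normF (e k w) ^+ 10)%R])%E) <= c.
  have hE : (fun w => normF (e k w) ^+ 10) = (fun w => eps k w ^+ 10).
    apply/funext => w; rewrite -[10%N]/(2 * 5)%N !exprM normF_sqr sqnE.
    by rewrite !big_ord1.
  have := hc k; rewrite hE unlock => hk.
  have h0 : (0 <= \int[P]_w (eps k w ^+ 10)%:E)%E.
    by apply: integral_ge0 => w _; rewrite lee_fin (exprM _ 2 5) exprn_ge0 // sqr_ge0.
  have hf : (\int[P]_w (eps k w ^+ 10)%:E)%E \is a fin_num.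
    by rewrite ge0_fin_numE // (le_lt_trans hk) // ltry.
  split; last by rewrite -lee_fin fineK.
  split; last by rewrite fineK.
  apply/integrableP; split.
    by apply/measurable_EFinP; apply: measurable_funX; exact: me.
  under eq_integral => w _.
    rewrite gee0_abs; last by rewrite lee_fin (exprM _ 2 5) exprn_ge0 // sqr_ge0.
    over.
  by apply: le_lt_trans hk _; rewrite ltry.
have c0 : 0 <= c.
  have [[_ h1] h2] := e10 0; apply: le_trans h2; rewrite -lee_fin -h1.
  by apply: integral_ge0 => w _; rewrite lee_fin (exprM _ 2 5) exprn_ge0 // sqr_ge0.
exists (1 + c); first by rewrite addr_ge0.
move=> k; apply: (mean_le_dom (g := fun w => 1 + eps k w ^+ 10)).
- by apply: measurable_funX; exact: me.
- move=> w; rewrite ger0_norm; last by rewrite (exprM _ 2 2) sqr_ge0.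
  rewrite (exprM _ 2 2) (exprM _ 2 5); set x := eps k w ^+ 2.
  have x0 : 0 <= x by exact: sqr_ge0.
  have [hx|hx] := lerP x 1.
    have h2 : x ^+ 2 <= 1 by exact: exprn_ile1.
    have h5 := exprn_ge0 5 x0; lra.
  have h25 : x ^+ 2 <= x ^+ 5 by rewrite ler_eXn2l.
  lra.
- have [h1 h2] := e10 k; exists (1 + fine ('E_P[(fun w => normF (e k w) ^+ 10)%R])%E).
    by rewrite lerD2l.
  exact: (has_meanD (has_mean_cst P 1) h1).
Qed.

Let L4eps k : L4 P (eps k).
Proof. by split; [exact: me | have [C _ h] := eps4; exists C]. Qed.

Let past k : set (T -> R) :=
  [set X | exists2 j : int, j <= k - 1 &
     (exists i, X = fun w => e j w i 0) \/ (exists i, X = fun w => u j w i 0)].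

Let past_meas k X : past k X -> measurable_fun (setT : set T) X.
Proof. by move=> [j _ [[i ->]|[i ->]]]; [exact: me | exact: mu]. Qed.

Let past_eps k j : j <= k - 1 -> gmeas (sgen (past k)) (eps j).
Proof. by move=> jk; apply: gmeas_gen; exists j => //; left; exists 0. Qed.

Let noise_mul k (Y : T -> R) : gmeas (sgen (past k)) Y ->
  P.-integrable setT (EFin \o (fun w => eps k w * Y w)) -> has_mean P (fun w => eps k w * Y w) 0.
Proof.
move=> mY hi; have [h _ _] := hN.
have h2 := @cond_exp_mean0 _ _ _ P _ _ Y 0 (past_meas (k := k)) (h k) mY.
have hE : (fun w => (e k w 0 0 - 0) * Y w) = (fun w => eps k w * Y w).
  by apply/funext => w; rewrite subr0.
by rewrite hE in h2; exact: h2.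
Qed.

Let noise_mul2 k (Y : T -> R) : gmeas (sgen (past k)) Y ->
  P.-integrable setT (EFin \o (fun w => (eps k w ^+ 2 - sigma_e ^+ 2) * Y w)) ->
  has_mean P (fun w => (eps k w ^+ 2 - sigma_e ^+ 2) * Y w) 0.
Proof.
move=> mY hi; have [_ h _] := hN.
have h2 := @cond_exp_mean0 _ _ _ P _ _ Y (sigma_e ^+ 2) (past_meas (k := k)) (h k) mY.
have hE : (fun w => ((e k w *m (e k w)^T) 0 0 - sigma_e ^+ 2) * Y w) =
   (fun w => (eps k w ^+ 2 - sigma_e ^+ 2) * Y w).
  by apply/funext => w; rewrite mxE big_ord1 mxE.
by rewrite hE in h2; exact: h2.
Qed.

Lemma noise_uncorrelated (p q : int) : p != q -> has_mean P (fun w => eps p w * eps q w) 0.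
Proof.
wlog qp : p q / q < p.
  move=> h; rewrite neq_lt => /orP[pq|qp]; last by apply: h => //; rewrite gt_eqF.
  apply: has_mean_ext (h q p pq _) => [w|]; [exact: mulrC | by rewrite gt_eqF].
by move=> _; apply: noise_mul; [apply: past_eps; lia | exact: L4_prod2].
Qed.

Definition noise_lag (c : nat) (k : int) (w : T) : R :=
  eps k w * eps (k - c%:Z) w - (c == 0%N)%:R * sigma_e ^+ 2.

Let int_lags (a b c f : int) (s1 s2 : R) :
  P.-integrable setT (EFin \o (fun w => (eps a w * eps b w - s1) * (eps c w * eps f w - s2))).
Proof.
have := integrableD measurableT (integrableD measurableT (integrableD measurableT
   (L4_prod (L4eps a) (L4eps b) (L4eps c) (L4eps f))
   (L4_prod (L4_cst P (- s2)) (L4eps a) (L4eps b) (L4_cst P 1)))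
   (L4_prod (L4_cst P (- s1)) (L4eps c) (L4eps f) (L4_cst P 1)))
   (finite_measure_integrable_cst P (s1 * s2) measurableT).
congr (_.-integrable _ _); apply/funext => w /=; rewrite -!EFinD; congr EFin; ring.
Qed.

(** By symmetry [q < p]. At lag 0 the conditional variance centres [e_p^2 - sigma^2]; at a positive
    lag [e_p] multiplies a variable of its past. *)
Let noise_lag_orth (c : nat) (p q : int) : p != q ->
  has_mean P (fun w => noise_lag c p w * noise_lag c q w) 0.
Proof.
wlog qp : p q / q < p.
  move=> h; rewrite neq_lt => /orP[pq|qp]; last by apply: h => //; rewrite gt_eqF.
  apply: has_mean_ext (h q p pq _) => [w|]; [exact: mulrC | by rewrite gt_eqF].
move=> _; have i1 := int_lags p (p - c%:Z) q (q - c%:Z) ((c == 0%N)%:R * sigma_e ^+ 2) ((c == 0%N)%:R * sigma_e ^+ 2).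
have gm j : j <= p - 1 -> gmeas (sgen (past p)) (noise_lag c j).
  move=> jp; apply: gmeasBc; apply: gmeasM; apply: past_eps; lia.
case: c i1 gm => [|c] i1 gm.
  have hE k w : noise_lag 0 k w = eps k w ^+ 2 - sigma_e ^+ 2.
    by rewrite /noise_lag subr0 mul1r.
  have hF : (fun w => noise_lag 0 p w * noise_lag 0 q w) =
    (fun w => (eps p w ^+ 2 - sigma_e ^+ 2) * noise_lag 0 q w) by apply/funext => w; rewrite hE.
  rewrite hF; apply: noise_mul2; first by apply: gm; lia.
  by rewrite -hF; exact: i1.
have hF : (fun w => noise_lag c.+1 p w * noise_lag c.+1 q w) =
    (fun w => eps p w * (eps (p - c.+1%:Z) w * noise_lag c.+1 q w)).
  by apply/funext => w; rewrite {1}/noise_lag mul0r subr0 mulrA.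
rewrite hF; apply: noise_mul; last by rewrite -hF; exact: i1.
by apply: gmeasM; [apply: past_eps; lia | apply: gm; lia].
Qed.

(** An arbitrary injective enumeration of times covers forward, backward and shifted sums with a
    single constant. *)
Lemma noise_lag_fam : exists C, forall (c : nat) (p : nat -> int), injective p ->
  orth P (fun t => noise_lag c (p t)) C.
Proof.
have [C4 C0 h4] := eps4; pose s := (sigma_e ^+ 2) ^+ 2.
exists (2 * (C4 + C4) + 2 * s) => c p pinj; split; last first.
  by move=> k l kl; apply: noise_lag_orth; apply: contra_neq kl => /pinj.
move=> k; have hs : mean_le P (cst (2 * s)) (2 * s) by exists (2 * s) => //; exact: has_mean_cst.
have hb := mean_leD (mean_leZ (ler0n _ 2) (mean_leD (h4 (p k)) (h4 (p k - c%:Z)))) hs.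
apply: mean_le_dom hb.
  apply: measurable_funX; apply: measurable_funB; last exact: measurable_cst.
  apply: measurable_funM; exact: me.
move=> w; rewrite ger0_norm ?sqr_ge0 // /noise_lag /cst.
set a := eps _ w; set b := eps _ w; set z := _%:R.
have hz : (z * sigma_e ^+ 2) ^+ 2 <= s.
  by rewrite /z /s; case: (c == 0%N); rewrite ?mul1r // mul0r expr0n /= sqr_ge0.
have hab : (a * b) ^+ 2 <= a ^+ 4 + b ^+ 4.
  have := norm_mul_le (lexx ((a ^+ 2) ^+ 2)) (lexx ((b ^+ 2) ^+ 2)).
  by rewrite -exprMn -!exprM ger0_norm ?sqr_ge0 // (exprM _ 1 2) expr1 sqr_ge0.
have := sqr_ge0 (a * b + z * sigma_e ^+ 2); rewrite sqrrB sqrrD !mulr2n.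
lra.
Qed.

Let De : set (T -> R) := [set X | exists k i, X = fun w => e k w i 0].
Let Dr : set (T -> R) := [set X | exists k i, X = fun w => r k w i 0].
Let De_meas X : De X -> measurable_fun (setT : set T) X.
Proof. by move=> [k [i ->]]; exact: me. Qed.
Let Dr_meas X : Dr X -> measurable_fun (setT : set T) X.
Proof. by move=> [k [i ->]]; exact: mr. Qed.

(** The roles are exchanged: by independence, the indicator of [E] minus its probability has zero
    integral over every event generated by [e], so the pull-out property applies to it with [V] as
    factor. *)
Let indicator_mul (V : T -> R) (E : set T) : gmeas (sgen De) V -> has_mean P V 0 ->
  <<s sgen Dr>> E -> (\int[P]_(w in E) (V w)%:E = 0)%E.
Proof.
move=> mV hV hE; have [iV V0] := hV.
have mE : measurable E by exact: (sgen_measurable Dr_meas).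
have V' := gmeas_measurable (sgen_measurable De_meas) mV.
pose c := fine (P E).
have cE : P E = c%:E by rewrite fineK // fin_num_measure.
have c0 : 0 <= c by rewrite -lee_fin -cE.
have iE : P.-integrable setT (EFin \o (\1_E : T -> R)) by exact: integrable_indic.
have ic : P.-integrable setT (EFin \o (cst c : T -> R)) by exact: finite_measure_integrable_cst.
have [b hb] := has_meanE (integrable_abse iV : P.-integrable setT (EFin \o (fun w => `|V w|))).
have h1 : has_mean P (fun w => (\1_E w - c) * V w) 0.
  apply: (@cond_mean0_mul _ _ _ P _ (sgen_measurable De_meas) (fun w => \1_E w - c)) => //.
  - exact: (integrableB measurableT iE ic).
  - move=> F hF; have mF : measurable F by exact: (sgen_measurable De_meas).
    under eq_integral => w _ do rewrite EFinB.
    rewrite (integralB mF (integrableS measurableT mF (@subsetT _ F) iE)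
      (integrableS measurableT mF (@subsetT _ F) ic)).
    rewrite (integral_indic P mF mE) (integral_cst P mF c%:E).
    rewrite [X in (X - _)%E](_ : _ = c%:E * P F)%E; last by rewrite -cE; exact: hI.
    by rewrite subee // fin_numM // fin_num_measure.
  - apply: (integrable_dom _ _ (has_meanZ (1 + c) hb)).
      by apply: measurable_funM => //; apply: measurable_funB; [exact: measurable_indic | exact: measurable_cst].
    move=> w; rewrite normrM ler_wpM2r // (le_trans (ler_normB _ _)) // (ger0_norm c0) lerD2r.
    by rewrite indicE ger0_norm //; case: (w \in E).
have := has_meanD h1 (has_meanZ c hV); rewrite mulr0 addr0 => -[_ h2].
apply: etrans h2; rewrite [LHS]integral_mkcond; apply: eq_integral => w _.
rewrite /patch indicE; case: (w \in E); congr EFin; rewrite /=; ring.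
Qed.

(** The pull-out property once more, now over the sigma-algebra of [r]; no product measure is
    formed. *)
Lemma indep_mul_mean0 (V W : T -> R) (M : R) : gmeas (sgen De) V -> has_mean P V 0 ->
  gmeas (sgen Dr) W -> (forall w, `|W w| <= M) -> has_mean P (fun w => V w * W w) 0.
Proof.
move=> mV hV mW hW; have [iV V0] := hV.
apply: (cond_mean0_mul (sgen_measurable Dr_meas) iV) => //.
  by move=> E hE; exact: indicator_mul.
have [b hb] := has_meanE (integrable_abse iV : P.-integrable setT (EFin \o (fun w => `|V w|))).
apply: (integrable_dom _ _ (has_meanZ M hb)).
  apply: measurable_funM; first exact: (gmeas_measurable (sgen_measurable De_meas) mV).
  exact: (gmeas_measurable (sgen_measurable Dr_meas) mW).
by move=> w; rewrite normrM mulrC ler_wpM2r.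
Qed.

(* Clipping turns the almost sure bound on r into a sure one. *)
Definition clip (M x : R) : R := Num.max (- M) (Num.min M x).

Lemma clip_id M x : `|x| <= M -> clip M x = x.
Proof. by rewrite ler_norml => /andP[h1 h2]; rewrite /clip (min_idPr h2) (max_idPr h1). Qed.

Lemma clip_bd M x : 0 <= M -> `|clip M x| <= M.
Proof.
by move=> M0; rewrite ler_norml /clip le_max lexx /= ge_max ge_min lexx andbT; lra.
Qed.

Definition cross_lag (M : R) (i : 'I_nu) (k l : int) (w : T) : R := eps k w * clip M (r l w i 0).

(** Orthogonality comes from [E e_p e_q = 0] by independence, whatever the bounded factors in [r].
    Hence [l] is arbitrary, while [p] must be injective. *)
Lemma cross_lag_fam (M : R) : 0 <= M -> exists C, forall (i : 'I_nu) (p l : nat -> int), injective p ->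
  orth P (fun t => cross_lag M i (p t) (l t)) C.
Proof.
move=> M0; have [C4 C0 h4] := eps4.
exists (M ^+ 2 * (1 + C4)) => i p l pinj.
have mclip k : gmeas (sgen Dr) (fun w => clip M (r k w i 0)).
  apply: (measurable_maxr (measurable_cst _)).
  apply: (measurable_minr (measurable_cst _)).
  by apply: gmeas_gen; exists k, i.
have mclip' k := gmeas_measurable (sgen_measurable Dr_meas) (mclip k).
split.
  move=> k; have h1 : mean_le P (cst 1 : T -> R) 1 by exists 1 => //; exact: has_mean_cst.
  apply: mean_le_dom (mean_leZ (sqr_ge0 M) (mean_leD h1 (h4 (p k)))).
    by apply: measurable_funX; apply: measurable_funM => //; exact: me.
  move=> w; rewrite /cross_lag ger0_norm ?sqr_ge0 // exprMn mulrC; apply: ler_pM; rewrite ?sqr_ge0 //.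
    by rewrite -[leLHS]real_normK ?num_real // ler_pXn2r ?nnegrE // clip_bd.
  rewrite /cst (exprM _ 2 2); have := sqr_ge0 (eps (p k) w ^+ 2 - 1); rewrite sqrrB.
  have := sqr_ge0 (eps (p k) w); lra.
move=> k m km.
have := @indep_mul_mean0 (fun w => eps (p k) w * eps (p m) w)
  (fun w => clip M (r (l k) w i 0) * clip M (r (l m) w i 0)) (M * M) _ _ _ _.
have hE : (fun w => eps (p k) w * eps (p m) w * (clip M (r (l k) w i 0) * clip M (r (l m) w i 0))) =
  (fun w => cross_lag M i (p k) (l k) w * cross_lag M i (p m) (l m) w).
  by apply/funext => w; rewrite /cross_lag; ring.
rewrite hE; apply.
- by apply: gmeasM; apply: gmeas_gen; [exists (p k), 0 | exists (p m), 0].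
- by apply: noise_uncorrelated; apply: contra_neq km => /pinj.
- by apply: gmeasM.
- by move=> w; rewrite normrM ler_pM // clip_bd.
Qed.

End Families.

(** * Almost sure rates of the sample covariances *)

Lemma window_sum_le (R : realDomainType) (n a b : nat) (p : pred nat) (g : nat -> R) (K : R) :
  (forall t, p t -> (a <= t < b)%N) -> (forall t, `|g t| <= K) ->
  `|\sum_(1 <= t < n | p t) g t| <= (b - a)%:R * K.
Proof.
move=> hp hg; have K0 : 0 <= K by exact: le_trans (hg 0%N).
apply: le_trans (ler_norm_sum _ _ _) _; apply: le_trans (ler_sum _ (fun t _ => hg t)) _.
rewrite big_const_seq iter_addr_0 -[leLHS]mulr_natl ler_wpM2r // ler_nat.
rewrite -size_filter -(size_iota a (b - a)); apply: uniq_leq_size.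
  by apply: filter_uniq; exact: iota_uniq.
by move=> t; rewrite mem_filter => /andP[/hp + _]; rewrite mem_iota; lia.
Qed.

(** With [s = N^(1/4)] one has [ln N = 4 ln s <= 4 s], and all orders of magnitude become powers of
    [s]. *)
Lemma fourth_root (R : realType) (N : nat) : (0 < N)%N -> exists s : R,
  [/\ 0 < s, N%:R = s ^+ 4, ln (N%:R : R) <= 4 * s & forall J, (J ^ 4 <= N)%N -> J%:R <= s].
Proof.
move=> N0; pose s : R := Num.sqrt (Num.sqrt N%:R).
have s0 : 0 < s by rewrite !sqrtr_gt0 ltr0n.
have sN : N%:R = s ^+ 4 by rewrite (exprM _ 2 2) !sqr_sqrtr ?sqrtr_ge0.
exists s; split=> //.
  by rewrite sN lnXn // -[leLHS]mulr_natl ler_wpM2l //; apply: ltW; exact: ln_sublinear.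
by move=> J hJ; rewrite -(@ler_pXn2r _ 4) ?nnegrE // ?(ltW s0) // -sN -natrX ler_nat.
Qed.

(** The error at [N'] is of order [sqrt (N' log N')]; times [J] this is at most of order [s^(7/2)],
    against [N = s^4]. At most [4 J] products have [t - tau] outside the sample, and small [N'] are
    handled by the trivial bound. *)
Lemma quasi_stationary_ucov (R : realType) (q : nat) (v : int -> 'cV[R]_q) (S : int -> 'M[R]_q) (M B : R) :
  quasi_stationary (fun N => Num.sqrt (ln (N%:R : R) / N%:R)) v S ->
  (forall t, normF (v t) <= M) -> (forall tau i j, `|S tau i j| <= B) -> ucov v S.
Proof.
move=> [C1' [C2 [N1 _ hN1]]] hM hB kappa k0.
have M0 : 0 <= M by apply: le_trans (hM 0); exact: normF_ge0.
pose C1 := `|C1'|; have C10 : 0 <= C1 by exact: normr_ge0.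
pose K1 := N1.+4.+1%:R * (M ^+ 2 + `|B|).
(* A single threshold [L <= s] absorbs the trivial range, the boundary terms and the logarithm, in
   this order of the three inequalities. *)
have [L hL] : exists L : nat, [/\ (0 < L)%N, K1 <= kappa * L%:R, 8 * M ^+ 2 <= kappa * L%:R &
    16 * C1 ^+ 2 <= kappa ^+ 2 * L%:R].
  have [l1 h1] := nat_bound (K1 / kappa); have [l2 h2] := nat_bound (8 * M ^+ 2 / kappa).
  have [l3 h3] := nat_bound (16 * C1 ^+ 2 / kappa ^+ 2).
  have h (l : nat) (x y : R) : 0 < y -> x / y <= l%:R -> (l <= (l1 + l2 + l3).+1)%N -> x <= y * (l1 + l2 + l3).+1%:R.
    by move=> y0; rewrite ler_pdivrMr // mulrC => hl hh; apply: le_trans hl _; rewrite ler_pM2l // ler_nat.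
  by exists (l1 + l2 + l3).+1; split=> //; [apply: h h1 _ | apply: h h2 _ | apply: h h3 _]; rewrite ?exprn_gt0 //; lia.
case: hL => L0 hK1 hM2 hC1.
exists (L ^ 4)%N => N hN N' hN' J hJ tau htau i j.
have N0 : (0 < N)%N by apply: leq_trans hN; rewrite expn_gt0 L0.
have [s [s0 sN hln hs]] := fourth_root R N0; have hJs := hs J hJ; have hLs := hs L hN.
have L1 : 1 <= L%:R :> R by rewrite ler1n.
have J2 (K : R) : 0 <= K -> K <= kappa * L%:R -> K * J%:R ^+ 2 <= kappa * N%:R.
  move=> K0 hK; rewrite sN; apply: (@le_trans _ _ (K * s ^+ 2)).
    by rewrite ler_wpM2l // ler_pXn2r ?nnegrE // ltW.
  rewrite (exprD _ 2 2) mulrA ler_wpM2r ?sqr_ge0 //; apply: le_trans hK _.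
  rewrite ler_pM2l //; nra.
pose f t := v t i 0 * v (t - tau) j 0.
have hv t k : `|v t k 0| <= M by apply: le_trans (hM t); exact: entry_normF.
have hf t : `|f t| <= M ^+ 2 by rewrite normrM expr2 ler_pM.
have [hbig|hsmall] := boolP ((N1 <= N') && (absz tau <= N') && (0 < N'))%N; last first.
  have h1 : `|\sum_(1 <= t < N'.+1) (f t%:Z - S tau i j)| <= N'%:R * (M ^+ 2 + `|B|).
    have := @window_sum_le _ N'.+1 1 N'.+1 (fun t => (1 <= t < N'.+1)%N)
      (fun t => f t%:Z - S tau i j) (M ^+ 2 + `|B|) _ _.
    rewrite -big_nat subn1; apply=> // t; apply: le_trans (ler_normB _ _) _; apply: lerD => //.
    by apply: le_trans (hB tau i j) (ler_norm _).
  apply: (@le_trans _ _ (K1 * J%:R ^+ 2)); last first.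
    by apply: J2 => //; rewrite mulr_ge0 // addr_ge0 ?sqr_ge0.
  apply: le_trans (ler_wpM2l (ler0n _ J) h1) _.
  have -> : K1 * J%:R ^+ 2 = (N1.+4.+1 * J ^ 2)%:R * (M ^+ 2 + `|B|) by rewrite natrM natrX /K1; ring.
  rewrite mulrA -natrM ler_wpM2r ?addr_ge0 ?sqr_ge0 // ler_nat.
  have hN'b : (N' <= N1 + 4 * J)%N by clear -hsmall htau; lia.
  have hJJ : (J <= J * J)%N by case: (J) => // k; rewrite leq_pmulr.
  rewrite -mulnn; clear -hN'b hJJ; nia.
case/andP: hbig => /andP[hb1 hb2] N'0.
have [hcov _] := hN1 N' hb1.
have {}hcov := hcov tau; have ht : `|tau| <= N'%:Z by clear -hb2; lia.
have {hcov ht} := hcov ht => hcov.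
pose c t := (1 <= t%:Z - tau) && (t%:Z - tau <= N'%:Z).
have h1 : `|\sum_(1 <= t < N'.+1 | c t) f t%:Z - N'%:R * S tau i j| <= C1 * (N'%:R * Num.sqrt (ln (N'%:R : R) / N'%:R)).
  have n0 : N'%:R != 0 :> R by rewrite pnatr_eq0 -lt0n.
  have -> : \sum_(1 <= t < N'.+1 | c t) f t%:Z - N'%:R * S tau i j =
      N'%:R * (sample_cov v N' tau - S tau) i j.
    rewrite mxBE [in RHS]/sample_cov mxE summxE mulrBr mulrA mulfV // mul1r; congr (_ - _).
    by apply: eq_bigr => t _; rewrite mxE big_ord1 !mxE.
  rewrite normrM ger0_norm // mulrCA ler_wpM2l //; apply: le_trans (entry_normF _ _ _) _.
  apply: le_trans hcov _; rewrite ler_wpM2r ?sqrtr_ge0 //; exact: ler_norm.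
have h2 : `|\sum_(1 <= t < N'.+1 | ~~ c t) f t%:Z| <= (absz tau)%:R * M ^+ 2.
  have [tp|tn] := lerP 0 tau.
    have := @window_sum_le _ N'.+1 1 (absz tau).+1 (fun t => (1 <= t < N'.+1)%N && ~~ c t)
      (fun t => f t%:Z) (M ^+ 2) _ _.
    rewrite -big_nat_cond subn1; apply=> // t; rewrite /c; clear -tp; lia.
  have := @window_sum_le _ N'.+1 (N'.+1 - absz tau) N'.+1 (fun t => (1 <= t < N'.+1)%N && ~~ c t)
    (fun t => f t%:Z) (M ^+ 2) _ _.
  rewrite -big_nat_cond (_ : (N'.+1 - (N'.+1 - absz tau) = absz tau)%N); last by clear -hb2; lia.
  apply=> // t; rewrite /c; clear -tn hb2; lia.
have hlog : J%:R * (C1 * (N'%:R * Num.sqrt (ln (N'%:R : R) / N'%:R))) <= kappa / 2 * N%:R.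
  have N'p : 0 < N'%:R :> R by rewrite ltr0n.
  have l0 : 0 <= ln (N'%:R : R) by rewrite ln_ge0 // ler1n.
  rewrite -(@ler_pXn2r _ 2) ?nnegrE ?mulr_ge0 ?sqrtr_ge0 ?(ltW k0) //.
  rewrite !exprMn sqr_sqrtr ?divr_ge0 // sN.
  have -> : N'%:R ^+ 2 * (ln (N'%:R : R) / N'%:R) = N'%:R * ln (N'%:R : R) by field; rewrite gt_eqF.
  have hll : N'%:R * ln (N'%:R : R) <= s ^+ 4 * (4 * s).
    apply: ler_pM => //; first by rewrite -sN ler_nat.
    by apply: le_trans hln; rewrite ler_ln ?posrE ?ltr0n // ler_nat.
  have hJ2 : J%:R ^+ 2 <= s ^+ 2 :> R by rewrite ler_pXn2r ?nnegrE // ltW.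
  apply: (@le_trans _ _ (s ^+ 2 * (C1 ^+ 2 * (s ^+ 4 * (4 * s))))).
    apply: ler_pM; rewrite ?mulr_ge0 ?sqr_ge0 //.
    by rewrite ler_wpM2l ?sqr_ge0.
  have -> : s ^+ 2 * (C1 ^+ 2 * (s ^+ 4 * (4 * s))) = s ^+ 7 * (4 * C1 ^+ 2) by ring.
  have -> : kappa ^+ 2 * 2^-1 ^+ 2 * (s ^+ 4) ^+ 2 = s ^+ 7 * (kappa ^+ 2 * s / 4) by field.
  rewrite ler_wpM2l ?exprn_ge0 ?(ltW s0) //.
  have : kappa ^+ 2 * L%:R <= kappa ^+ 2 * s by rewrite ler_wpM2l ?sqr_ge0.
  lra.
have h3 := J2 (8 * M ^+ 2) (mulr_ge0 (ler0n _ 8) (sqr_ge0 _)) hM2.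
have -> : \sum_(1 <= t < N'.+1) (v t%:Z i 0 * v (t%:Z - tau) j 0 - S tau i j) =
    (\sum_(1 <= t < N'.+1 | c t) f t%:Z - N'%:R * S tau i j) + \sum_(1 <= t < N'.+1 | ~~ c t) f t%:Z.
  rewrite big_split /= sumrN sumr_const_nat subn1 /= addrAC mulr_natl; congr (_ - _).
  by rewrite (bigID c).
apply: le_trans (ler_wpM2l (ler0n _ J) (ler_normD _ _)) _; rewrite mulrDr.
have h4 := ler_wpM2l (ler0n R J) h1; have h5 := ler_wpM2l (ler0n R J) h2.
have h6 : J%:R * ((absz tau)%:R * M ^+ 2) <= 4 * M ^+ 2 * J%:R ^+ 2.
  have -> : 4 * M ^+ 2 * J%:R ^+ 2 = J%:R * ((4 * J)%:R * M ^+ 2) by rewrite natrM; ring.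
  by rewrite ler_wpM2l // ler_wpM2r ?sqr_ge0 // ler_nat.
lra.
Qed.

(** The property [ucov] for one scalar product, so that almost sure statements can be proved entry
    by entry. *)
Definition lag_law (R : realType) (f : int -> int -> R) : Prop :=
  forall kappa : R, 0 < kappa -> exists N0, forall N, (N0 <= N)%N -> forall N', (N' <= N)%N ->
  forall J, (J ^ 4 <= N)%N -> forall tau : int, (absz tau <= 4 * J)%N ->
  J%:R * `|\sum_(1 <= t < N'.+1) f tau t%:Z| <= kappa * N%:R.

Lemma lag_law_ext (R : realType) (f g : int -> int -> R) :
  (forall tau t, f tau t = g tau t) -> lag_law f -> lag_law g.
Proof.
move=> h hf kappa k0; have [N0 h0] := hf kappa k0; exists N0 => N hN N' hN' J hJ tau htau.
by under eq_bigr => t _ do rewrite -h; exact: h0.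
Qed.

Lemma lag_law_unif (R : realType) (I : finType) (f : I -> int -> int -> R) :
  (forall i, lag_law (f i)) ->
  forall kappa : R, 0 < kappa -> exists N0, forall N, (N0 <= N)%N -> forall N', (N' <= N)%N ->
  forall J, (J ^ 4 <= N)%N -> forall tau : int, (absz tau <= 4 * J)%N -> forall i,
  J%:R * `|\sum_(1 <= t < N'.+1) f i tau t%:Z| <= kappa * N%:R.
Proof.
move=> h kappa k0; have [n0 hn0] := choice (fun i => h i kappa k0).
exists (\max_i n0 i)%N => N hN N' hN' J hJ tau htau i; apply: hn0 => //.
exact: leq_trans (leq_bigmax i) hN.
Qed.

Lemma ucov_lag_law (R : realType) (q : nat) (s : int -> 'cV[R]_q) (S : int -> 'M[R]_q) :
  ucov s S <-> forall i j, lag_law (fun tau t => s t i 0 * s (t - tau) j 0 - S tau i j).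
Proof.
split=> [h i j kappa k0|h kappa k0].
  by have [N0 h0] := h kappa k0; exists N0 => N hN N' hN' J hJ tau htau; exact: h0.
have [N0 h0] := lag_law_unif (fun ij : 'I_q * 'I_q => h ij.1 ij.2) k0.
exists N0 => N hN N' hN' J hJ tau htau i j; exact: (h0 N hN N' hN' J hJ tau htau (i, j)).
Qed.

Lemma ucov_block (R : realType) (q : nat) (v : int -> 'cV[R]_q) (v' : int -> 'cV[R]_1)
    (S : int -> 'M[R]_q) (s : int -> R) :
  ucov v S ->
  (forall i, lag_law (fun tau t => v t i 0 * v' (t - tau) 0 0)) ->
  (forall i, lag_law (fun tau t => v' t 0 0 * v (t - tau) i 0)) ->
  lag_law (fun tau t => v' t 0 0 * v' (t - tau) 0 0 - s tau) ->
  ucov (fun t => col_mx (v t) (v' t)) (fun tau => block_mx (S tau) 0 0 (s tau)%:M).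
Proof.
move=> /ucov_lag_law h1 h2 h3 h4; apply/ucov_lag_law => i j.
rewrite -(fintype.splitK i) -(fintype.splitK j); case: (fintype.split i) => i'; case: (fintype.split j) => j' /=.
- apply: lag_law_ext (h1 i' j') => tau t; by rewrite /block_mx !col_mxEu row_mxEl.
- rewrite ord1; apply: lag_law_ext (h2 i') => tau t; by rewrite /block_mx !col_mxEu row_mxEr col_mxEd mxE subr0.
- rewrite ord1; apply: lag_law_ext (h3 j') => tau t; by rewrite /block_mx !col_mxEd row_mxEl col_mxEu mxE subr0.
- rewrite !ord1; apply: lag_law_ext h4 => tau t; by rewrite /block_mx !col_mxEd row_mxEr mxE mulr1n.
Qed.

Section NoiseCovariance.
Context (R : realType) d (T : measurableType d) (P : probability T R) (nu : nat).
Variables (u r : int -> T -> 'cV[R]_nu) (e : int -> T -> 'cV[R]_1) (sigma_e : R).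
Hypothesis (mu : random_signal u) (mr : random_signal r) (me : random_signal e).
Hypothesis hN : noise_assumption P u e sigma_e.
Hypothesis hI : independent_sigma P (sigma_signal r) (sigma_signal e).

(** The strong law has natural lags, so lags of either sign form two orthogonal families. *)
Lemma orth_lag_law (C : R) (f : int -> int -> T -> R) :
  (forall c, orth P (fun t => f (Posz c) (Posz t.+1)) C) ->
  (forall c, orth P (fun t => f (- Posz c) (Posz t.+1)) C) ->
  {ae P, forall w, lag_law (fun tau t => f tau t w)}.
Proof.
move=> h1 h2; apply: filterS2 (orth_strong_law h1) (orth_strong_law h2) => w H1 H2 kappa k0.
have [N1 g1] := H1 kappa k0; have [N2 g2] := H2 kappa k0.
exists (maxn N1 N2) => N; rewrite geq_max => /andP[hN1 hN2] N' hN' J hJ tau htau.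
rewrite big_add1 /=; have [t0|t0] := lerP 0 tau.
  by rewrite -(gez0_abs t0); apply: g1.
have -> : tau = - Posz (absz tau) by lia.
by apply: g2 => //; rewrite abszN.
Qed.

Lemma noise_lag_law :
  {ae P, forall w, lag_law (fun tau t => e t w 0 0 * e (t - tau) w 0 0 - (tau == 0)%:R * sigma_e ^+ 2)}.
Proof.
have [C hC] := noise_lag_fam mu me hN.
apply: (@orth_lag_law C (fun tau t w => e t w 0 0 * e (t - tau) w 0 0 - (tau == 0)%:R * sigma_e ^+ 2)) => c.
  by apply: (hC c (fun t => Posz t.+1)) => a b []. 
(* A negative lag is a positive one seen from the later of the two times. *)
have h : (fun t w => e (Posz t.+1) w 0 0 * e (Posz t.+1 - - Posz c) w 0 0 - (- Posz c == 0)%:R * sigma_e ^+ 2) =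
   (fun t => noise_lag e sigma_e c (Posz t.+1 + Posz c)).
  apply/funext => t; apply/funext => w; rewrite /noise_lag opprK addrK mulrC oppr_eq0; by [].
by rewrite h; apply: (hC c (fun t => Posz t.+1 + Posz c)) => a b; lia.
Qed.

Lemma cross_lag_law (M : R) : 0 <= M -> {ae P, forall w, forall k, normF (r k w) <= M} ->
  {ae P, forall w, forall i, lag_law (fun tau t => r t w i 0 * e (t - tau) w 0 0) /\
                             lag_law (fun tau t => e t w 0 0 * r (t - tau) w i 0)}.
Proof.
move=> M0 hM; have [C hC] := cross_lag_fam mu mr me hN hI M0.
apply: filter_forall => i.
have h1 : {ae P, forall w, lag_law (fun tau t => clip M (r t w i 0) * e (t - tau) w 0 0)}.
  apply: (@orth_lag_law C (fun tau t w => clip M (r t w i 0) * e (t - tau) w 0 0)) => c.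
    have h : (fun t w => clip M (r (Posz t.+1) w i 0) * e (Posz t.+1 - Posz c) w 0 0) =
        (fun t => cross_lag r e M i (Posz t.+1 - Posz c) (Posz t.+1)).
      by apply/funext => t; apply/funext => w; rewrite /cross_lag mulrC.
    by rewrite h; apply: hC => a b; lia.
  have h : (fun t w => clip M (r (Posz t.+1) w i 0) * e (Posz t.+1 - - Posz c) w 0 0) =
      (fun t => cross_lag r e M i (Posz t.+1 - - Posz c) (Posz t.+1)).
    by apply/funext => t; apply/funext => w; rewrite /cross_lag mulrC.
  by rewrite h; apply: hC => a b; lia.
have h2 : {ae P, forall w, lag_law (fun tau t => e t w 0 0 * clip M (r (t - tau) w i 0))}.
  apply: (@orth_lag_law C (fun tau t w => e t w 0 0 * clip M (r (t - tau) w i 0))) => c.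
    by apply: (hC i (fun t => Posz t.+1) (fun t => Posz t.+1 - Posz c)) => a b [].
  by apply: (hC i (fun t => Posz t.+1) (fun t => Posz t.+1 - - Posz c)) => a b [].
apply: filterS3 hM h1 h2 => w hw l1 l2.
have hc k : clip M (r k w i 0) = r k w i 0.
  by apply: clip_id; apply: le_trans (hw k); exact: entry_normF.
by split; [apply: lag_law_ext l1 | apply: lag_law_ext l2] => tau t; rewrite hc.
Qed.

(** The strong law for [e_t^2 - sigma^2], forward and backward in time, with [J = 1]. Enlarging the
    constant by [N0] makes the bound hold for all windows, not only for long ones. *)
Lemma noise_pbd : {ae P, forall w, pbd (fun t => sqn (e t w))}.
Proof.
have [C hC] := noise_lag_fam mu me hN.
have inj1 : injective Posz by move=> a b [].
have h1 := @orth_strong_law _ _ _ P (fun c t => noise_lag e sigma_e 0 (Posz t)) C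
  (fun c => hC 0%N Posz inj1).
have inj2 : injective (fun t : nat => - Posz t) by move=> a b /oppr_inj [].
have h2 := @orth_strong_law _ _ _ P (fun c t => noise_lag e sigma_e 0 (- Posz t)) C
  (fun c => hC 0%N (fun t => - Posz t) inj2).
apply: filterS2 h1 h2 => w /(_ 1 ltr01) [N1 H1] /(_ 1 ltr01) [N2 H2].
have sE t : sqn (e t w) = e t w 0 0 ^+ 2 by rewrite sqnE !big_ord1.
have key (f : nat -> R) N0 : (forall N, (N0 <= N)%N -> forall N', (N' <= N)%N -> forall J, (J ^ 4 <= N)%N ->
    forall c, (c <= 4 * J)%N -> J%:R * `|\sum_(0 <= t < N') (f t - sigma_e ^+ 2)| <= 1 * N%:R) ->
    forall M, \sum_(0 <= t < M) f t <= (sigma_e ^+ 2 + N0.+1%:R) * M.+1%:R.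
  move=> H M; have := H (N0 + M).+1 _ M _ 1%N _ 0%N _; rewrite !mul1r => /(_ _ _ _ _) h.
  have : `|\sum_(0 <= t < M) (f t - sigma_e ^+ 2)| <= (N0 + M).+1%:R by apply: h => //; lia.
  rewrite big_split /= sumrN sumr_const_nat subn0 => /(le_trans (ler_norm _)).
  rewrite lerBlDr => hh; apply: le_trans hh _; rewrite addrC mulrDl lerD //.
    by rewrite -[leLHS]mulr_natr ler_wpM2l ?sqr_ge0 // ler_nat.
  by rewrite -natrM ler_nat; nia.
have nE t : noise_lag e sigma_e 0 t w = e t w 0 0 ^+ 2 - sigma_e ^+ 2.
  by rewrite /noise_lag subr0 mul1r.
have k1 := key (fun t => sqn (e (Posz t) w)) N1 _; have k2 := key (fun t => sqn (e (- Posz t) w)) N2 _.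
exists ((sigma_e ^+ 2 + N1.+1%:R) * 2 + (sigma_e ^+ 2 + N2.+1%:R) * 2).
have p0 n : 0 <= sigma_e ^+ 2 + n%:R by rewrite addr_ge0 ?sqr_ge0.
split=> [|M]; first by rewrite addr_ge0 ?mulr_ge0.
rewrite /win (@big_cat_nat _ _ _ M) //=; last by lia.
have e1 : \sum_(M <= i < M.*2.+1) sqn (e (Posz i - Posz M) w) = \sum_(0 <= t < M.+1) sqn (e (Posz t) w).
  rewrite -{1}[M]add0n big_addn (_ : (M.*2.+1 - M = M.+1)%N); last by lia.
  by apply: eq_bigr => t _; congr (sqn (e _ w)); lia.
have e2 : \sum_(0 <= i < M) sqn (e (Posz i - Posz M) w) <= \sum_(0 <= t < M.+1) sqn (e (- Posz t) w).
  rewrite big_nat_rev /= add0n [leRHS]big_nat_recl //= -[leLHS]add0r lerD ?sqn_ge0 //.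
  rewrite !big_nat; apply: ler_sum => t /andP[_ tM].
  rewrite le_eqVlt; apply/orP; left; apply/eqP; congr (sqn (e _ w)); lia.
have M2 : M.+2%:R <= 2 * M.+1%:R :> R by rewrite -natrM ler_nat; lia.
rewrite e1 addrC mulrDl; apply: lerD.
  apply: le_trans (k1 _ M.+1) _.
    by move=> N hn N' hN' J hJ c hc; under eq_bigr do rewrite sE -nE; exact: (H1 N hn N' hN' J hJ c hc).
  by rewrite -mulrA ler_wpM2l // addr_ge0 ?sqr_ge0.
apply: le_trans e2 _; apply: le_trans (k2 _ M.+1) _.
  by move=> N hn N' hN' J hJ c hc; under eq_bigr do rewrite sE -nE; exact: (H2 N hn N' hN' J hJ c hc).
by rewrite -mulrA ler_wpM2l // addr_ge0 ?sqr_ge0.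
Qed.

End NoiseCovariance.

(** * Identification of the limit covariances *)

Lemma ucov_sample_cov (R : realType) (q : nat) (s : int -> 'cV[R]_q) (S : int -> 'M[R]_q) tau i j :
  ucov s S -> (fun N => sample_cov s N tau i j) @ \oo --> S tau i j.
Proof.
move=> hu; apply/cvgrPdist_le => eps eps0.
have k0 : 0 < eps / 4 by lra.
have [N0 hN0] := hu _ k0.
set c := absz tau; pose J := c.+1.
have [N1 hN1] := nat_bound (2 * (c%:R * `|S tau i j|) / eps).
near=> N; have hN : (N0 + N1 + J ^ 4 <= N)%N by near: N; exact: nbhs_infty_ge.
have Np : (0 < N)%N by apply: leq_trans hN; rewrite addn_gt0 expn_gt0 orbT.
have NR : 0 < N%:R :> R by rewrite ltr0n.
pose g t := s t%:Z i 0 * s (t%:Z - tau) j 0.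
have h N' : (N' <= N)%N -> `|\sum_(1 <= t < N'.+1) (g t - S tau i j)| <= eps / 4 * N%:R.
  move=> hN'; have h1 : (N0 <= N)%N by lia.
  have h2 : (J ^ 4 <= N)%N by lia.
  have h3 : (absz tau <= 4 * J)%N by rewrite /J -/c; lia.
  apply: le_trans (hN0 N h1 N' hN' J h2 tau h3 i j).
  by rewrite -[leLHS]mul1r ler_wpM2r // ler1n.
pose cd t := (1 <= t%:Z - tau) && (t%:Z - tau <= N%:Z).
have cN : (c <= N)%N.
  have : (c < J ^ 4)%N by apply: (leq_trans (ltnSn c)); rewrite -/J -{1}[J]expn1 leq_pexp2l.
  lia.
have hc : `|\sum_(1 <= t < N.+1 | cd t) g t - N%:R * S tau i j| <= eps / 2 * N%:R + c%:R * `|S tau i j|.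
  (* The admissible times form an interval that misses at most [c] points of the sample, so the sum
     over them is a difference of two partial sums. *)
  have [a [b [ab bN habs hcd]]] : exists a b, [/\ (a <= b)%N, (b <= N)%N, (N - (b - a) <= c)%N &
     forall t, (1 <= t < N.+1)%N && cd t = (a < t < b.+1)%N].
    have [tp|tn] := lerP 0 tau.
      exists c, N; split=> //; first by clear -cN; lia.
      by move=> t; rewrite /cd /c; clear -tp; lia.
    exists 0%N, (N - c)%N; split=> //; first by clear; lia.
      by clear -cN; lia.
    by move=> t; rewrite /cd /c; clear -tn; lia.
  have -> : \sum_(1 <= t < N.+1 | cd t) g t = \sum_(a.+1 <= t < b.+1) g t.
    rewrite big_nat_cond [RHS]big_nat_cond big_mkcond [RHS]big_mkcond /=.
    rewrite (@big_nat_widenl _ _ _ a.+1 1) //= [RHS]big_mkcond /=.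
    rewrite (@big_nat_widen _ _ _ 1 b.+1 N.+1) //= [RHS]big_mkcond /=.
    by apply: eq_bigr => t _; rewrite hcd andbT; case: (a < t)%N; case: (t < b.+1)%N.
  have e1 n : \sum_(1 <= t < n.+1) g t = \sum_(1 <= t < n.+1) (g t - S tau i j) + n%:R * S tau i j.
    by rewrite big_split /= sumrN sumr_const_nat subn1 /= mulr_natl subrK.
  have -> : \sum_(a.+1 <= t < b.+1) g t = \sum_(1 <= t < b.+1) g t - \sum_(1 <= t < a.+1) g t.
    by rewrite (@big_cat_nat _ _ _ a.+1 1 b.+1) //= addrAC subrr add0r.
  rewrite !e1.
  have hb := h b bN; have ha := h a (leq_trans ab bN).
  set x := \sum_(1 <= t < b.+1) _ in hb *; set y := \sum_(1 <= t < a.+1) _ in ha *.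
  have -> : x + b%:R * S tau i j - (y + a%:R * S tau i j) - N%:R * S tau i j =
      (x - y) - (N - (b - a))%:R * S tau i j.
    rewrite natrB; last by clear -bN; lia.
    rewrite natrB //; ring.
  apply: le_trans (ler_normB _ _) _; apply: lerD.
    apply: le_trans (ler_normB _ _) _; lra.
  by rewrite normrM ger0_norm // ler_wpM2r // ler_nat.
have hE : S tau i j - sample_cov s N tau i j =
   N%:R^-1 * - (\sum_(1 <= t < N.+1 | cd t) g t - N%:R * S tau i j).
  rewrite /sample_cov mxE summxE mulrN mulrBr mulrA mulVf ?gt_eqF // mul1r opprB; congr (_ - _).
  by congr (_ * _); apply: eq_bigr => t _; rewrite mxE big_ord1 !mxE.
rewrite hE normrM normrN normfV ger0_norm // mulrC ler_pdivrMr //; apply: le_trans hc _.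
have : 2 * (c%:R * `|S tau i j|) <= eps * N%:R.
  move: hN1; rewrite ler_pdivrMr // mulrC => h1; apply: le_trans h1 _.
  by rewrite [leLHS]mulrC ler_pM2l // ler_nat; clear -hN; lia.
lra.
Unshelve. all: by end_near.
Qed.

(** Lets the spectral lower bound, known for [S'], be combined with the rates, known for [S]. *)
Lemma ucov_unique (R : realType) (q : nat) (s : int -> 'cV[R]_q) (S S' : int -> 'M[R]_q) :
  ucov s S -> (forall tau, (fun N => sample_cov s N tau) @ \oo --> S' tau) -> S' = S.
Proof.
move=> hu h; apply/funext => tau; apply/matrixP => i j.
have h1 := cvg_comp _ _ (h tau) (@coord_continuous R q q i j (S' tau)).
have h2 : (fun N => sample_cov s N tau i j) @ \oo --> S' tau i j by exact: h1.
exact: (cvg_unique (@Rhausdorff R) h2 (ucov_sample_cov hu)).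
Qed.

Lemma cov_summable_bd (R : realType) (q : nat) (S : int -> 'M[R]_q) :
  cov_summable S -> exists B, forall tau i j, `|S tau i j| <= B.
Proof.
move=> hS; have [B hB] := cvg_asum (fun k => addr_ge0 (normF_ge0 _) (normF_ge0 _)) hS.
exists B => tau i j; apply: le_trans (entry_normF _ _ _) _.
have [n hn] : exists n : nat, tau = n%:Z \/ tau = - n%:Z by exists (absz tau); lia.
apply: le_trans (hB n.+1); rewrite big_nat_recr //= -[leLHS]add0r lerD //.
  by apply: sumr_ge0 => k _; rewrite addr_ge0 ?normF_ge0.
by case: hn => ->; rewrite ?lerDl ?lerDr normF_ge0.
Qed.

Lemma sqn_col_mx (R : realType) (p q : nat) (v : 'cV[R]_p) (w : 'cV[R]_q) :
  sqn (col_mx v w) = sqn v + sqn w.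
Proof.
by rewrite !sqn_colE big_split_ord /=; congr (_ + _); apply: eq_bigr => k _;
  rewrite ?col_mxEu ?col_mxEd.
Qed.

Lemma noise_covariance (R : realType) d (T : measurableType d) (P : probability T R) (nu : nat)
    (u r : int -> T -> 'cV[R]_nu) (e : int -> T -> 'cV[R]_1) (sigma_e M : R) (Rr : int -> 'M[R]_nu) :
  random_signal u -> random_signal r -> random_signal e ->
  noise_assumption P u e sigma_e ->
  independent_sigma P (sigma_signal r) (sigma_signal e) ->
  {ae P, forall w, forall k, normF (r k w) <= M} ->
  {ae P, forall w, quasi_stationary
           (fun N => Num.sqrt (ln (N%:R : R) / N%:R)) (fun t => r t w) Rr} ->
  cov_summable Rr ->
  {ae P, forall w, let s t := col_mx (r t w) (e t w) in
     pbd (fun t => sqn (s t)) /\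
     ucov s (fun tau => block_mx (Rr tau) 0 0 ((tau == 0)%:R * sigma_e ^+ 2)%:M)}.
Proof.
move=> mu mr me hN hI hM hq hR.
have {}hM : {ae P, forall w, forall k, normF (r k w) <= `|M|}.
  by apply: filterS hM => w h k; apply: le_trans (h k) (ler_norm _).
have [B hB] := cov_summable_bd hR.
have hc := cross_lag_law mu mr me hN hI (normr_ge0 M) hM.
have h1 : {ae P, forall w, pbd (fun t => sqn (e t w)) /\
    lag_law (fun tau t => e t w 0 0 * e (t - tau) w 0 0 - (tau == 0)%:R * sigma_e ^+ 2)}.
  by apply: filterS2 (noise_pbd mu me hN) (noise_lag_law mu me hN) => w.
have h2 : {ae P, forall w, (forall k, normF (r k w) <= `|M|) /\ quasi_stationary
           (fun N => Num.sqrt (ln (N%:R : R) / N%:R)) (fun t => r t w) Rr}.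
  by apply: filterS2 hM hq => w.
apply: filterS3 h1 h2 hc => w [p1 p2] [q1 q2] q3; split.
  pose s t := col_mx (r t w) (e t w).
  have hs t : sqn (s t) = sqn (r t w) + sqn (e t w) by exact: sqn_col_mx.
  have -> : (fun t => sqn (s t)) = (fun t => sqn (r t w) + sqn (e t w)) by exact/funext.
  apply: pbdD => //; exists (2 * M ^+ 2); split=> [|n]; first by rewrite mulr_ge0 ?sqr_ge0.
  apply: (@le_trans _ _ (\sum_(0 <= i < n.*2.+1) M ^+ 2)).
    apply: ler_sum => i _; rewrite -normF_sqr -[M ^+ 2]real_normK ?num_real //.
    by rewrite ler_pXn2r ?nnegrE ?normF_ge0.
  have h : (n.*2.+1)%:R <= 2 * n.+1%:R :> R by rewrite -natrM ler_nat; clear; lia.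
  by have := ler_wpM2l (sqr_ge0 M) h; rewrite sumr_const_nat subn0 -[M ^+ 2 *+ _]mulr_natr; lra.
apply: ucov_block => //.
- exact: (quasi_stationary_ucov q2 q1 hB).
- by move=> i; have [] := q3 i.
- by move=> i; have [] := q3 i.
Qed.

(** * Inversion of the closed loop *)

Lemma normF_N1 (R : realType) (p q : nat) (v : 'M[R]_(p, q)) : normF v <= N1 v.
Proof. by rewrite normF_sqn -[leRHS]ger0_norm ?N1_ge0 // -sqrtr_sqr ler_wsqrtr // sqn_N1. Qed.

Section ClosedLoop.
Variables (R : realType) (m nu : nat).
Let nx := m.+1.
Variables (A : 'M[R]_nx) (B : 'M[R]_(nx, nu)) (C : 'rV[R]_nx) (K : 'cV[R]_nx) (F : nat -> 'cV[R]_nu).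
Variables (hu : nat -> 'M[R]_(nu, nu + 1)) (hy : nat -> 'M[R]_(1, nu + 1)).
Hypothesis hcl : closed_loop_impulse A B C K F hu hy.
Variables (den : nat -> R) (num : nat -> 'cV[R]_nu).
Hypothesis hfr : stable_fraction F den num.
Let AK := A - K *m C.
Let BK := row_mx B K.
Let h k := col_mx (hu k) (hy k).
Let ir k : 'M[R]_(nu, nu + 1) := (k == 0%N)%:R *: row_mx 1%:M 0.
Let ie k : 'M[R]_(1, nu + 1) := (k == 0%N)%:R *: row_mx 0 1%:M.

(** The relation [den (u - r) + num y = 0] on impulse responses: exchanging the sums turns the
    convolution of [den] and [F] into [num], which clears the possibly unstable [F]. *)
Lemma controller_response k :
  \sum_(0 <= j < k.+1) (den j *: hu (k - j)%N + num j *m hy (k - j)%N) = den k *: row_mx 1%:M 0.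
Proof.
have [hx [_ _ _ hU]] := hcl; have [_ _ _ hnum] := hfr.
pose f i j := den i *: (F j *m hy (k - i - j)%N).
have e1 j : (j < k.+1)%N -> den j *: hu (k - j)%N = den j *: ir (k - j)%N -
    \sum_(0 <= n < k.+1 - j) f j n.
  move=> jk; rewrite hU scalerDr scalerN addrC subSn // big_mkord scaler_sumr; congr (_ - _).
have e2 n : (n < k.+1)%N -> num n *m hy (k - n)%N = \sum_(0 <= j < n.+1) f j (n - j)%N.
  move=> nk; rewrite -hnum mulmx_suml big_mkord; apply: eq_bigr => j _.
  rewrite -scalemxAl /f; congr (_ *: (_ *m hy _)); have := ltn_ord j; lia.
rewrite big_split /=.
have -> : \sum_(0 <= j < k.+1) den j *: hu (k - j)%N =
    \sum_(0 <= j < k.+1) (den j *: ir (k - j)%N - \sum_(0 <= n < k.+1 - j) f j n).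
  by rewrite !big_nat; apply: eq_bigr => j /andP[_ jk]; exact: e1.
have -> : \sum_(0 <= n < k.+1) num n *m hy (k - n)%N =
    \sum_(0 <= n < k.+1) \sum_(0 <= j < n.+1) f j (n - j)%N.
  by rewrite !big_nat; apply: eq_bigr => j /andP[_ jk]; exact: e2.
rewrite sum_triangle sumrB subrK.
rewrite big_nat_recr //= big_nat big1 ?add0r; last first.
  by move=> j /andP[_ jk]; rewrite /ir subn_eq0 leqNgt jk scale0r scaler0.
by rewrite /ir subnn eqxx scale1r.
Qed.

(** The predictor Markov parameters, preceded by 0 because the predictor is strictly causal. *)
Definition predictor_gain (k : nat) : 'rV[R]_(nu + 1) :=
  if k is k'.+1 then C *m AK ^+ k' *m BK else 0.

(** Substituting [e = y - C x] in the state equation gives the predictor form driven by [(u, y)], so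
    that a filter built on powers of [A_K] recovers the innovation. *)
Lemma predictor_response k :
  hy k - \sum_(0 <= j < k.+1) predictor_gain j *m h (k - j)%N = ie k.
Proof.
have [hx [hx0 hX hY _]] := hcl.
have hxE n : hx n = \sum_(0 <= j < n) AK ^+ j *m (BK *m h (n.-1 - j)%N).
  elim: n => [|n IH]; first by rewrite big_nil hx0.
  have -> : hx n.+1 = AK *m hx n + BK *m h n.
    have hK : K *m ie n = K *m hy n - K *m C *m hx n by rewrite hY mulmxDr mulmxA addrC addKr.
    by rewrite hX -/(ie n) hK mulmxBl /BK mul_row_col [X in _ + X]addrC addrACA.
  rewrite big_nat_recl //= expr0 mul1mx subn0 addrC; congr (_ + _).
  rewrite IH mulmx_sumr !big_nat; apply: eq_bigr => j /andP[_ jn].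
  rewrite exprS -mulmxA; congr (AK *m (_ *m (BK *m h _))); lia.
rewrite big_nat_recl //= mul0mx add0r hY hxE mulmx_sumr addrAC.
rewrite (_ : \sum_(0 <= j < k) _ = \sum_(0 <= j < k) C *m AK ^+ j *m BK *m h (k - j.+1)%N) ?subrr ?add0r //.
apply: eq_bigr => j _; rewrite !mulmxA; congr (_ *m h _); lia.
Qed.

Hypothesis hh : asum (fun k => normF (h k)).
Hypothesis AK_stable : spectral_radius AK < 1.
Hypothesis hM : exists M : R, forall z : R[i], `|z| = 1 -> forall i,
  `|transfer num z i 0| <= real_complex R M * `|ztransform den z|.

Let asum_delta : asum (fun k => `|((k == 0%N)%:R : R)|).
Proof.
exists 1 => n; apply: (@le_trans _ _ (\sum_(0 <= k < n.+1) `|((k == 0%N)%:R : R)|)).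
  by rewrite big_nat_recr //= lerDl.
by rewrite big_nat_recl //= normr1 big1 ?addr0 // => k _; rewrite normr0.
Qed.

Let asum_gain : asum (fun k => normF (predictor_gain k)).
Proof.
have [S hS] := powers_summable AK_stable; exists (N1 C * S * N1 BK) => n.
apply: (@le_trans _ _ (\sum_(0 <= k < n.+1) normF (predictor_gain k))).
  by rewrite big_nat_recr //= lerDl normF_ge0.
rewrite big_nat_recl //= [normF 0]normF_sqn sqn0 sqrtr0 add0r.
apply: (@le_trans _ _ (\sum_(0 <= k < n) N1 C * N1 (AK ^+ k) * N1 BK)).
  apply: ler_sum => k _; apply: le_trans (normF_N1 _) _; apply: le_trans (N1M _ _) _.
  by rewrite ler_wpM2r ?N1_ge0 // N1M.
by rewrite -mulr_suml -mulr_sumr ler_wpM2r ?N1_ge0 // ler_wpM2l ?N1_ge0.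
Qed.

Let asum_row (q : nat) (g : nat -> 'rV[R]_q) :
  (forall l, asum (fun k => `|g k 0 l|)) -> asum (fun k => normF (g k)).
Proof.
move=> hg; apply: asum_le (asum_abs_sum (a := fun l k => `|g k 0 l|) _) => [k|l]; last first.
  by apply: asum_le (hg l) => k; rewrite normr_id.
rewrite ger0_norm ?sumr_ge0 //; apply: le_trans (normF_N1 _) _.
by rewrite /N1 big_ord1.
Qed.

(** The controller rows recover [den r] and the predictor row recovers [e]. Multiplying by [den]
    instead of dividing keeps all filters summable, at the price of excluding the zeros of [den]. *)
Lemma closed_loop_transfer_lb : exists2 c : R, 0 < c & forall z : R[i], cm z = 1 ->
  ztransform den z != 0 -> forall w : 'rV[R[i]]_(nu + 1), c * csq w <= csq (w *m transfer h z).
Proof.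
have [dsum nsum _ _] := hfr; have [M hM'] := hM.
have hd : asum (fun k => `|den k|) by apply: cvg_asum dsum => k.
have hn : asum (fun k => normF (num k)) by apply: cvg_asum nsum => k; exact: normF_ge0.
pose dl k : R := (k == 0%N)%:R.
pose g (i : 'I_(nu + 1)) k : 'rV[R]_(nu + 1) := match fintype.split i with
  | inl i' => row_mx (den k *: delta_mx 0 i') (num k i' 0)%:M
  | inr _ => row_mx 0 (dl k)%:M - predictor_gain k end.
pose dn (i : 'I_(nu + 1)) := if fintype.split i is inl _ then den else dl.
have dlE z : ztransform dl z = 1.
  have h1 k : cm ((dl k)%:C%C * z ^- k) <= `|dl k|.
    rewrite cmM cmR /dl; case: eqP => [->|_]; last by rewrite normr0 mul0r.
    by rewrite expr0 invr1 cm1 mulr1.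
  have h2 n : \sum_(1 <= k < n) `|dl k| <= 0.
    by rewrite big_nat big1 // => k /andP[k1 _]; rewrite /dl gtn_eqF // normr0.
  have := csum_tail h1 asum_delta h2; rewrite mulr0 big_nat1 /dl /= expr0 invr1 mulr1 => h3.
  by apply/eqP; rewrite -subr_eq0; apply/eqP/cm_eq0/le_anti; rewrite h3 cm_ge0.
have [Sg hSg] := asum_gain.
have hg i : asum (fun k => normF (g i k)).
  rewrite /g; case: (fintype.split i) => i'; apply: asum_row => l.
    rewrite -(fintype.splitK l); case: (fintype.split l) => l' /=.
      apply: asum_le hd => k; rewrite row_mxEl !mxE eqxx /=.
      by case: eqP; rewrite ?mulr1 ?mulr0 ?normr0.
    by apply: asum_le hn => k; rewrite row_mxEr ord1 mxE mulr1n; exact: entry_normF.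
  case: asum_delta asum_gain => S1 h1 [S2 h2]; exists (S1 + S2) => n.
  apply: le_trans (lerD (h1 n) (h2 n)); rewrite -big_split; apply: ler_sum => k _ /=.
  rewrite mxBE; apply: le_trans (ler_normB _ _) _; apply: lerD; last exact: entry_normF.
  rewrite -(fintype.splitK l); case: (fintype.split l) => l' /=; first by rewrite row_mxEl mxE normr0.
  by rewrite row_mxEr !ord1 mxE mulr1n.
have hrow i k : \sum_(0 <= n < k.+1) g i n *m h (k - n)%N = dn i k *: delta_mx 0 i.
  have dE : delta_mx 0 i = match fintype.split i with
      inl i' => row_mx (delta_mx 0 i') 0 | inr _ => row_mx 0 1%:M end :> 'rV[R]_(nu + 1).
    apply/rowP => l; rewrite -{1}(fintype.splitK i) -(fintype.splitK l).
    case: (fintype.split i) => i'; case: (fintype.split l) => l' /=;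
      rewrite ?row_mxEl ?row_mxEr !mxE ?eqxx /= ?(inj_eq (@lshift_inj _ _)) ?(inj_eq (@rshift_inj _ _))
        ?eq_lrshift ?eq_rlshift ?ord1 //.
  rewrite dE /g /dn; case: (fintype.split i) => i' /=.
    have -> : row_mx (delta_mx 0 i') 0 = delta_mx 0 i' *m row_mx 1%:M 0 :> 'rV[R]_(nu + 1).
      by rewrite mul_mx_row mulmx1 mulmx0.
    rewrite scalemxAr.
    rewrite -controller_response mulmx_sumr; apply: eq_bigr => n _.
    rewrite mul_row_col mulmxDr -scalemxAr scalemxAl mulmxA; congr (_ + _ *m _).
    by apply/matrixP => a b; rewrite !ord1 mxE -rowE !mxE mulr1n.
  have -> : dl k *: row_mx 0 1%:M = ie k by [].
  rewrite -predictor_response; under eq_bigr do rewrite mulmxBl mul_row_col mul0mx add0r.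
  rewrite sumrB; congr (_ - _); rewrite big_nat_recl //= subn0 /dl big1 ?addr0 ?mul1mx // => n _.
  by rewrite (_ : (0%:R)%:M = 0) ?mul0mx // raddf0.
have [||c c0 hc] := @transfer_lb _ _ h g dn (1 + `|M| + Sg) hh hg.
- move=> i k j; have := congr1 (fun v : 'rV_(nu + 1) => v 0 j) (hrow i k).
  rewrite summxE !mxE eqxx /= [in X in _ = X -> _]eq_sym mulr_natr => <-.
  by rewrite exchange_big; apply: eq_bigr => n _; rewrite mxE.
- move=> z z1 i l; rewrite mxE /g /dn; case: (fintype.split i) => i'.
    have dz := cm_ge0 (ztransform den z).
    have M0 := normr_ge0 M; have Sg0 : 0 <= Sg by have := hSg 0%N; rewrite big_nil.
    rewrite -(fintype.splitK l); case: (fintype.split l) => l' /=.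
      have -> : (fun k => row_mx (den k *: delta_mx 0 i') (num k i' 0)%:M 0 (lshift 1 l')) =
          (fun k => den k *+ (i' == l')).
        by apply/funext => k; rewrite row_mxEl !mxE eqxx /= eq_sym mulr_natr.
      rewrite ztransform_mulb; case: (i' == l'); rewrite ?mulr1n ?mulr0n ?cm0; last by rewrite mulr_ge0 // !addr_ge0.
      by rewrite -[leLHS]mul1r ler_wpM2r // -addrA lerDl addr_ge0.
    have -> : (fun k => row_mx (den k *: delta_mx 0 i') (num k i' 0)%:M 0 (rshift nu l')) =
        (fun k => num k i' 0).
      by apply/funext => k; rewrite row_mxEr !ord1 !mxE mulr1n.
    have z1' : `|z| = 1 by rewrite cmE z1.
    have := hM' z z1' i'; rewrite mxE !cmE -rmorphM /= lecR => hb.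
    apply: le_trans hb _; rewrite ler_wpM2r //; have := ler_norm M; lra.
  rewrite dlE cm1 mulr1; apply: ztransform_bound => // n.
  apply: (@le_trans _ _ (\sum_(0 <= k < n) (`|dl k| + normF (predictor_gain k)))).
    apply: ler_sum => k _; rewrite mxBE; apply: le_trans (ler_normB _ _) _; apply: lerD; last exact: entry_normF.
    rewrite -(fintype.splitK l); case: (fintype.split l) => l' /=; first by rewrite row_mxEl mxE normr0.
    by rewrite row_mxEr !ord1 mxE mulr1n.
  have hdl : \sum_(0 <= k < n) `|dl k| <= 1.
    apply: (@le_trans _ _ (\sum_(0 <= k < n.+1) `|dl k|)).
      by rewrite big_nat_recr //= lerDl.
    by rewrite big_nat_recl //= /dl normr1 big1 ?addr0 // => k _; rewrite normr0.
  have := hSg n; have := normr_ge0 M; rewrite big_split /=; lra.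
exists c => // z z1 dz w; apply: hc => // i; rewrite /dn; case: (fintype.split i) => _ //.
by rewrite dlE oner_eq0.
Qed.

End ClosedLoop.

(** * From rates to almost sure convergence *)

Lemma asum_shift (R : realType) (f : nat -> R) : asum (fun k => f k.+1) -> (forall k, 0 <= f k) -> asum f.
Proof.
move=> [S hS] f0; exists (f 0%N + S) => n.
apply: (@le_trans _ _ (\sum_(0 <= k < n.+1) f k)); first by rewrite big_nat_recr //= lerDl.
by rewrite big_nat_recl //= lerD2l.
Qed.

(** The filter is general because one of the two limits is taken along a restricted set of [N]. *)
Lemma sqn_cvg (R : realType) (q : nat) (F : set_system nat) {FF : Filter F} (f : nat -> 'rV[R]_q) (l : 'rV[R]_q) :
  (forall eps : R, 0 < eps -> \forall N \near F, sqn (f N - l) <= eps) -> f @ F --> l.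
Proof.
move=> h; apply/cvg_ballP => eps e0.
have e2 : 0 < (eps / 2) ^+ 2 by rewrite exprn_gt0 // divr_gt0.
apply: filterS (h _ e2) => N hN; split=> // i j; rewrite -ball_normE /ball_ /=.
apply: (@le_lt_trans _ _ (eps / 2)); last by lra.
rewrite -(@ler_pXn2r _ 2) ?nnegrE ?divr_ge0 ?(ltW e0) //.
apply: le_trans hN; rewrite real_normK ?num_real // -sqrrN opprB -mxBE; exact: sqn_entry.
Qed.

(** The order on complex numbers compares real parts at equal imaginary parts; the comparison of
    real parts is kept. *)
Lemma excitation_spectrum_lb (R : realType) (q : nat) (S : int -> 'M[R]_q) (delta : R) :
  (forall z : R[i], `|z| = 1 -> forall v : 'cV[R[i]]_q,
     real_complex R delta * ((map_mx (@conjc R) v)^T *m v) 0 0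
       <= ((map_mx (@conjc R) v)^T *m spectrum S z *m v) 0 0) -> spectrum_lb S delta.
Proof.
move=> h z z1 p; have z1' : `|z| = 1 by rewrite cmE z1.
have := h z z1' p^T; rewrite map_trmx !trmxK.
rewrite csq_hform1 -rmorphM /= lecE /= => /andP[_]; by rewrite /hform.
Qed.

Lemma order_growth (R : realType) (n : nat -> nat) (delta : R) :
  n @ \oo --> \oo -> 0 < delta ->
  (fun N : nat => ((n N)%:R : R) `^ (4 + delta) / N%:R) @ \oo --> (0 : R) ->
  forall n0, exists N0, forall N, (N0 <= N)%N -> (n0 <= n N)%N /\ (n N ^ 4 <= N)%N.
Proof.
move=> h1 d0 h2 n0.
have [N1 _ hN1] : \forall N \near \oo, (maxn n0 1 <= n N)%N.
  exact: (h1 _ (nbhs_infty_ge (maxn n0 1))).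
have [N2 _ hN2] := cvgr_le _ h2 _ (ltr01 : 0 < 1 :> R).
exists (maxn N1 N2).+1 => N hN.
have := hN1 N _; have := hN2 N _ => /(_ _) g2 /(_ _) g1.
have {}g1 : (maxn n0 1 <= n N)%N by apply: g1 => /=; lia.
have {}g2 : (n N)%:R `^ (4 + delta) / N%:R <= 1 :> R by apply: g2 => /=; lia.
split; first by lia.
have NR : 0 < N%:R :> R by rewrite ltr0n; lia.
move: g2; rewrite ler_pdivrMr // mul1r => g2; rewrite -(ler_nat R) natrX.
apply: le_trans g2; rewrite -powR_mulrn //; apply: ler_powR; last by lra.
by rewrite ler1n; lia.
Qed.

Theorem theorem5p2 (R : realType) (d : measure_display) (T : measurableType d)
    (P : probability T R) (nx nu : nat) (hnx : (0 < nx)%N) (hnu : (0 < nu)%N)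
    (A : 'M[R]_nx) (B : 'M[R]_(nx, nu)) (C : 'rV[R]_nx) (K : 'cV[R]_nx)
    (a : 'rV[R]_nx) (Fy : nat -> 'cV[R]_nu)
    (x : int -> T -> 'cV[R]_nx) (u r : int -> T -> 'cV[R]_nu)
    (y e : int -> T -> 'cV[R]_1) (sigma_e : R) (n : nat -> nat)
    (hC : C = e1row R nx) (hAK : A - K *m C = canonical_AK a)
    (hsys : is_system P A B C K x u y e)
    (hS : system_assumption A B C K)
    (hN : noise_assumption P u e sigma_e)
    (hI : input_assumption P A B C K Fy u r y e)
    (hO : order_assumption C (A - K *m C) (row_mx B K) n) :
  let z (w : T) (k : int) : 'cV[R]_(nu + 1) := col_mx (u k w) (y k w) in
  let Rn (w : T) (N : nat) := Rhat (z w) (n N) N in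
  let gn (w : T) (N : nat) := ghat (fun k => y k w) (z w) (n N) N in
  {ae P, forall w,
     ((fun N => a_wls nx (Rn w N) (gn w N)) @ \oo --> a) /\
     ((fun N => eta_wls nx (Rn w N) (gn w N))
        @ within [set N | Lambda_wls nx (Rn w N) (gn w N) \in unitmx] \oo
        --> rvec (row_mx B K))}.
Proof.
case: nx hnx A B C K a x hC hAK hsys hS hI hO => // m _ A B C K a x hC hAK hsys hS hI hO z Rn gn.
have [mx mu my me hdyn] := hsys; have [_ hstab hctrl hobs] := hS.
case: hI => mr [den [num [hfr hM _]]] hind [M hrM] [Rr [psi [hqs hRr _ _]]]
  [hu [hy [hcl hfs hfilt]]] [Rre [delta [hcov hRre de0 hexc]]].
have [hninf [delta' de0' hgrow] _] := hO.
pose h k := col_mx (hu k) (hy k).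
have sq0 k : 0 <= normF (h k) * Num.sqrt k%:R by rewrite mulr_ge0 ?normF_ge0 ?sqrtr_ge0.
(* Stability with [f_N = 1 / sqrt N] is exactly summability of [|h_k|] weighted by [sqrt k], from
   index 1 on. *)
have hh : asum (fun l => normF (h l) * Num.sqrt l%:R).
  apply: asum_shift => //.
  have hf0 k : 0 <= normF (h k.+1) / (Num.sqrt k.+1%:R)^-1 by rewrite invrK.
  by apply: asum_le (cvg_asum hf0 hfs) => k; rewrite invrK.
have hh1 : asum (fun l => normF (h l)).
  apply: asum_shift => [|k]; last exact: normF_ge0.
  have [S hS1] := hh; exists S => n1.
  apply: (@le_trans _ _ (\sum_(0 <= l < n1.+1) normF (h l) * Num.sqrt l%:R)); last exact: hS1.
  rewrite big_nat_recl //= -[leLHS]add0r lerD //; apply: ler_sum => k _.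
  by rewrite -[leLHS]mulr1 ler_wpM2l ?normF_ge0 // -{1}[1]sqrtr1 ler_wsqrtr // ler1n.
have stab : spectral_radius (canonical_AK a) < 1 by rewrite -hAK.
have obs (v : 'cV[R]_m.+1) : (forall i, (i < m.+1)%N -> e1row R m.+1 *m canonical_AK a ^+ i *m v = 0) -> v = 0.
  by rewrite -hC -hAK; exact: obs_AK.
have ctr (v : 'rV[R]_m.+1) : (forall i, (i < m.+1)%N -> v *m canonical_AK a ^+ i *m row_mx B K = 0) -> v = 0.
  rewrite -hAK; apply: ctrb_AK => // v'; rewrite mul_mx_row -(row_mx0 R 1 nu 1).
  by move=> /eq_row_mx [].
have [c c0 hc] := closed_loop_transfer_lb hcl hfr hh1 hstab hM.
pose S0 tau : 'M[R]_(nu + 1) := block_mx (Rr tau) 0 0 ((tau == 0)%:R * sigma_e ^+ 2)%:M.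
have hcov2 := noise_covariance mu mr me hN hind hrM hqs hRr.
(* The equality is deterministic, so a single path in the event of full measure decides it. It moves
   the excitation bound to [S0], for which rates are available. *)
have hS0 : Rre = S0.
  have [w [[_ hw1] hw2]] : exists w, (pbd (fun t => sqn (col_mx (r t w) (e t w))) /\
      ucov (fun t => col_mx (r t w) (e t w)) S0) /\
      (forall tau, (fun N => sample_cov (fun t => col_mx (r t w) (e t w)) N tau) @ \oo --> Rre tau).
    have hex : {ae P, forall w, (pbd (fun t => sqn (col_mx (r t w) (e t w))) /\
      ucov (fun t => col_mx (r t w) (e t w)) S0) /\
      (forall tau, (fun N => sample_cov (fun t => col_mx (r t w) (e t w)) N tau) @ \oo --> Rre tau)}.
      by apply: filterS2 hcov2 hcov.
    have pf : ProperFilter (almost_everywhere P).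
      apply: ae_properfilter_algebraOfSetsType.
      by rewrite [X in (_ < X)%E](probability_setT P) lte01.
    exact: (filter_ex hex).
  exact: (ucov_unique hw1 hw2).
rewrite hS0 in hRre hexc.
have [dsum nsum d00 _] := hfr.
have hd : asum (fun k => `|den k|) by apply: cvg_asum dsum => k.
have [c1 [c2 [C0 [c10 htoep]]]] :=
  toepform_bounds hh1 hd d00 hRre de0 (excitation_spectrum_lb hexc) c0 hc.
have [Bd hBd] := cov_summable_bd hRre.
have hnn := order_growth hninf de0' hgrow.
(* From here on one path is fixed and the argument is deterministic; [b1] and [b2] are constants of
   this path. *)
apply: filterS3 hcov2 hdyn hfilt => w [hp hucov] hdw hfw.
have [b1 [b2 [b10 b20 hR]]] := Rhat_qbd hfw hh hp hucov hBd c10 htoep hnn.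
have state_eq t : x (t + 1) w = canonical_AK a *m x t w + row_mx B K *m z w t.
  have [hx hy'] := hdw t; rewrite hx -hAK mul_row_col hy' mulmxDr mulmxBl mulmxA.
  by rewrite [X in _ = _ + X]addrCA [RHS]addrA subrK [RHS]addrA.
have output_eq t : y t w = e1row R m.+1 *m x t w + e t w by rewrite -hC; have [_] := hdw t.
have es t : e t w 0 0 = col_mx (r t w) (e t w) (rshift nu 0) 0 by rewrite col_mxEd.
have S_white k j : S0 k.+1%:Z (rshift nu 0) j = 0.
  by rewrite /S0 /block_mx col_mxEd mul0r raddf0 row_mx0 mxE.
have hzy : pbd (fun t => sqn (z w t)) -> pbd (fun t => sqn (y t w)).
  by apply: pbd_le => t; rewrite sqn_col_mx lerDr sqn_ge0.
have close tau : 0 < tau -> exists N0, forall N, (N0 <= N)%N ->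
    sqn (a_wls m.+1 (Rn w N) (gn w N) - a) <= tau /\
    (Lambda_wls m.+1 (Rn w N) (gn w N) \in unitmx ->
     sqn (eta_wls m.+1 (Rn w N) (gn w N) - rvec (row_mx B K)) <= tau).
  move=> tau0; have [d1 d10 hd1] := estimates_close stab obs ctr b10 b20 tau0.
  have [N1 hN1] := ghat_close state_eq output_eq hfw hh hh1 hp hucov hzy es S_white hnn stab b10 b20 hR d10.
  have [N2 hN2] := hR; have [N3 hN3] := hnn (m.+1 + m.+1)%N.
  exists (maxn N1 (maxn N2 N3)) => N; rewrite !geq_max => /and3P[h1 h2 h3].
  by apply: hd1; [have [] := hN3 N h3 | exact: hN2 | exact: hN1].
split; apply: sqn_cvg => tau tau0; have [N0 hN0] := close tau tau0.
  by exists N0 => // N hN1; have [] := hN0 N hN1.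
rewrite near_withinE; exists N0 => // N hN1 hL; have [_] := hN0 N hN1; exact.
Qed.
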